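(* Let $d\ge1$ and $0<\beta<2$. Let $b$ be a bounded function on $\mathbb{R}^d\times\mathbb{R}^d$ such that $b(x,z)=b(x,-z)$ for all $x,z\in\mathbb{R}^d$ and such that $x\mapsto b(x,z)$ is continuous for a.e. $z\in\mathbb{R}^d$. Then $q^b(t,x,y)\ge0$ on $(0,\infty)\times\mathbb{R}^d\times\mathbb{R}^d$ if and only if for each $x\in\mathbb{R}^d$, $b(x,z)\ge0$ for a.e. $z\in\mathbb{R}^d$.
   Context: $b$ is real-valued and measurable. For $f\in C_b^2(\mathbb{R}^d)$, $\mathcal{S}^bf(x)=\int_{\mathbb{R}^d}(f(x+z)-f(x)-\nabla f(x)\cdot z\,\mathbf 1_{\{|z|\le1\}})\frac{b(x,z)}{|z|^{d+\beta}}dz$, and $\mathcal{S}^b_zg(s,z,y)$ means $\mathcal{S}^b$ applied to $z\mapsto g(s,z,y)$. For $a\ge0$, $p_a(t,x,y)=(2\pi)^{-d}\int_{\mathbb{R}^d}e^{-i(x-y)\cdot\xi}e^{-t(|\xi|^2+a|\xi|^\beta)}d\xi$ is the heat kernel of $\Delta+a\Delta^{\beta/2}$. For bounded $b$ with $b(x,z)=b(x,-z)$, $q^b(t,x,y)$ denotes the fundamental solution of $\mathcal{L}^b=\Delta+\mathcal{S}^b$: it is the unique continuous function on $(0,\infty)\times\mathbb{R}^d\times\mathbb{R}^d$ satisfying the Chapman–Kolmogorov equation $\int q^b(t,x,z)q^b(s,z,y)dz=q^b(t+s,x,y)$ for all $s,t>0$, and, for some $\varepsilon,c_1,c_2>0$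 and all $(t,x,y)\in(0,\varepsilon]\times\mathbb{R}^d\times\mathbb{R}^d$, $|q^b(t,x,y)|\le c_1p_1(t,c_2x,c_2y)$ and $q^b(t,x,y)=p_0(t,x,y)+\int_0^t\int_{\mathbb{R}^d}q^b(t-s,x,z)\mathcal{S}^b_zp_0(s,z,y)\,dz\,ds$. *)

(* Defs.v *)
From HB Require Import structures.
From mathcomp Require Import all_boot all_order all_algebra.
From mathcomp Require Import all_classical all_reals all_analysis.
From mathcomp Require Import complex.

Set Implicit Arguments.
Unset Strict Implicit.
Unset Printing Implicit Defensive.

Import Order.TTheory GRing.Theory Num.Theory.
Import numFieldNormedType.Exports.

Local Open Scope classical_set_scope.
Local Open Scope ring_scope.

Definition rV_display : measure_display -> measure_display.
Proof. exact. Qed.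

Section measurable_rV.
Context {d : measure_display} {T : measurableType d} {n : nat}.

Let coord (i : 'I_n) (x : 'rV[T]_n) : T := x ord0 i.

Let rV_set0 : g_sigma_preimage coord set0.
Proof. exact: sigma_algebra0. Qed.

Let rV_setC A : g_sigma_preimage coord A -> g_sigma_preimage coord (~` A).
Proof. exact: sigma_algebraC. Qed.

Let rV_bigcup (F : (set 'rV[T]_n)^nat) :
  (forall i, g_sigma_preimage coord (F i)) ->
  g_sigma_preimage coord (\bigcup_i (F i)).
Proof. exact: sigma_algebra_bigcup. Qed.

(* The product sigma-algebra; for T = R it is the Borel sigma-algebra of R^n. *)
HB.instance Definition _ := @isMeasurable.Build (rV_display d)
  'rV[T]_n (g_sigma_preimage coord) rV_set0 rV_setC rV_bigcup.

End measurable_rV.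

Section rV_cons.
Context {T : Type}.

(* [rV_cons (t, x)] is the row vector with first coordinate t, then those of x. *)
Definition rV_cons n (p : T * 'rV[T]_n) : 'rV[T]_n.+1 :=
  \row_(i < n.+1) oapp (p.2 ord0) p.1 (unlift ord0 i).

Lemma rV_cons0 n (p : T * 'rV[T]_n) : rV_cons p ord0 ord0 = p.1.
Proof. by rewrite mxE unlift_none. Qed.

Lemma rV_cons_lift n (p : T * 'rV[T]_n) i :
  rV_cons p ord0 (lift ord0 i) = p.2 ord0 i.
Proof. by rewrite mxE liftK. Qed.

Definition rV_uncons n (x : 'rV[T]_n.+1) : T * 'rV[T]_n :=
  (x ord0 ord0, \row_i x ord0 (lift ord0 i)).

Lemma rV_consK n : cancel (@rV_cons n) (@rV_uncons n).
Proof.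
move=> [t x]; congr (_, _); first exact: rV_cons0.
by apply/rowP => i; rewrite mxE rV_cons_lift.
Qed.

End rV_cons.

Section measurable_rV_cons.
Context {d : measure_display} {T : measurableType d}.

Lemma measurable_coord n (i : 'I_n) :
  measurable_fun setT (fun x : 'rV[T]_n => x ord0 i).
Proof.
move=> _ Y mY; rewrite setTI; apply: sub_sigma_algebra => /=.
rewrite -bigcup_seq/=; exists i => /=; first by rewrite mem_index_enum.
by exists Y => //; rewrite setTI.
Qed.

Lemma measurable_fun_coordP d1 (T1 : measurableType d1) n (f : T1 -> 'rV[T]_n) :
  (forall i, measurable_fun setT (fun x => f x ord0 i)) ->
  measurable_fun setT f.
Proof.
move=> mf.
pose G := \big[setU/set0]_(i < n)
  preimage_set_system setT (fun x : 'rV[T]_n => x ord0 i) measurable.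
apply: (measurability G) => //.
move=> _ [C GC <-]; move: GC; rewrite /G -bigcup_seq => -[i _ [B mB <-]].
by rewrite setTI setTI -[X in measurable X]setTI; exact: mf.
Qed.

Lemma measurable_rV_cons n : measurable_fun setT (@rV_cons T n).
Proof.
apply: measurable_fun_coordP => i; case: (unliftP ord0 i) => [j|] ->.
- under eq_fun do rewrite rV_cons_lift.
  exact: (measurableT_comp (measurable_coord j) measurable_snd).
- by under eq_fun do rewrite rV_cons0; exact: measurable_fst.
Qed.

Lemma measurable_rV_uncons n : measurable_fun setT (@rV_uncons T n).
Proof.
apply: measurable_fun_pair; first exact: measurable_coord.
apply: measurable_fun_coordP => i; under eq_fun do rewrite mxE.
exact: measurable_coord.
Qed.

End measurable_rV_cons.

Section lebesgue_rV.
Context {R : realType}.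

(* Lebesgue measure on R^n (Borel sets), by recursion: R^0 carries the unit mass
   and R^n.+1 the image of the product of Lebesgue measure on R and on R^n. *)
Section step.
Variables (n : nat) (m : {sigma_finite_measure set 'rV[R]_n -> \bar R}).

Definition lebesgue_rV_step : set 'rV[R]_n.+1 -> \bar R :=
  pushforward (lebesgue_measure \x m)%E
    (fun p : measurableTypeR R * 'rV[R]_n => @rV_cons R n p).

Let mcons : measurable_fun setT
  (fun p : measurableTypeR R * 'rV[R]_n => @rV_cons R n p).
Proof.
move=> _ A mA.
by have := @measurable_rV_cons _ R n measurableT A mA.
Qed.

Let step0 : lebesgue_rV_step set0 = 0%E.
Proof. by rewrite /lebesgue_rV_step /pushforward preimage_set0 measure0. Qed.

Let step_ge0 A : (0 <= lebesgue_rV_step A)%E.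
Proof. exact: (@measure_ge0 _ _ _ (lebesgue_measure \x m)%E). Qed.

Let step_sigma_additive : semi_sigma_additive lebesgue_rV_step.
Proof.
move=> F mF tF mUF; rewrite /lebesgue_rV_step /pushforward preimage_bigcup.
apply: (@measure_semi_sigma_additive _ _ _ (lebesgue_measure \x m)%E).
- by move=> i; rewrite -[X in measurable X]setTI; exact: mcons.
- apply/trivIsetP => /= i j _ _ ij; rewrite -preimage_setI.
  by move/trivIsetP : tF => /(_ _ _ _ _ ij) ->//; rewrite preimage_set0.
- by rewrite -preimage_bigcup -[X in measurable X]setTI; exact: mcons.
Qed.

HB.instance Definition _ := isMeasure.Build _ _ _ lebesgue_rV_step
  step0 step_ge0 step_sigma_additive.

Let step_sigma_finite : sigma_finite setT lebesgue_rV_step.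
Proof.
have /sigma_finiteP[F [FT ndF Foo]] :=
  sigma_finiteT (@lebesgue_measure R : {sigma_finite_measure set _ -> \bar R}).
have /sigma_finiteP[G [GT ndG Goo]] := sigma_finiteT m.
exists (fun k => [set x | F k (rV_uncons x).1 /\ G k (rV_uncons x).2]).
  apply/esym; rewrite -subTset => x _.
  have : [set: measurableTypeR R] (rV_uncons x).1 by [].
  rewrite FT => -[i _ Fi].
  have : [set: 'rV[R]_n] (rV_uncons x).2 by [].
  rewrite GT => -[j _ Gj].
  exists (maxn i j) => //; split.
  - by move: Fi; exact/subsetPset/ndF/leq_maxl.
  - by move: Gj; exact/subsetPset/ndG/leq_maxr.
move=> k; have [mF Fk] := Foo k; have [mG Gk] := Goo k; split.
  have mFG : @measurable _ (R * 'rV[R]_n)%type (F k `*` G k).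
    exact: (@measurableX _ _ R 'rV[R]_n).
  have := @measurable_rV_uncons _ R n measurableT _ mFG.
  by rewrite setTI.
rewrite /lebesgue_rV_step /pushforward.
rewrite [X in product_measure1 _ _ X](_ : _ = F k `*` G k).
  by rewrite product_measure1E// lte_mul_pinfty// ge0_fin_numE.
by apply/funext => p; rewrite /preimage /mkset (@rV_consK R n p).
Qed.

HB.instance Definition _ := @Measure_isSigmaFinite.Build _ _ _
  lebesgue_rV_step step_sigma_finite.
End step.

Fixpoint lebesgue_rV n : {sigma_finite_measure set 'rV[R]_n -> \bar R} :=
  match n with
  | 0 => \d_(0 : 'rV[R]_0)
  | n'.+1 => lebesgue_rV_step (lebesgue_rV n')
  end.

Lemma lebesgue_rV_box n (u v : 'rV[R]_n) :
  (forall i, u ord0 i <= v ord0 i) ->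
  lebesgue_rV n [set x | forall i, u ord0 i <= x ord0 i <= v ord0 i] =
  (\prod_(i < n) (v ord0 i - u ord0 i))%:E.
Proof.
elim: n u v => [|n IH] u v uv /=.
  by rewrite big_ord0 diracE mem_set// => -[].
pose w (x : 'rV[R]_n.+1) := (rV_uncons x).2.
pose A : set (measurableTypeR R) := `[u ord0 ord0, v ord0 ord0]%classic.
pose B := [set x : 'rV[R]_n | forall i, w u ord0 i <= x ord0 i <= w v ord0 i].
have mA : measurable A by exact: measurable_itv.
have mB : measurable B.
  rewrite (_ : B = \big[setI/setT]_(i < n)
      [set x : 'rV[R]_n | x ord0 i \in `[w u ord0 i, w v ord0 i]]).
    apply: bigsetI_measurable => i _.
    rewrite -[X in measurable X]setTI.
    exact: (@measurable_coord _ R n i measurableT _ (measurable_itv _)).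
  rewrite -bigcap_seq; apply/seteqP; split => x /= h i.
    by move=> _ /=; rewrite in_itv/=; exact: h.
  by have /= := h i; rewrite in_itv/=; apply; rewrite mem_index_enum.
transitivity ((lebesgue_measure \x lebesgue_rV n)%E (A `*` B)).
  rewrite /lebesgue_rV_step /pushforward; congr product_measure1.
  apply/seteqP; split => -[t x]/=.
    move=> h; split => /=.
      by have := h ord0; rewrite rV_cons0 /A/= in_itv.
    by move=> i; have := h (lift ord0 i); rewrite rV_cons_lift !mxE.
  rewrite /A/= in_itv/= => -[h0 h] i.
  case: (unliftP ord0 i) => [j|] ->; last by rewrite rV_cons0.
  by rewrite rV_cons_lift; have := h j; rewrite !mxE.
rewrite product_measure1E// big_ord_recl EFinM; congr (_ * _)%E.
  rewrite [LHS]lebesgue_measure_itv/= lte_fin; case: ltP => //.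
  move=> vu; have -> : u ord0 ord0 = v ord0 ord0.
    by apply/eqP; rewrite eq_le uv vu.
  by rewrite subrr.
rewrite /B IH; last by move=> i; rewrite !mxE.
by congr EFin; apply: eq_bigr => i _; rewrite !mxE.
Qed.

End lebesgue_rV.

Section nonlocal_operator.
Context {R : realType} {d : nat}.
Implicit Types (x y z xi : 'rV[R]_d) (f : 'rV[R]_d -> R).

Definition dotrV x y : R := \sum_(i < d) x ord0 i * y ord0 i.

(* The Euclidean norm; the library norm `|x| on 'rV[R]_d is the sup norm. *)
Definition enorm x : R := Num.sqrt (dotrV x x).

Definition gradient f x : 'rV[R]_d := \row_i 'D_(delta_mx ord0 i) f x.

(* The integrand is meaningless at z = 0 only, which is Lebesgue negligible
   when 0 < d. *)
Definition nonlocal_op (beta : R) (b : 'rV[R]_d -> 'rV[R]_d -> R) f x : R :=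
  \int[lebesgue_rV d]_z
    ((f (x + z) - f x - dotrV (gradient f x) z * \1_[set w | enorm w <= 1] z)
     * (b x z / enorm z `^ (d%:R + beta))).

Definition cexpi (theta : R) : R[i] := (cos theta +i* sin theta)%C.

Definition cintegral (h : 'rV[R]_d -> R[i]) : R[i] :=
  ((\int[lebesgue_rV d]_x complex.Re (h x)) +i*
   (\int[lebesgue_rV d]_x complex.Im (h x)))%C.

(* [heat_kernel beta a] is p_a. The Fourier integral is real, as its imaginary
   part integrates an odd function, so that taking the real part only changes
   the type. *)
Definition heat_kernel (beta a t : R) x y : R :=
  complex.Re
    ((((2 * pi) ^- d)%:C)%C *
     cintegral (fun xi =>
       cexpi (- dotrV (x - y) xi) *
       ((expR (- t * (enorm xi ^+ 2 + a * enorm xi `^ beta)))%:C)%C)).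

Definition chapman_kolmogorov (q : R -> 'rV[R]_d -> 'rV[R]_d -> R) : Prop :=
  forall (s t : R) x y, 0 < s -> 0 < t ->
    \int[lebesgue_rV d]_z (q t x z * q s z y) = q (t + s) x y.

(* The values of q at times t <= 0 are irrelevant. *)
Record is_fundamental_solution (beta : R) (b : 'rV[R]_d -> 'rV[R]_d -> R)
    (q : R -> 'rV[R]_d -> 'rV[R]_d -> R) : Prop := {
  fundsol_continuous :
    {within [set p : R * 'rV[R]_d * 'rV[R]_d | 0 < p.1.1],
      continuous (fun p => q p.1.1 p.1.2 p.2)} ;
  fundsol_chapman_kolmogorov : chapman_kolmogorov q ;
  fundsol_duhamel : exists eps c1 c2 : R,
    [/\ 0 < eps, 0 < c1, 0 < c2 &
      forall (t : R) x y, 0 < t <= eps ->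
        `|q t x y| <= c1 * heat_kernel beta 1 t (c2 *: x) (c2 *: y) /\
        q t x y = heat_kernel beta 0 t x y +
          \int[lebesgue_measure]_(s in `]0, t[)
            \int[lebesgue_rV d]_z
              (q (t - s) x z *
               nonlocal_op beta b (fun w => heat_kernel beta 0 s w y) z)]
}.

End nonlocal_operator.

(* Main.v *)
From HB Require Import structures.
Require Import Defs.
From mathcomp Require Import all_boot all_order all_algebra.
From mathcomp Require Import all_classical all_reals all_analysis.
From mathcomp Require Import measurable_realfun complex ring lra.
Set Implicit Arguments.
Unset Strict Implicit.
Unset Printing Implicit Defensive.
Import Order.TTheory GRing.Theory Num.Theory.
Import numFieldNormedType.Exports.
Local Open Scope classical_set_scope.
Local Open Scope ring_scope.

(** Fix a starting point [x] and a short time [t0], and read [(t, y) |-> q t x y] on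
    the times ]0, t0[ as the density [qst] of a signed measure Q on space-time. Two
    estimates make everything below absolutely convergent. The domination of [q] by the
    kernel with a stable part, whose mass is computed on the Fourier side
    ([int_stable_kernel_le]), shows that Q is finite. On the heat kernel the nonlocal
    operator is an average of second differences ([nonlocal_op_gk]), whose total mass
    is at most 4 min(1, |w|^2 / 4 s) ([int_gkD2_min]); hence the perturbation kernel
    [stk] is integrable, with a mass that tends to 0 with t0 ([int_norm_stk]). Testing
    the Duhamel formula with a bounded function phi on ]0, t0[ x R^d gives
      Q(phi) = U phi (0, x) + Q(K phi)    ([int_qst_duhamel]),
    where U phi is the heat potential of phi, and K phi, the function with kernel [stk],
    is the nonlocal operator applied to U phi ([kop_stk]).

    Suppose that b is nonnegative. The Neumann series for phi - K phi = psi >= 0 turns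
    the identity into Q(psi) = U phi (0, x), so it remains to see that U phi >= 0, which
    is a maximum principle. When the jumps smaller than dl are removed, the total rate
    of the jumps is bounded by a constant k, and phi - K phi >= - eta reads
    phi + k U phi >= - eta + N(U phi) with a positive operator N of mass k. As U phi is
    also the potential of phi + k U phi for the heat semigroup killed at rate k
    ([potential_resolvent]), a lower bound for this function improves itself
    geometrically ([potential_ge]). The errors made by stopping the Neumann series and
    by truncating the jumps tend to 0 ([qst_psi_truncated]); thus Q(psi) >= 0 for all
    psi >= 0, so q >= 0 at short times by continuity ([fundsol_ge0_small]), and at all
    times by the Chapman--Kolmogorov equation.

    Suppose that q is nonnegative, and let f >= 0 be smooth and bounded, with a zero of
    order four at x. With phi(s, y) = f(y) on ]0, t0[, the left-hand side of the
    identity is nonnegative, and the potential is of order t0^3. Near x the nonlocal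
    operator sends f to approximately L, the integral of f(x + w) b(x, w) / |w|^(d + beta)
    in w; as the mass of q behaves like that of the heat kernel ([int_qst_left]) and
    little of it leaves a neighbourhood of x ([int_qst_bump]), the last term is
    L t0^2 / 2 up to terms of order t0^3 or small compared with t0^2. Letting t0 tend
    to 0 gives L >= 0 ([jump_mean_ge0]). The functions f available form an algebra, whose
    closure in L^1 contains the indicators of all measurable sets
    ([approximable_measurable]), and this forces b(x, w) >= 0 for almost every w. *)

(** * Integration of real-valued functions over product spaces *)

Section prodm.
Context (R : realType) d1 d2 (T1 : measurableType d1) (T2 : measurableType d2).
Variables (m1 : {sigma_finite_measure set T1 -> \bar R}).
Variables (m2 : {sigma_finite_measure set T2 -> \bar R}).

(** The product measure, bundled so that it can itself enter a product. *)
Definition prodm : set (T1 * T2) -> \bar R := (m1 \x m2)%E.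
HB.instance Definition _ := Measure.on prodm.

Let prodm_sigma_finite : sigma_finite setT prodm.
Proof.
have /sigma_finiteP[F [TF ndF Foo]] := sigma_finiteT m1.
have /sigma_finiteP[G [TG ndG Goo]] := sigma_finiteT m2.
exists (fun n => F n `*` G n).
  rewrite -setXTT TF TG predeqE => -[x y]; split.
    move=> [/= [n _ Fnx] [k _ Gky]]; exists (maxn n k) => //; split.
    - by move: x Fnx; exact/subsetPset/ndF/leq_maxl.
    - by move: y Gky; exact/subsetPset/ndG/leq_maxr.
  by move=> [n _ []/= ? ?]; split; exists n.
move=> k; have [? ?] := Foo k; have [? ?] := Goo k.
split; first exact: measurableX.
by rewrite /prodm product_measure1E// lte_mul_pinfty// ge0_fin_numE.
Qed.

HB.instance Definition _ := @Measure_isSigmaFinite.Build _ _ _ prodm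
  prodm_sigma_finite.
End prodm.

Notation rintegrable mu f := (integrable mu setT (fun x => (f x)%:E)).

Section real_integral.
Context d (T : measurableType d) (R : realType).
Variable mu : {measure set T -> \bar R}.
Implicit Types f g : T -> R.

Lemma measurable_EFinW f : measurable_fun setT f ->
  measurable_fun setT (fun x => (f x)%:E).
Proof. by move=> mf; exact/measurable_EFinP. Qed.

Lemma rintegrable_measurable f : rintegrable mu f -> measurable_fun setT f.
Proof. by move=> /integrableP[/measurable_EFinP]. Qed.

Lemma rintegrableP f : measurable_fun setT f ->
  (\int[mu]_x (`|f x|)%:E < +oo)%E -> rintegrable mu f.
Proof. by move=> mf fi; apply/integrableP; split=> //; exact/measurable_EFinP. Qed.

Lemma rintegrable_lty f : rintegrable mu f -> (\int[mu]_x (`|f x|)%:E < +oo)%E.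
Proof. by move=> /integrableP[]. Qed.

Lemma rintegrable_bound f (c : R) : measurable_fun setT f ->
  (\int[mu]_x (`|f x|)%:E <= c%:E)%E -> rintegrable mu f.
Proof. by move=> mf fi; apply: rintegrableP => //; apply: le_lt_trans fi (ltry _). Qed.

Lemma rintegrable_dominated f g : measurable_fun setT f -> rintegrable mu g ->
  (forall x, `|f x| <= g x) -> rintegrable mu f.
Proof.
move=> mf gi fg; apply: (le_integrable measurableT _ _ gi).
  exact/measurable_EFinP.
move=> x _ /=; rewrite lee_fin (le_trans (fg x))//; exact: ler_norm.
Qed.

Lemma rintegrableD f g : rintegrable mu f -> rintegrable mu g ->
  rintegrable mu (fun x => f x + g x).
Proof.
move=> fi gi; under eq_fun do rewrite EFinD.
exact: (integrableD measurableT fi gi).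
Qed.

Lemma rintegrableB f g : rintegrable mu f -> rintegrable mu g ->
  rintegrable mu (fun x => f x - g x).
Proof.
move=> fi gi; under eq_fun do rewrite EFinB.
exact: (integrableB measurableT fi gi).
Qed.

Lemma rintegrableZl (c : R) f : rintegrable mu f ->
  rintegrable mu (fun x => c * f x).
Proof.
move=> fi; under eq_fun do rewrite EFinM.
exact: (integrableZl measurableT c fi).
Qed.

Lemma rintegrableN f : rintegrable mu f -> rintegrable mu (fun x => - f x).
Proof.
move=> fi; under eq_fun do rewrite -mulN1r.
exact: rintegrableZl.
Qed.

Lemma rintegrable_norm f : rintegrable mu f -> rintegrable mu (fun x => `|f x|).
Proof. by move=> fi; exact: (integrable_norm fi). Qed.

Lemma rintegrable_mulr f g (c : R) : rintegrable mu f -> measurable_fun setT g ->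
  (forall x, `|g x| <= c) -> rintegrable mu (fun x => f x * g x).
Proof.
move=> fi mg gc; have mf := rintegrable_measurable fi.
apply: (@rintegrable_dominated _ (fun x => c * `|f x|)).
- exact: measurable_funM.
- exact/rintegrableZl/rintegrable_norm.
- by move=> x; rewrite normrM mulrC ler_wpM2r.
Qed.

Lemma EFin_Rint f : rintegrable mu f ->
  (\int[mu]_x f x)%:E = (\int[mu]_x (f x)%:E)%E.
Proof. by move=> fi; rewrite fineK//; exact: integrable_fin_num. Qed.

Lemma RintD f g : rintegrable mu f -> rintegrable mu g ->
  \int[mu]_x (f x + g x) = \int[mu]_x f x + \int[mu]_x g x.
Proof. exact: RintegralD. Qed.

Lemma RintB f g : rintegrable mu f -> rintegrable mu g ->
  \int[mu]_x (f x - g x) = \int[mu]_x f x - \int[mu]_x g x.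
Proof. exact: RintegralB. Qed.

Lemma RintZl (c : R) f : rintegrable mu f ->
  \int[mu]_x (c * f x) = c * \int[mu]_x f x.
Proof. exact: RintegralZl. Qed.

Lemma RintN f : rintegrable mu f -> \int[mu]_x (- f x) = - \int[mu]_x f x.
Proof. by move=> fi; rewrite -mulN1r -RintZl//; under eq_Rintegral do rewrite -mulN1r. Qed.

Lemma le_Rint f g : rintegrable mu f -> rintegrable mu g ->
  (forall x, f x <= g x) -> \int[mu]_x f x <= \int[mu]_x g x.
Proof. by move=> fi gi fg; apply: le_Rintegral. Qed.

Lemma eq_Rint f g : (forall x, f x = g x) -> \int[mu]_x f x = \int[mu]_x g x.
Proof. by move=> fg; apply: eq_Rintegral => x _; exact: fg. Qed.

Lemma eq_int (f g : T -> \bar R) : (forall x, f x = g x) ->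
  (\int[mu]_x f x = \int[mu]_x g x)%E.
Proof. by move=> fg; apply: eq_integral => x _; exact: fg. Qed.

Lemma Rint_norm_le f (c : R) : measurable_fun setT f ->
  (\int[mu]_x (`|f x|)%:E <= c%:E)%E -> `|\int[mu]_x f x| <= c.
Proof.
move=> mf fc; have fi := rintegrable_bound mf fc.
rewrite -lee_fin (EFin_normr_Rintegral _ fi)//.
by apply: le_trans fc; apply: le_abse_integral => //; exact/measurable_EFinP.
Qed.

Lemma Rint_norm_leE f : measurable_fun setT f ->
  ((`|\int[mu]_x f x|)%:E <= \int[mu]_x (`|f x|)%:E)%E.
Proof.
move=> mf; have [fi|] := ltP (\int[mu]_x (`|f x|)%:E)%E +oo%E.
  rewrite (EFin_normr_Rintegral _ (rintegrableP mf fi))//.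
  by apply: le_abse_integral => //; exact/measurable_EFinP.
by rewrite leye_eq => /eqP ->; rewrite leey.
Qed.

Lemma Rint_norm f : rintegrable mu f ->
  `|\int[mu]_x f x| <= \int[mu]_x `|f x|.
Proof. exact: le_normr_Rintegral. Qed.

Lemma ge0_le_int f g : measurable_fun setT f -> measurable_fun setT g ->
  (forall x, 0 <= f x) -> (forall x, f x <= g x) ->
  (\int[mu]_x (f x)%:E <= \int[mu]_x (g x)%:E)%E.
Proof.
move=> mf mg f0 fg; apply: ge0_le_integral => //.
- by move=> x _; rewrite lee_fin.
- exact/measurable_EFinP.
- exact/measurable_EFinP.
- by move=> x _; rewrite lee_fin.
Qed.

Lemma ge0_intZl (c : R) f : 0 <= c -> measurable_fun setT f ->
  (forall x, 0 <= f x) ->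
  (\int[mu]_x (c * f x)%:E = c%:E * \int[mu]_x (f x)%:E)%E.
Proof.
move=> c0 mf f0; under eq_int do rewrite EFinM.
apply: ge0_integralZl_EFin => //; first by move=> x _; rewrite lee_fin.
exact/measurable_EFinP.
Qed.

Lemma ae_eq_Rint f g : measurable_fun setT f -> measurable_fun setT g ->
  {ae mu, forall x, f x = g x} -> \int[mu]_x f x = \int[mu]_x g x.
Proof.
move=> mf mg fg; congr fine; apply: ae_eq_integral => //.
- exact/measurable_EFinP.
- exact/measurable_EFinP.
- by apply: filterS fg => x -> _.
Qed.

Lemma Rint_cvg (f_ : nat -> T -> R) f g : (forall n, measurable_fun setT (f_ n)) ->
  measurable_fun setT f -> rintegrable mu g ->
  {ae mu, forall x, f_ ^~ x @ \oo --> f x} ->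
  (forall n x, `|f_ n x| <= g x) ->
  (\int[mu]_x f_ n x) @[n --> \oo] --> \int[mu]_x f x.
Proof.
move=> mf_ mf gi cf fg.
have mE (h : T -> R) : measurable_fun setT h -> measurable_fun setT (EFin \o h).
  by move=> mh; exact/measurable_EFinP.
have cE : {ae mu, forall x, setT x ->
    (fun n => (f_ n x)%:E) @ \oo --> (f x)%:E}.
  apply: filterS cf => x h _; apply: cvg_EFin => //.
  exact: nearW.
have dE : {ae mu, forall x n, setT x -> (`|(f_ n x)%:E| <= (g x)%:E)%E}.
  by apply: aeW => x n _; rewrite /= lee_fin.
have [fi _ cvg] := dominated_convergence measurableT
  (fun n => mE _ (mf_ n)) (mE _ mf) cE gi dE.
by apply: fine_cvg; rewrite (EFin_Rint fi).
Qed.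

End real_integral.

Section two_spaces.
Context (R : realType) d1 d2 (X : measurableType d1) (Y : measurableType d2).
Variables (mX : {sigma_finite_measure set X -> \bar R}).
Variables (mY : {sigma_finite_measure set Y -> \bar R}).
Implicit Types f : X * Y -> R.

Lemma measurable_section1 f (x : X) : measurable_fun setT f ->
  measurable_fun setT (fun y => f (x, y)).
Proof. by move=> mf; apply: measurableT_comp. Qed.

Lemma measurable_section2 f (y : Y) : measurable_fun setT f ->
  measurable_fun setT (fun x => f (x, y)).
Proof. by move=> mf; apply: measurableT_comp. Qed.

Lemma ge0_int_prod f : measurable_fun setT f -> (forall p, 0 <= f p) ->
  (\int[prodm mX mY]_p (f p)%:E = \int[mX]_x \int[mY]_y (f (x, y))%:E)%E.
Proof.
move=> mf f0; apply: (fubini_tonelli1 (fun p => (f p)%:E)).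
  exact/measurable_EFinP.
by move=> p; rewrite lee_fin.
Qed.

Lemma ge0_int_swap f : measurable_fun setT f -> (forall p, 0 <= f p) ->
  (\int[mX]_x \int[mY]_y (f (x, y))%:E = \int[mY]_y \int[mX]_x (f (x, y))%:E)%E.
Proof.
move=> mf f0; apply: (fubini_tonelli (fun p => (f p)%:E)).
  exact/measurable_EFinP.
by move=> p; rewrite lee_fin.
Qed.

Lemma measurable_int f : measurable_fun setT f -> (forall p, 0 <= f p) ->
  measurable_fun setT (fun x => \int[mY]_y (f (x, y))%:E)%E.
Proof.
move=> mf f0; apply: (measurable_fun_fubini_tonelli_F (fun p => (f p)%:E)).
  exact/measurable_EFinP.
by move=> p; rewrite lee_fin.
Qed.

Lemma measurable_Rint f : measurable_fun setT f ->
  measurable_fun setT (fun x => \int[mY]_y f (x, y)).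
Proof.
move=> mf; have mE : measurable_fun setT (EFin \o f) by exact/measurable_EFinP.
apply: (measurableT_comp (@fine_measurable _ setT measurableT)).
under eq_fun do rewrite integralE.
apply: emeasurable_funB.
- rewrite (_ : (fun _ => _) = fubini_F mY ((EFin \o f)^\+)%E).
    apply: measurable_fun_fubini_tonelli_F => //.
    exact: measurable_funepos.
  by apply/funext => x; apply: eq_int => y; rewrite !funeposE.
- rewrite (_ : (fun _ => _) = fubini_F mY ((EFin \o f)^\-)%E).
    apply: measurable_fun_fubini_tonelli_F => //.
    exact: measurable_funeneg.
  by apply/funext => x; apply: eq_int => y; rewrite !funenegE.
Qed.

Lemma rintegrable_prodP f : measurable_fun setT f ->
  (\int[mX]_x \int[mY]_y (`|f (x, y)|)%:E < +oo)%E -> rintegrable (prodm mX mY) f.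
Proof.
move=> mf fi; apply: rintegrableP => //; rewrite ge0_int_prod//.
exact: measurableT_comp.
Qed.

Lemma ae_rintegrable f : rintegrable (prodm mX mY) f ->
  {ae mX, forall x, rintegrable mY (fun y => f (x, y))}.
Proof. exact: ae_integrable1. Qed.

Lemma Rint_prod f : rintegrable (prodm mX mY) f ->
  \int[prodm mX mY]_p f p = \int[mX]_x \int[mY]_y f (x, y).
Proof.
move=> fi; rewrite /Rintegral -[X in fine X](integral12_prod_meas1 fi).
congr fine; apply: ae_eq_integral => //.
- exact: (measurable_fubini_F fi).
- exact: (@measurable_EFinW _ _ _ (fun x => \int[mY]_y f (x, y))
    (measurable_Rint (rintegrable_measurable fi))).
- by apply: filterS (ae_rintegrable fi) => x fx _; rewrite /fubini_F (EFin_Rint fx).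
Qed.

Lemma int_norm_Rint_le f : measurable_fun setT f ->
  (\int[mX]_x (`|\int[mY]_y f (x, y)|)%:E
    <= \int[mX]_x \int[mY]_y (`|f (x, y)|)%:E)%E.
Proof.
move=> mf; have mn : measurable_fun setT (fun p => `|f p|) by exact: measurableT_comp.
apply: ge0_le_integral => //.
- by apply/measurable_EFinP; apply: measurableT_comp => //; exact: measurable_Rint.
- exact: (measurable_int mn).
- by move=> x _; apply: Rint_norm_leE; exact: (@measurable_section1 f).
Qed.

Lemma rintegrable_Rint f : rintegrable (prodm mX mY) f ->
  rintegrable mX (fun x => \int[mY]_y f (x, y)).
Proof.
move=> fi; have mf := rintegrable_measurable fi.
apply: rintegrableP; first exact: measurable_Rint.
apply: le_lt_trans (int_norm_Rint_le mf) _.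
rewrite -(@ge0_int_prod (fun p => `|f p|))//; last exact: measurableT_comp.
exact: rintegrable_lty.
Qed.

End two_spaces.

Lemma Rint_swap (R : realType) d1 d2 (X : measurableType d1) (Y : measurableType d2)
    (mX : {sigma_finite_measure set X -> \bar R})
    (mY : {sigma_finite_measure set Y -> \bar R}) (f : X * Y -> R) :
  rintegrable (prodm mX mY) f ->
  \int[mX]_x \int[mY]_y f (x, y) = \int[mY]_y \int[mX]_x f (x, y).
Proof.
move=> fi; have mf := rintegrable_measurable fi.
rewrite -Rint_prod//.
rewrite /Rintegral -[X in fine X](integral21_prod_meas1 fi).
congr fine; apply: ae_eq_integral => //.
- exact: (measurable_fubini_G fi).
- exact: (@measurable_EFinW _ _ _ (fun y => \int[mX]_x f (x, y)) (@measurable_Rint R _ _ Y X mX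
    (fun p => f (p.2, p.1)) (measurableT_comp mf (@measurable_swap _ _ Y X)))).
- apply: filterS (ae_integrable2 fi) => y fy _; rewrite /fubini_G.
  by rewrite (EFin_Rint (f := fun x => f (x, y)) fy).
Qed.

(** * Lebesgue measure on row vectors *)

Lemma measurable_time (R : realType) :
  measurable_fun setT (fun t : measurableTypeR R => t : R).
Proof. exact: measurable_id. Qed.

Section lebesgue_line.
Context {R : realType}.
Local Notation leb := (@lebesgue_measure R).

Lemma lebesgue_measure_shift (a : R) (A : set (measurableTypeR R)) : measurable A ->
  pushforward leb (fun t : measurableTypeR R => (t + a : R) : measurableTypeR R) A = leb A.
Proof.
have msh : measurable_fun setT (fun t : measurableTypeR R => (t + a : R) : measurableTypeR R).
  by apply: measurable_funD => //; exact: measurable_time.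
move=> mA; apply/esym/lebesgue_measure_unique => //= _ [[u v]] _ <-.
rewrite /pushforward.
rewrite (_ : _ @^-1` _ = `]u - a, v - a]%classic); last first.
  by apply/seteqP; split=> x /=; rewrite !in_itv/= ltrBlDr lerBrDr.
by rewrite !lebesgue_measure_itv/= !lte_fin ltrD2r -!EFinB opprB addrA subrK.
Qed.

Lemma ge0_int_shift1 (a : R) (f : R -> \bar R) : measurable_fun setT f ->
  (forall t, 0 <= f t)%E -> (\int[leb]_t f (t + a)%R = \int[leb]_t f t)%E.
Proof.
have msh : measurable_fun setT (fun t : measurableTypeR R => (t + a : R) : measurableTypeR R).
  by apply: measurable_funD => //; exact: measurable_time.
move=> mf f0.
transitivity (\int[pushforward leb (fun t : measurableTypeR R => (t + a : R)%R : measurableTypeR R)]_t f t)%E.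
  by rewrite ge0_integral_pushforward.
apply: eq_measure_integral => A mA _; exact: lebesgue_measure_shift.
Qed.

Lemma ge0_int_opp1 (f : R -> \bar R) : measurable_fun setT f ->
  (forall t, 0 <= f t)%E -> (\int[leb]_t f (- t)%R = \int[leb]_t f t)%E.
Proof.
have msh : measurable_fun setT (fun t : measurableTypeR R => (- t : R) : measurableTypeR R).
  by apply: measurableT_comp => //; exact: measurable_time.
move=> mf f0.
transitivity (\int[pushforward leb (fun t : measurableTypeR R => (- t : R)%R : measurableTypeR R)]_t f t)%E.
  by rewrite ge0_integral_pushforward.
apply: eq_measure_integral => A mA _; exact: lebesgue_measureN.
Qed.

End lebesgue_line.

Section lebesgue_rV_integral.
Context {R : realType}.
Local Notation leb := (@lebesgue_measure R).
Local Notation "'leb_ d" := (lebesgue_rV d : {measure set 'rV[R]_d -> \bar R})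
  (at level 0, d at level 0).

Lemma int_rV0 (f : 'rV[R]_0 -> \bar R) : measurable_fun setT f ->
  (\int['leb_0]_x f x = f 0%R)%E.
Proof. by move=> mf; rewrite /= integral_dirac// diracT mul1e. Qed.

Lemma measurable_cons n : measurable_fun setT
  (fun p : measurableTypeR R * 'rV[R]_n => @rV_cons R n p).
Proof. by move=> _ A mA; have := @measurable_rV_cons _ R n measurableT A mA. Qed.

Lemma ge0_int_rVS n (f : 'rV[R]_n.+1 -> \bar R) : measurable_fun setT f ->
  (forall x, 0 <= f x)%E ->
  (\int['leb_(n.+1)]_x f x = \int[leb]_t \int['leb_n]_x f (rV_cons (t, x)))%E.
Proof.
move=> mf f0; rewrite /= /lebesgue_rV_step ge0_integral_pushforward//; last first.
  exact: measurable_cons.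
rewrite preimage_setT.
apply: (fubini_tonelli1 (fun p : measurableTypeR R * 'rV[R]_n => f (rV_cons p))).
  exact: (measurableT_comp mf (@measurable_cons n)).
by [].
Qed.

Lemma measurable_addrV n d (T : measurableType d) (f g : T -> 'rV[R]_n) :
  measurable_fun setT f -> measurable_fun setT g ->
  measurable_fun setT (fun x => f x + g x).
Proof.
move=> mf mg; apply: measurable_fun_coordP => i.
under eq_fun do rewrite mxE.
by apply: measurable_funD; apply: (measurableT_comp (measurable_coord i)).
Qed.

Lemma measurable_opprV n d (T : measurableType d) (f : T -> 'rV[R]_n) :
  measurable_fun setT f -> measurable_fun setT (fun x => - f x).
Proof.
move=> mf; apply: measurable_fun_coordP => i.
under eq_fun do rewrite mxE.
by apply: measurableT_comp => //; apply: (measurableT_comp (measurable_coord i)).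
Qed.

Lemma measurable_scalerV n d (T : measurableType d) (c : T -> R) (f : T -> 'rV[R]_n) :
  measurable_fun setT c -> measurable_fun setT f ->
  measurable_fun setT (fun x => c x *: f x).
Proof.
move=> mc mf; apply: measurable_fun_coordP => i.
under eq_fun do rewrite mxE.
by apply: measurable_funM => //; apply: (measurableT_comp (measurable_coord i)).
Qed.

Lemma rV_consD n (a : 'rV[R]_n.+1) t x : rV_cons (t, x) + a =
  rV_cons (t + (rV_uncons a).1, x + (rV_uncons a).2).
Proof.
apply/rowP => i; rewrite mxE; case: (unliftP ord0 i) => [j|] ->.
  by rewrite !rV_cons_lift !mxE.
by rewrite !rV_cons0.
Qed.

Lemma rV_consN n t (x : 'rV[R]_n) : - rV_cons (t, x) = rV_cons (- t, - x).
Proof.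
apply/rowP => i; rewrite mxE; case: (unliftP ord0 i) => [j|] ->.
  by rewrite !rV_cons_lift !mxE.
by rewrite !rV_cons0.
Qed.

(** By induction on the dimension, from the invariance on the line. *)
Lemma ge0_int_shift n (a : 'rV[R]_n) (f : 'rV[R]_n -> \bar R) :
  measurable_fun setT f -> (forall x, 0 <= f x)%E ->
  (\int['leb_n]_x f (x + a)%R = \int['leb_n]_x f x)%E.
Proof.
elim: n a f => [|n IH] a f mf f0.
  by apply: eq_int => x; congr f; apply/rowP => -[].
have msh : measurable_fun setT (fun x : 'rV[R]_n.+1 => x + a).
  by apply: measurable_addrV.
rewrite !ge0_int_rVS//; last exact: (measurableT_comp mf msh).
have mfc : measurable_fun setT
    (fun p : measurableTypeR R * 'rV[R]_n => f (rV_cons p)).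
  exact: (measurableT_comp mf (@measurable_cons n)).
transitivity (\int[leb]_t
    (fun t : R => \int['leb_n]_x f (rV_cons (t, x))) (t + (rV_uncons a).1)%R)%E.
  apply: eq_int => t.
  rewrite -(IH (rV_uncons a).2 (fun x => f (rV_cons ((t + (rV_uncons a).1)%R, x))))//.
    by apply: eq_int => x; rewrite rV_consD.
  exact: (measurableT_comp mfc (pair1_measurable _)).
apply: (ge0_int_shift1 (rV_uncons a).1
  (f := fun t => \int['leb_n]_x f (rV_cons (t, x)))%E).
  exact: (@measurable_fun_fubini_tonelli_F _ _ _ _ _ 'leb_n _ mfc (fun p => f0 _)).
by move=> t; exact: integral_ge0.
Qed.

Lemma ge0_int_opp n (f : 'rV[R]_n -> \bar R) :
  measurable_fun setT f -> (forall x, 0 <= f x)%E ->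
  (\int['leb_n]_x f (- x)%R = \int['leb_n]_x f x)%E.
Proof.
elim: n f => [|n IH] f mf f0.
  by apply: eq_int => x; congr f; apply/rowP => -[].
have msh : measurable_fun setT (fun x : 'rV[R]_n.+1 => - x).
  by apply: measurable_opprV.
rewrite !ge0_int_rVS//; last exact: (measurableT_comp mf msh).
have mfc : measurable_fun setT
    (fun p : measurableTypeR R * 'rV[R]_n => f (rV_cons p)).
  exact: (measurableT_comp mf (@measurable_cons n)).
transitivity (\int[leb]_t
    (fun t : R => \int['leb_n]_x f (rV_cons (t, x))) (- t)%R)%E.
  apply: eq_int => t.
  rewrite -(IH (fun x => f (rV_cons ((- t)%R, x))))//.
    by apply: eq_int => x; rewrite rV_consN.
  exact: (measurableT_comp mfc (pair1_measurable _)).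
apply: (ge0_int_opp1 (f := fun t => \int['leb_n]_x f (rV_cons (t, x)))%E).
  exact: (@measurable_fun_fubini_tonelli_F _ _ _ _ _ 'leb_n _ mfc (fun p => f0 _)).
by move=> t; exact: integral_ge0.
Qed.

End lebesgue_rV_integral.

Section rV_functions.
Context {R : realType}.
Local Notation leb := (@lebesgue_measure R).
Local Notation "'leb_ d" := (lebesgue_rV d : {measure set 'rV[R]_d -> \bar R})
  (at level 0, d at level 0).

Lemma int_shift n (a : 'rV[R]_n) (f : 'rV[R]_n -> \bar R) : measurable_fun setT f ->
  (\int['leb_n]_x f (x + a)%R = \int['leb_n]_x f x)%E.
Proof.
move=> mf; rewrite integralE [RHS]integralE; congr (_ - _)%E.
- rewrite -(ge0_int_shift a (f := f^\+%E))//; last exact: measurable_funepos.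
  by apply: eq_int => x; rewrite !funeposE.
- rewrite -(ge0_int_shift a (f := f^\-%E))//; last exact: measurable_funeneg.
  by apply: eq_int => x; rewrite !funenegE.
Qed.

Lemma int_opp n (f : 'rV[R]_n -> \bar R) : measurable_fun setT f ->
  (\int['leb_n]_x f (- x)%R = \int['leb_n]_x f x)%E.
Proof.
move=> mf; rewrite integralE [RHS]integralE; congr (_ - _)%E.
- rewrite -(ge0_int_opp (f := f^\+%E))//; last exact: measurable_funepos.
  by apply: eq_int => x; rewrite !funeposE.
- rewrite -(ge0_int_opp (f := f^\-%E))//; last exact: measurable_funeneg.
  by apply: eq_int => x; rewrite !funenegE.
Qed.

Lemma Rint_shift n (a : 'rV[R]_n) (f : 'rV[R]_n -> R) : measurable_fun setT f ->
  \int['leb_n]_x f (x + a) = \int['leb_n]_x f x.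
Proof.
by move=> mf; congr fine; apply: (int_shift a (f := fun x => (f x)%:E));
  exact: measurable_EFinW.
Qed.

Lemma Rint_opp n (f : 'rV[R]_n -> R) : measurable_fun setT f ->
  \int['leb_n]_x f (- x) = \int['leb_n]_x f x.
Proof.
by move=> mf; congr fine; apply: (int_opp (f := fun x => (f x)%:E));
  exact: measurable_EFinW.
Qed.

Lemma ge0_int_prod_coord n (h : 'I_n -> R -> R) (c : 'I_n -> R) :
  (forall i, measurable_fun setT (h i)) -> (forall i t, 0 <= h i t) ->
  (forall i, \int[leb]_t (h i t)%:E = (c i)%:E)%E ->
  (\int['leb_n]_x (\prod_(i < n) h i (x ord0 i))%:E = (\prod_(i < n) c i)%:E)%E.
Proof.
elim: n h c => [|n IH] h c mh h0 hc.
  rewrite (@int_rV0 _ (fun x => (\prod_(i < 0) h i (x ord0 i))%:E))//.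
    by rewrite !big_ord0.
  by rewrite (_ : (fun _ => _) = cst 1%E)//; apply/funext => x; rewrite big_ord0.
have mp m (k : 'I_m -> R -> R) : (forall i, measurable_fun setT (k i)) ->
    measurable_fun setT (fun x : 'rV[R]_m => \prod_(i < m) k i (x ord0 i)).
  move=> mk; apply: (@measurable_prod _ _ _ setT _ _ (fun i (x : 'rV[R]_m) => k i (x ord0 i))) => i _.
  by apply: (measurableT_comp (mk i)); exact: measurable_coord.
rewrite (@ge0_int_rVS _ _ (fun x => (\prod_(i < n.+1) h i (x ord0 i))%:E)).
- have c0 : 0 <= \prod_(i < n) c (lift ord0 i).
    apply: prodr_ge0 => i _; rewrite -lee_fin -hc.
    by apply: integral_ge0 => t _; rewrite lee_fin.
  transitivity (\int[leb]_t ((\prod_(i < n) c (lift ord0 i)) * h ord0 t)%:E)%E.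
    apply: eq_int => t.
    transitivity (\int['leb_n]_x
        (h ord0 t * \prod_(i < n) h (lift ord0 i) (x ord0 i))%:E)%E.
      apply: eq_int => x; rewrite big_ord_recl rV_cons0.
      by under eq_bigr do rewrite rV_cons_lift.
    rewrite ge0_intZl//.
    + by rewrite (IH (fun i => h (lift ord0 i)) (fun i => c (lift ord0 i)))// -EFinM mulrC.
    + exact: (mp n (fun i => h (lift ord0 i))).
    + by move=> x; apply: prodr_ge0.
  rewrite ge0_intZl//; last exact: (mh ord0).
  by rewrite hc -EFinM big_ord_recl mulrC.
- by apply: measurable_EFinW; exact: (mp n.+1 h mh).
- by move=> x; rewrite lee_fin; apply: prodr_ge0.
Qed.

Context {d : nat}.
Implicit Types x y z w u : 'rV[R]_d.

Lemma dotrVC x y : dotrV x y = dotrV y x.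
Proof. by apply: eq_bigr => i _; rewrite mulrC. Qed.

Lemma dotrVDl x y z : dotrV (x + y) z = dotrV x z + dotrV y z.
Proof. by rewrite /dotrV -big_split; apply: eq_bigr => i _; rewrite mxE mulrDl. Qed.

Lemma dotrVDr x y z : dotrV x (y + z) = dotrV x y + dotrV x z.
Proof. by rewrite dotrVC dotrVDl !(dotrVC x). Qed.

Lemma dotrVNl x y : dotrV (- x) y = - dotrV x y.
Proof. by rewrite /dotrV -sumrN; apply: eq_bigr => i _; rewrite mxE mulNr. Qed.

Lemma dotrVNr x y : dotrV x (- y) = - dotrV x y.
Proof. by rewrite dotrVC dotrVNl dotrVC. Qed.

Lemma dotrVZl (c : R) x y : dotrV (c *: x) y = c * dotrV x y.
Proof. by rewrite /dotrV mulr_sumr; apply: eq_bigr => i _; rewrite mxE mulrA. Qed.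

Lemma dotrVZr (c : R) x y : dotrV x (c *: y) = c * dotrV x y.
Proof. by rewrite dotrVC dotrVZl dotrVC. Qed.

Lemma dotrV_ge0 x : 0 <= dotrV x x.
Proof. by apply: sumr_ge0 => i _; rewrite -expr2 sqr_ge0. Qed.

Lemma dotrV0 x : dotrV 0 x = 0.
Proof. by rewrite -[0 in LHS](scale0r 0) dotrVZl mul0r. Qed.

Lemma enorm_ge0 x : 0 <= enorm x. Proof. exact: sqrtr_ge0. Qed.

Lemma enorm_sqr x : enorm x ^+ 2 = dotrV x x.
Proof. by rewrite sqr_sqrtr// dotrV_ge0. Qed.

Lemma enormN x : enorm (- x) = enorm x.
Proof. by rewrite /enorm dotrVNl dotrVNr opprK. Qed.

Lemma enorm0 : enorm (0 : 'rV[R]_d) = 0.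
Proof. by rewrite /enorm dotrV0 sqrtr0. Qed.

Lemma sqr_coord_le x i : x ord0 i ^+ 2 <= dotrV x x.
Proof.
rewrite /dotrV (bigD1 i)//= -expr2 lerDl; apply: sumr_ge0 => j _.
by rewrite -expr2 sqr_ge0.
Qed.

Lemma coord_le_enorm x i : `|x ord0 i| <= enorm x.
Proof. by rewrite -sqrtr_sqr ler_wsqrtr// sqr_coord_le. Qed.

Lemma enorm_eq0 x : (enorm x == 0) = (x == 0).
Proof.
apply/eqP/eqP => [x0|->]; last exact: enorm0.
apply/rowP => i; rewrite mxE; apply/eqP.
by rewrite -normr_eq0 eq_le normr_ge0 andbT -x0 coord_le_enorm.
Qed.

Lemma enorm_gt0 x : (0 < enorm x) = (x != 0).
Proof. by rewrite lt_neqAle enorm_ge0 andbT eq_sym enorm_eq0. Qed.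

Lemma norm_le_enorm x : `|x| <= enorm x.
Proof.
rewrite [leLHS]mx_normrE; apply: bigmax_le; first exact: enorm_ge0.
by move=> -[i j] _ /=; rewrite (ord1 i) coord_le_enorm.
Qed.

Lemma dotrV_norm_le x y : `|dotrV x y| <= (\sum_(i < d) `|x ord0 i|) * enorm y.
Proof.
rewrite mulr_suml (le_trans (ler_norm_sum _ _ _))//.
by apply: ler_sum => i _; rewrite normrM ler_wpM2l// coord_le_enorm.
Qed.

Section measurability.
Context d1 (T : measurableType d1).

Lemma measurable_dotrV (f g : T -> 'rV[R]_d) :
  measurable_fun setT f -> measurable_fun setT g ->
  measurable_fun setT (fun t => dotrV (f t) (g t)).
Proof.
move=> mf mg; apply: (@measurable_sum _ _ _ setT _ _ (fun i (t : T) => f t ord0 i * g t ord0 i)) => i.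
by apply: measurable_funM; apply: (measurableT_comp (measurable_coord i)).
Qed.

Lemma measurable_enorm (f : T -> 'rV[R]_d) :
  measurable_fun setT f -> measurable_fun setT (fun t => enorm (f t)).
Proof.
by move=> mf; apply: (measurableT_comp (continuous_measurable_fun (@sqrt_continuous R))); exact: measurable_dotrV.
Qed.

End measurability.
End rV_functions.

(** * The Fourier transform of a Gaussian weight *)

Section line.
Context {R : realType}.
Local Notation leb := (@lebesgue_measure R).
Implicit Types f F : R -> R.

Lemma is_derive_continuous f (df : R -> R) : (forall x : R, is_derive x 1 f (df x)) ->
  continuous f.
Proof.
move=> fd x; apply: differentiable_continuous; apply/derivable1_diffP.
by have [] := fd x.
Qed.

Lemma integral_derivative_segment f F (a b : R) : a <= b ->
  (forall x : R, is_derive x 1 F (f x)) -> continuous f ->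
  (\int[leb]_(x in `[a, b]) (f x)%:E = (F b - F a)%:E)%E.
Proof.
rewrite le_eqVlt => /predU1P[<-|ab] Fd cf.
  by rewrite set_itv1 integral_set1 subrr.
have cF := is_derive_continuous Fd.
rewrite (@continuous_FTC2 R f F a b)//.
- exact: continuous_subspaceT.
- split; first by move=> x _; have [] := Fd x.
  + by apply: cvg_at_right_filter; exact: cF.
  + by apply: cvg_at_left_filter; exact: cF.
- by move=> x _; rewrite derive1E; have [] := Fd x.
Qed.

(** The integrals over [-n, n] are boundary terms, which vanish in the limit. *)
Lemma Rint_derivative_line f F : (forall x : R, is_derive x 1 F (f x)) ->
  continuous f -> rintegrable leb f ->
  F n%:R @[n --> \oo] --> 0 -> F (- n%:R) @[n --> \oo] --> 0 ->
  \int[leb]_x f x = 0.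
Proof.
move=> Fd cf fi F1 F2.
have mf := rintegrable_measurable fi.
pose f_ n x := f x * \1_(`[- n%:R, n%:R] : set R) x.
have mf_ n : measurable_fun setT (f_ n : measurableTypeR R -> R).
  by apply: measurable_funM => //; exact: measurable_indic.
have c1 : (\int[leb]_x f_ n x) @[n --> \oo] --> \int[leb]_x f x.
  apply: (Rint_cvg mf_ mf (rintegrable_norm fi)).
    apply: aeW => x; apply: cvg_near_cst.
    near=> n; rewrite /f_ indicE mem_set ?mulr1//= in_itv/= -ler_norml.
    near: n; exact: nbhs_infty_ger.
  move=> n x; rewrite /f_ normrM ler_piMr// indicE.
  by case: (x \in _); rewrite ?normr1 ?normr0.
have c2 : (\int[leb]_x f_ n x) @[n --> \oo] --> (0 : R).
  have -> : (fun n => \int[leb]_x f_ n x) = (fun n : nat => F n%:R - F (- n%:R)).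
    apply/funext => n.
    have -> : \int[leb]_x f_ n x = \int[leb]_(x in `[- n%:R, n%:R]) f x.
      rewrite [RHS]Rintegral_mkcond; apply: eq_Rint => x.
      by rewrite /f_ patchE indicE; case: (x \in _); rewrite ?mulr1 ?mulr0.
    by rewrite /Rintegral (integral_derivative_segment (F := F))// (le_trans (y := 0))// oppr_le0.
  by rewrite -(subr0 0); apply: cvgB.
exact: (cvg_unique _ c1 c2).
Unshelve. all: end_near. Qed.

Definition gauss1 (a x : R) : R := expR (- (a * x ^+ 2)).

Lemma gauss1_gt0 a x : 0 < gauss1 a x. Proof. exact: expR_gt0. Qed.
Lemma gauss1_ge0 a x : 0 <= gauss1 a x. Proof. exact: expR_ge0. Qed.
#[local] Hint Resolve gauss1_ge0 : core.

Lemma measurable_gauss1 a : measurable_fun setT (gauss1 a).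
Proof.
apply: measurableT_comp => //; apply: measurableT_comp => //.
by apply: measurable_funM => //; exact: measurable_funX.
Qed.

(** Read off from the total mass of the normal density of variance [1 / (2 a)]. *)
Lemma int_gauss1 a : 0 < a ->
  (\int[leb]_x (gauss1 a x)%:E = (Num.sqrt (pi / a))%:E)%E.
Proof.
move=> a0; pose s := Num.sqrt (a * 2)^-1.
have s0 : s != 0 by rewrite gt_eqF// sqrtr_gt0 invr_gt0 mulr_gt0.
have s2 : s ^+ 2 = (a * 2)^-1 by rewrite sqr_sqrtr// invr_ge0 mulr_ge0// ltW.
have p0 := normal_peak_gt0 s0.
have : (\int[leb]_x (normal_peak s * gauss1 a x)%:E = 1)%E.
  rewrite -[RHS](integral_normal_pdf 0 s); apply: eq_int => x.
  rewrite normal_pdfE// /normal_fun subr0 s2; congr (_ * expR _)%:E.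
  by field; rewrite gt_eqF.
rewrite ge0_intZl//; [|exact: ltW|exact: measurable_gauss1].
move=> /(congr1 (fun y => (normal_peak s)^-1%:E * y)%E).
rewrite muleA -EFinM mulVf ?gt_eqF// mul1e mule1 => ->.
rewrite /normal_peak invrK s2; congr (Num.sqrt _)%:E.
by field; rewrite gt_eqF.
Qed.

Lemma rintegrable_gauss1 a : 0 < a -> rintegrable leb (gauss1 a).
Proof.
move=> a0; apply: rintegrableP; first exact: measurable_gauss1.
under eq_int do rewrite ger0_norm//.
by rewrite int_gauss1// ltry.
Qed.

Lemma norm_gauss1_le a x : 0 < a ->
  `|x| * gauss1 a x <= gauss1 a x + 2 / a * gauss1 (a / 2) x.
Proof.
move=> a0; have x1 : `|x| <= 1 + x ^+ 2.
  by rewrite -(real_normK (num_real x)); have := normr_ge0 x; nra.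
apply: (le_trans (ler_wpM2r (gauss1_ge0 a x) x1)).
rewrite mulrDl mul1r lerD2l.
have -> : gauss1 a x = gauss1 (a / 2) x * gauss1 (a / 2) x.
  by rewrite /gauss1 -expRD; congr expR; field.
rewrite mulrA ler_wpM2r//.
pose y := a / 2 * x ^+ 2.
have -> : x ^+ 2 = 2 / a * y by rewrite /y; field; rewrite gt_eqF.
have a2 : 0 <= 2 / a by rewrite divr_ge0// ltW.
rewrite -(mulrA (2 / a)) ler_piMr// /gauss1 expRN -/y.
rewrite ler_pdivrMr ?expR_gt0// mul1r.
by apply: le_trans (expR_ge1Dx y); rewrite lerDr.
Qed.

Lemma rintegrable_norm_gauss1 a : 0 < a -> rintegrable leb (fun x => `|x| * gauss1 a x).
Proof.
move=> a0; apply: (@rintegrable_dominated _ _ _ leb _ (fun x => gauss1 a x + 2 / a * gauss1 (a / 2) x)).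
- have mn : measurable_fun setT (fun x : R => `|x|) by exact: measurableT_comp.
  exact: (measurable_funM mn (measurable_gauss1 a)).
- apply: rintegrableD; first exact: rintegrable_gauss1.
  by apply: rintegrableZl; apply: rintegrable_gauss1; rewrite divr_gt0.
- by move=> x; rewrite ger0_norm ?mulr_ge0// norm_gauss1_le.
Qed.

Section fourier1.
Variable a : R.
Hypothesis a0 : 0 < a.

Let C (u : R) : R := \int[leb]_x (cos (u * x) * gauss1 a x).

Let measurable_cos_gauss u : measurable_fun setT (fun x : R => cos (u * x) * gauss1 a x).
Proof.
apply: measurable_funM; last exact: measurable_gauss1.
apply: (measurableT_comp (continuous_measurable_fun (@continuous_cos R))).
exact: measurable_funM.
Qed.

Let measurable_sin_gauss u : measurable_fun setT (fun x : R => sin (u * x) * gauss1 a x).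
Proof.
apply: measurable_funM; last exact: measurable_gauss1.
apply: (measurableT_comp (continuous_measurable_fun (@continuous_sin R))).
exact: measurable_funM.
Qed.

Lemma rintegrable_cos_gauss1 u : rintegrable leb (fun x => cos (u * x) * gauss1 a x).
Proof.
apply: (@rintegrable_dominated _ _ _ leb _ _ _ (rintegrable_gauss1 a0)).
  exact: measurable_cos_gauss.
by move=> x; rewrite normrM (ger0_norm (gauss1_ge0 _ _)) ler_piMl// cos_max.
Qed.

Let rintegrable_xsin u : rintegrable leb (fun x => x * (sin (u * x) * gauss1 a x)).
Proof.
apply: (@rintegrable_dominated _ _ _ leb _ _ _ (rintegrable_norm_gauss1 a0)).
  exact: (measurable_funM (@measurable_time R) (measurable_sin_gauss u)).
move=> x; rewrite !normrM (ger0_norm (gauss1_ge0 _ _)) ler_wpM2l//.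
by rewrite ler_piMl// sin_max.
Qed.

Let vanish u : sin (u * n%:R) * gauss1 a n%:R @[n --> \oo] --> (0 : R).
Proof.
apply/cvgr0Pnorm_lt => e e0; near=> n.
have n0 : 1 <= n%:R :> R by rewrite ler1n; near: n; exact: nbhs_infty_gt.
have ne : (a * e)^-1 < n%:R :> R by near: n; exact: nbhs_infty_gtr.
rewrite normrM (ger0_norm (gauss1_ge0 _ _)).
apply: (@le_lt_trans _ _ (gauss1 a n%:R)); first by rewrite ler_piMl// sin_max.
have y0 : 0 < a * n%:R ^+ 2 by rewrite mulr_gt0// exprn_gt0// (lt_le_trans ltr01).
rewrite /gauss1 expRN invf_plt ?posrE ?expR_gt0//.
apply: lt_le_trans (expR_ge1Dx _).
rewrite -(ltr_pM2l a0) in ne.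
have -> : e^-1 = a * (a * e)^-1 by field; rewrite !gt_eqF.
apply: (lt_le_trans ne); rewrite -[leLHS]add0r lerD// ler_wpM2l//; first exact: ltW.
by rewrite expr2 ler_peMl// (le_trans ler01).
Unshelve. all: end_near. Qed.

(** Integration by parts: the integrand is the derivative of
    [sin (u x) * gauss1 a x], which vanishes at infinity. *)
Let ibp u : u * C u = 2 * a * \int[leb]_x (x * (sin (u * x) * gauss1 a x)).
Proof.
apply/eqP; rewrite -subr_eq0 -!RintZl//; last exact: rintegrable_cos_gauss1.
rewrite -RintB//; do ?[exact: rintegrableZl|exact/rintegrableZl/rintegrable_cos_gauss1].
apply/eqP; apply: (@Rint_derivative_line _ (fun x => sin (u * x) * gauss1 a x)).
- move=> x; apply: is_derive_eq; rewrite /= /gauss1 /GRing.scale/=.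
  ring.
- by apply: is_derive_continuous => x; rewrite /gauss1.
- apply: rintegrableB; apply: rintegrableZl => //.
  exact: rintegrable_cos_gauss1.
- exact: vanish.
- under eq_fun do rewrite mulrN sinN /gauss1 sqrrN mulNr.
  by rewrite -oppr0; apply: cvgN; exact: vanish.
Qed.

(** Differentiation under the integral sign and [ibp] show that the transform [C]
    satisfies C' (u) = - u / (2 a) C (u). *)
Lemma fourier_gauss1 u : \int[leb]_x (cos (u * x) * gauss1 a x) =
  Num.sqrt (pi / a) * expR (- (u ^+ 2 / (4 * a))).
Proof.
have a_neq0 : a != 0 by rewrite gt_eqF.
have dC (v : R) : is_derive v 1 C (- (v / (2 * a)) * C v).
  pose f (w x : R) := cos (w * x) * gauss1 a x.
  have Iv : (`]v - 1, v + 1[%classic : set R) v by rewrite /= in_itv/= ltrBlDr ltrDl ltr01.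
  have fd (w x : R) : is_derive w 1 (f ^~ x) (- (x * (sin (w * x) * gauss1 a x))).
    apply: is_derive_eq; rewrite /= /GRing.scale/=; ring.
  have int_f w : (`]v - 1, v + 1[%classic : set R) w -> rintegrable leb (f w).
    by move=> _; exact: rintegrable_cos_gauss1.
  have f_drv w x : (`]v - 1, v + 1[%classic : set R) w -> setT x -> derivable (f ^~ x) w 1.
    by move=> _ _; have [] := fd w x.
  have f_dom w x : (`]v - 1, v + 1[%classic : set R) w -> setT x ->
      `|partial1of2 f w x| <= `|x| * gauss1 a x.
    move=> _ _; rewrite partial1of2E; have [_ ->] := fd w x.
    rewrite normrN !normrM (ger0_norm (gauss1_ge0 _ _)) ler_wpM2l//.
    by rewrite ler_piMl// sin_max.
  have dom0 x : 0 <= `|x| * gauss1 a x by rewrite mulr_ge0.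
  apply: DeriveDef.
    exact: (derivable_under_integral measurableT Iv int_f f_drv dom0
      (rintegrable_norm_gauss1 a0) f_dom).
  rewrite -derive1E (differentiation_under_integral measurableT Iv int_f f_drv dom0
      (rintegrable_norm_gauss1 a0) f_dom).
  transitivity (\int[leb]_x (- (x * (sin (v * x) * gauss1 a x)))).
    by apply: eq_Rint => x; rewrite partial1of2E; have [_ ->] := fd v x.
  rewrite RintN// mulNr; congr (- _).
  rewrite mulrAC ibp; field; exact: a_neq0.
have dK (v : R) : is_derive v 1 (fun u => C u * expR (u ^+ 2 / (4 * a))) 0.
  apply: is_derive_eq; rewrite /= /GRing.scale/=; field; exact: a_neq0.
have := is_derive_0_is_cst u 0 dK.
rewrite /= expr0n/= mul0r expR0 mulr1 => h.
have C0 : C 0 = Num.sqrt (pi / a).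
  transitivity (\int[leb]_x gauss1 a x); last by rewrite /Rintegral int_gauss1.
  by apply: eq_Rint => x; rewrite mul0r cos0 mul1r.
by rewrite -/(C u) -C0 -h expRN mulfK// gt_eqF// expR_gt0.
Qed.

End fourier1.
End line.

(** * The heat kernels *)

Section gaussV.
Context {R : realType}.
Local Notation leb := (@lebesgue_measure R).
Local Notation "'leb_ d" := (lebesgue_rV d : {measure set 'rV[R]_d -> \bar R})
  (at level 0, d at level 0).

Definition gaussV n (a : R) (x : 'rV[R]_n) : R := expR (- (a * dotrV x x)).

Lemma gaussV_gt0 n a (x : 'rV[R]_n) : 0 < gaussV a x. Proof. exact: expR_gt0. Qed.
Lemma gaussV_ge0 n a (x : 'rV[R]_n) : 0 <= gaussV a x. Proof. exact: expR_ge0. Qed.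
#[local] Hint Resolve gaussV_gt0 gaussV_ge0 : core.

Lemma measurable_gaussV n a d (T : measurableType d) (f : T -> 'rV[R]_n) :
  measurable_fun setT f -> measurable_fun setT (fun t => gaussV a (f t)).
Proof.
move=> mf; rewrite /gaussV; apply: (measurableT_comp (@measurable_expR R)).
under eq_fun do rewrite -mulNr.
by apply: measurable_funM => //; exact: measurable_dotrV.
Qed.

Lemma gaussV_prod n a (x : 'rV[R]_n) : gaussV a x = \prod_(i < n) gauss1 a (x ord0 i).
Proof.
rewrite /gaussV /dotrV mulr_sumr -sumrN expR_sum.
by apply: eq_bigr => i _; rewrite /gauss1 expr2.
Qed.

Lemma int_gaussV n a : 0 < a ->
  (\int['leb_n]_x (gaussV a x)%:E = (Num.sqrt (pi / a) ^+ n)%:E)%E.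
Proof.
move=> a0; under eq_int do rewrite gaussV_prod.
rewrite (@ge0_int_prod_coord _ n (fun=> gauss1 a) (fun=> Num.sqrt (pi / a)))//.
- by rewrite prodr_const card_ord.
- by move=> i; exact: measurable_gauss1.
- by move=> i t; exact: gauss1_ge0.
- by move=> i; exact: int_gauss1.
Qed.

Lemma rintegrable_gaussV n a : 0 < a -> rintegrable 'leb_n (gaussV a).
Proof.
move=> a0; apply: rintegrableP; first exact: measurable_gaussV.
under eq_int do rewrite ger0_norm//.
by rewrite int_gaussV// ltry.
Qed.

Lemma rintegrable_mul_gaussV n a (f : 'rV[R]_n -> R) : 0 < a ->
  measurable_fun setT f -> (forall x, `|f x| <= 1) ->
  rintegrable 'leb_n (fun x => f x * gaussV a x).
Proof.
move=> a0 mf f1; apply: (@rintegrable_dominated _ _ _ 'leb_n _ _ _ (rintegrable_gaussV n a0)).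
  by apply: measurable_funM => //; exact: measurable_gaussV.
by move=> x; rewrite normrM (ger0_norm (gaussV_ge0 _ _)) ler_piMl.
Qed.

Lemma measurable_cosR : measurable_fun setT (@cos R).
Proof. exact: (continuous_measurable_fun (@continuous_cos R)). Qed.
Lemma measurable_sinR : measurable_fun setT (@sin R).
Proof. exact: (continuous_measurable_fun (@continuous_sin R)). Qed.

Lemma Rint_rVS n (f : 'rV[R]_n.+1 -> R) : rintegrable 'leb_(n.+1) f ->
  \int['leb_(n.+1)]_x f x = \int[leb]_t \int['leb_n]_x f (rV_cons (t, x)).
Proof.
move=> fi; have mf := rintegrable_measurable fi.
have mfc : measurable_fun setT
    (fun p : measurableTypeR R * 'rV[R]_n => f (rV_cons p)).
  exact: (measurableT_comp mf (@measurable_cons R n)).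
have fci : rintegrable (prodm leb (lebesgue_rV n)) (fun p => f (rV_cons p)).
  apply: rintegrable_prodP => //.
  rewrite -(@ge0_int_rVS _ _ (fun x => (`|f x|)%:E)).
  - exact: rintegrable_lty.
  - by apply: measurable_EFinW; exact: measurableT_comp.
  - by move=> x; rewrite lee_fin.
rewrite -(Rint_prod fci) /Rintegral; congr fine.
rewrite /= /lebesgue_rV_step (@integral_pushforward _ _ _ _ _ _ (@measurable_cons R n)).
- by rewrite preimage_setT.
- exact: measurable_EFinW.
- by rewrite preimage_setT.
- exact: measurableT.
Qed.

Lemma sin_gaussV0 n a (u : 'rV[R]_n) : 0 < a ->
  \int['leb_n]_x (sin (dotrV u x) * gaussV a x) = 0.
Proof.
move=> a0; set I := LHS.
have ms : measurable_fun setT (fun x : 'rV[R]_n => sin (dotrV u x)).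
  by apply: (measurableT_comp measurable_sinR); exact: measurable_dotrV.
have si := @rintegrable_mul_gaussV n a _ a0 ms (fun x => sin_max _).
suff : I = - I by lra.
have /= E := Rint_opp (rintegrable_measurable si).
rewrite {1}/I -E -RintN//.
by apply: eq_Rint => x; rewrite dotrVNr sinN /gaussV dotrVNl dotrVNr opprK mulNr.
Qed.

(** By induction on the dimension, expanding the cosine of a sum; the products of two
    sines integrate to zero. *)
Lemma fourier_gaussV n a (u : 'rV[R]_n) : 0 < a ->
  \int['leb_n]_x (cos (dotrV u x) * gaussV a x) =
  Num.sqrt (pi / a) ^+ n * gaussV (4 * a)^-1 u.
Proof.
move=> a0; elim: n u => [|n IH] u.
  rewrite /Rintegral (@int_rV0 _ (fun x => (cos (dotrV u x) * gaussV a x)%:E)).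
    by rewrite /= /gaussV /dotrV !big_ord0 !mulr0 cos0 oppr0 expR0.
  apply: measurable_EFinW; apply: measurable_funM; last exact: measurable_gaussV.
  by apply: (measurableT_comp measurable_cosR); exact: measurable_dotrV.
have mc m (v : 'rV[R]_m) : measurable_fun setT (fun x => cos (dotrV v x)).
  by apply: (measurableT_comp measurable_cosR); exact: measurable_dotrV.
have ms m (v : 'rV[R]_m) : measurable_fun setT (fun x => sin (dotrV v x)).
  by apply: (measurableT_comp measurable_sinR); exact: measurable_dotrV.
rewrite Rint_rVS; last by apply: rintegrable_mul_gaussV => // x; exact: cos_max.
pose u0 := u ord0 ord0; pose u' := (rV_uncons u).2.
have E t x : dotrV u (rV_cons (t, x)) = u0 * t + dotrV u' x.
  rewrite /dotrV big_ord_recl rV_cons0; congr (_ + _).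
  by apply: eq_bigr => i _; rewrite rV_cons_lift mxE.
have G t x : gaussV a (rV_cons (t, x)) = gauss1 a t * gaussV a x :> R.
  rewrite !gaussV_prod big_ord_recl rV_cons0; congr (_ * _).
  by apply: eq_bigr => i _; rewrite rV_cons_lift.
transitivity (\int[leb]_t
    ((Num.sqrt (pi / a) ^+ n * gaussV (4 * a)^-1 u') * (cos (u0 * t) * gauss1 a t))).
  apply: eq_Rint => t; rewrite -IH.
  transitivity (\int['leb_n]_x
      ((cos (u0 * t) * gauss1 a t) * (cos (dotrV u' x) * gaussV a x) -
       (sin (u0 * t) * gauss1 a t) * (sin (dotrV u' x) * gaussV a x))).
    by apply: eq_Rint => x; rewrite E G cosD; ring.
  rewrite RintB; first last.
  - by apply: rintegrableZl; apply: rintegrable_mul_gaussV => // x; exact: sin_max.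
  - by apply: rintegrableZl; apply: rintegrable_mul_gaussV => // x; exact: cos_max.
  rewrite !RintZl; first last.
  - by apply: rintegrable_mul_gaussV => // x; exact: cos_max.
  - by apply: rintegrable_mul_gaussV => // x; exact: sin_max.
  by rewrite sin_gaussV0// mulr0 subr0 mulrC.
rewrite RintZl; last exact: rintegrable_cos_gauss1.
rewrite fourier_gauss1// [_ ^+ n.+1]exprSr -!mulrA; congr (_ * _).
rewrite mulrCA; congr (_ * _).
rewrite !gaussV_prod big_ord_recl mulrC; congr (_ * _).
  by rewrite /gauss1 expr2 mulrA mulrC.
by apply: eq_bigr => i _; rewrite mxE.
Qed.

Lemma heat_kernel_cos n (beta a t : R) (x y : 'rV[R]_n) : heat_kernel beta a t x y =
  (2 * pi) ^- n * \int['leb_n]_xi (cos (dotrV (x - y) xi) *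
     expR (- t * (enorm xi ^+ 2 + a * enorm xi `^ beta))).
Proof.
rewrite /heat_kernel /cintegral /= mul0r subr0; congr (_ * _).
apply: eq_Rint => xi; rewrite /cexpi /= mulr0 subr0; congr (_ * _).
by rewrite cosN.
Qed.

(** The Gauss--Weierstrass kernel. *)
Definition gk n (s : R) (u : 'rV[R]_n) : R :=
  Num.sqrt (4 * pi * s) ^- n * gaussV (4 * s)^-1 u.

Lemma heat_kernel0E n (beta s : R) (x y : 'rV[R]_n) : 0 < s ->
  heat_kernel beta 0 s x y = gk s (x - y).
Proof.
move=> s0; rewrite heat_kernel_cos.
rewrite (eq_Rint _ (g := fun xi => cos (dotrV (x - y) xi) * gaussV s xi)); last first.
  by move=> xi; rewrite mul0r addr0 enorm_sqr mulNr.
rewrite fourier_gaussV// mulrA; congr (_ * _).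
rewrite -exprVn -exprMn -[RHS]exprVn; congr (_ ^+ n).
have p0 : 0 < pi :> R by exact: pi_gt0.
have E (p : R) : 0 < p -> p / s = (2 * p) ^+ 2 * (4 * p * s)^-1.
  by move=> p1; field; rewrite !gt_eqF.
rewrite (E _ p0).
rewrite sqrtrM ?sqr_ge0// sqrtr_sqr ger0_norm; last by rewrite mulr_ge0// ltW.
rewrite mulKf; last by rewrite gt_eqF// mulr_gt0.
by rewrite sqrtrV// !mulr_ge0// ltW.
Qed.

End gaussV.

Section gauss_kernel.
Context {R : realType}.
Local Notation leb := (@lebesgue_measure R).
Local Notation "'leb_ d" := (lebesgue_rV d : {measure set 'rV[R]_d -> \bar R})
  (at level 0, d at level 0).
#[local] Hint Extern 0 (is_true (0 <= gaussV _ _)) => solve [apply: gaussV_ge0] : core.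

Lemma measurable_inv : measurable_fun setT (fun x : R => x^-1).
Proof.
(* At [x = 0] both sides vanish. *)
rewrite (_ : (fun _ => _) = fun x : R => x * (x ^+ 2) `^ (- 1)).
  apply: measurable_funM => //.
  by apply: (measurableT_comp (measurable_powR _)); exact: measurable_funX.
apply/funext => x; rewrite powR_inv1 ?sqr_ge0//.
have [->|x0] := eqVneq x 0; first by rewrite invr0 mul0r.
by rewrite expr2 invfM mulrA divff// mul1r.
Qed.

Lemma measurable_funV d (T : measurableType d) (f : T -> R) :
  measurable_fun setT f -> measurable_fun setT (fun x => (f x)^-1).
Proof. by move=> mf; exact: (measurableT_comp measurable_inv). Qed.

Variable n : nat.
Implicit Types x y z u w : 'rV[R]_n.

Lemma gk_ge0 (s : R) u : 0 <= gk s u.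
Proof. by rewrite /gk; apply: mulr_ge0; rewrite ?gaussV_ge0// invr_ge0 exprn_ge0. Qed.
#[local] Hint Extern 0 (is_true (0 <= gk _ _)) => solve [apply: gk_ge0] : core.

Lemma gkN (s : R) u : gk s (- u) = gk s u.
Proof. by rewrite /gk /gaussV dotrVNl dotrVNr opprK. Qed.

Lemma measurable_gk d (T : measurableType d) (s : T -> R) (f : T -> 'rV[R]_n) :
  measurable_fun setT s -> measurable_fun setT f ->
  measurable_fun setT (fun t => gk (s t) (f t)).
Proof.
move=> ms mf; rewrite /gk; apply: measurable_funM.
  apply: measurable_funV; apply: measurable_funX.
  apply: (measurableT_comp (continuous_measurable_fun (@sqrt_continuous R))).
  exact: measurable_funM.
rewrite /gaussV; apply: (measurableT_comp (@measurable_expR R)).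
under eq_fun do rewrite -mulNr.
apply: measurable_funM; last exact: measurable_dotrV.
have -> : (fun t => - (4 * s t)^-1) = (fun t => (- 4 * s t)^-1).
  by apply/funext => t; rewrite mulNr invrN.
by apply: measurable_funV; exact: measurable_funM.
Qed.

Lemma measurable_gk1 (s : R) : measurable_fun setT (gk s : 'rV[R]_n -> R).
Proof. exact: measurable_gk. Qed.

Lemma int_gk (s : R) : 0 < s -> (\int['leb_n]_u (gk s u)%:E = 1)%E.
Proof.
move=> s0; rewrite /gk ge0_intZl ?invr_ge0 ?exprn_ge0//; last exact: measurable_gaussV.
rewrite int_gaussV ?invr_gt0 ?mulr_gt0// -EFinM invrK mulrCA mulrA mulVf//.
by rewrite gt_eqF// exprn_gt0// sqrtr_gt0 !mulr_gt0// pi_gt0.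
Qed.

Lemma rintegrable_gk (s : R) : 0 < s -> rintegrable 'leb_n (gk s).
Proof.
move=> s0; apply: rintegrableP; first exact: measurable_gk1.
under eq_int do rewrite ger0_norm//.
by rewrite int_gk// ltry.
Qed.

Lemma Rint_gk (s : R) : 0 < s -> \int['leb_n]_u (gk s u) = 1.
Proof. by move=> s0; rewrite /Rintegral int_gk. Qed.

Lemma int_gk_shift (s : R) x : 0 < s -> (\int['leb_n]_u (gk s (u + x))%:E = 1)%E.
Proof.
move=> s0; rewrite (int_shift x (f := fun u => (gk s u)%:E)) ?int_gk//.
by apply: measurable_EFinW; exact: measurable_gk1.
Qed.

Lemma int_gk_sub (s : R) x : 0 < s -> (\int['leb_n]_y (gk s (x - y))%:E = 1)%E.
Proof.
move=> s0; rewrite -(int_gk_shift (- x) s0).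
by apply: eq_int => y; rewrite -gkN opprB.
Qed.

Lemma rintegrable_gk_shift (s : R) x : 0 < s -> rintegrable 'leb_n (fun u => gk s (u + x)).
Proof.
move=> s0; apply: rintegrableP; first by apply: measurable_gk => //; exact: measurable_addrV.
under eq_int do rewrite ger0_norm//.
by rewrite int_gk_shift// ltry.
Qed.

Lemma Rint_gk_shift (s : R) x : 0 < s -> \int['leb_n]_u (gk s (u + x)) = 1.
Proof. by move=> s0; rewrite /Rintegral int_gk_shift. Qed.

(** Completing the square in [z]. *)
Lemma gk_mul (s t : R) x y z : 0 < s -> 0 < t ->
  gk s (x - z) * gk t (z - y) = gk (s + t) (x - y) *
    gk (s * t / (s + t)) (z - (s + t)^-1 *: (t *: x + s *: y)).
Proof.
move=> s0 t0; have st0 : 0 < s + t by exact: addr_gt0.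
have p0 : 0 <= (4 : R) * pi by rewrite mulr_ge0// ltW// pi_gt0.
rewrite /gk [LHS]mulrACA [RHS]mulrACA; congr (_ * _).
  rewrite -!exprVn -!exprMn; congr (_ ^+ n).
  have sq (a b : R) : 0 <= a -> (Num.sqrt a)^-1 * (Num.sqrt b)^-1 = (Num.sqrt (a * b))^-1.
    by move=> a0; rewrite sqrtrM// invfM.
  rewrite !sq; [|by rewrite mulr_ge0// ltW..].
  congr (Num.sqrt _)^-1.
  by move: (pi : R) => p; field; rewrite gt_eqF.
rewrite /gaussV -!expRD; congr expR.
rewrite !(dotrVDl, dotrVDr, dotrVNl, dotrVNr, dotrVZl, dotrVZr).
rewrite (dotrVC z x) (dotrVC y z) (dotrVC y x).
by field; rewrite !gt_eqF// mulr_gt0.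
Qed.

Lemma int_gk_gk (s t : R) x y : 0 < s -> 0 < t ->
  (\int['leb_n]_z (gk s (x - z) * gk t (z - y))%:E = (gk (s + t) (x - y))%:E)%E.
Proof.
move=> s0 t0; under eq_int do rewrite gk_mul//.
have r0 : 0 < s * t / (s + t) by rewrite !mulr_gt0// invr_gt0 addr_gt0.
rewrite ge0_intZl//; first by rewrite int_gk_shift// mule1.
by apply: measurable_gk => //; exact: measurable_addrV.
Qed.

Definition gkD2 (s : R) u w : R := gk s (u + w) + gk s (u - w) - 2 * gk s u.

Lemma measurable_gkD2 d (T : measurableType d) (s : T -> R) (f g : T -> 'rV[R]_n) :
  measurable_fun setT s -> measurable_fun setT f -> measurable_fun setT g ->
  measurable_fun setT (fun t => gkD2 (s t) (f t) (g t)).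
Proof.
move=> ms mf mg; rewrite /gkD2; apply: measurable_funB.
  apply: measurable_funD; apply: measurable_gk => //; apply: measurable_addrV => //.
  exact: measurable_opprV.
by apply: measurable_funM => //; exact: measurable_gk.
Qed.

Lemma gk_shiftE (s : R) u w : gk s (u + w) =
  gk s u * (expR (- (dotrV w w / (4 * s))) * expR (- (dotrV u w / (2 * s)))).
Proof.
rewrite /gk -[RHS]mulrA; congr (_ * _); rewrite /gaussV -!expRD; congr expR.
rewrite !(dotrVDl, dotrVDr) (dotrVC w u).
have [->|s0] := eqVneq s 0; last by field.
by rewrite !(mulr0, invr0, mul0r) oppr0 !addr0.
Qed.

(** With [r = |w|^2 / (4 s)] and [a = (u . w) / (2 s)], the second difference is
    [gk s u * (exp (- r) * (exp a + exp (- a)) - 2)], that is, the sum of a nonnegative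
    term, as [exp a + exp (- a) >= 2], and of [- 2 * (1 - exp (- r)) * gk s u]. *)
Lemma gkD2_le (s : R) u w : 0 < s -> `|gkD2 s u w| <=
  gk s (u + w) + gk s (u - w) + (2 - 4 * expR (- (dotrV w w / (4 * s)))) * gk s u.
Proof.
move=> s0; rewrite /gkD2 (gk_shiftE _ u (- w)) gk_shiftE dotrVNr dotrVNl dotrVNr opprK.
set e := expR (- (dotrV w w / _)); set a := dotrV u w / _.
rewrite mulNr opprK; set g := gk s u.
have e0 : 0 < e by exact: expR_gt0.
have g0 : 0 <= g by exact: gk_ge0.
have ch : 2 <= expR (- a) + expR a.
  rewrite -[leLHS]/(1 + 1) (le_trans _ (lerD (expR_ge1Dx (- a)) (expR_ge1Dx a)))//.
  by rewrite addrACA addNr addr0.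
have ge : 0 <= g * e * (expR (- a) + expR a - 2).
  by apply: mulr_ge0; [apply: mulr_ge0 => //; exact: ltW|rewrite subr_ge0].
have := expR_gt0 (- a); have := expR_gt0 a; move: (expR a) (expR (- a)) ch ge => p m ch ge p0 m0.
have e1 : e <= 1 by rewrite -expR0 ler_expR oppr_le0 divr_ge0 ?dotrV_ge0// mulr_ge0// ltW.
have g1 : 0 <= g * (1 - e) by rewrite mulr_ge0// subr_ge0.
by rewrite ler_norml; apply/andP; split; lra.
Qed.

(** The bound of [gkD2_le] integrates exactly, as all translates of the kernel have
    mass one. *)
Lemma int_gkD2_le (s : R) w : 0 < s ->
  (\int['leb_n]_u (`|gkD2 s u w|)%:E <=
    (4 * (1 - expR (- (dotrV w w / (4 * s)))))%:E)%E.
Proof.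
move=> s0; set e := expR _.
have i1 := rintegrable_gk_shift w s0.
have i2 := rintegrable_gk_shift (- w) s0.
have i3 := rintegrableZl (2 - 4 * e) (rintegrable_gk s0).
have i12 := rintegrableD i1 i2.
have i := rintegrableD i12 i3.
have mD : measurable_fun setT (fun u => `|gkD2 s u w|).
  by apply: measurableT_comp => //; exact: measurable_gkD2.
apply: (@le_trans _ _ (\int['leb_n]_u (gk s (u + w) + gk s (u - w) + (2 - 4 * e) * gk s u)%:E)%E).
  apply: ge0_le_int => //; first exact: rintegrable_measurable i.
  by move=> u; exact: gkD2_le.
rewrite -(EFin_Rint i) lee_fin (RintD i12 i3) (RintD i1 i2) RintZl; last exact: rintegrable_gk.
rewrite (Rint_gk_shift w s0) (Rint_gk_shift (- w) s0) (Rint_gk s0).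
by clear; lra.
Qed.

Lemma int_gkD2_min (s : R) w : 0 < s ->
  (\int['leb_n]_u (`|gkD2 s u w|)%:E <=
    (4 * Num.min 1 (dotrV w w / (4 * s)))%:E)%E.
Proof.
move=> s0; apply: le_trans (int_gkD2_le w s0) _; rewrite lee_fin ler_wpM2l//.
rewrite le_min; apply/andP; split; first by rewrite lerBlDr lerDl expR_ge0.
by rewrite lerBlDr addrC -lerBlDr; exact: expR_ge1Dx.
Qed.

End gauss_kernel.

(** * The kernel with a stable part *)

Section stable_kernel.
Context {R : realType}.
Local Notation "'leb_ d" := (lebesgue_rV d : {measure set 'rV[R]_d -> \bar R})
  (at level 0, d at level 0).
#[local] Hint Extern 0 (is_true (0 <= gaussV _ _)) => solve [apply: gaussV_ge0] : core.
Variables (n : nat) (beta : R).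
Hypothesis beta_gt0 : 0 < beta.
Hypothesis beta_le2 : beta <= 2.
Implicit Types x y z u w xi : 'rV[R]_n.

Let E (t : R) xi := expR (- t * (enorm xi ^+ 2 + 1 * enorm xi `^ beta)).

(** The kernel of [Delta + Delta^(beta/2)] as a function of the difference. *)
Definition stable_kernel (t : R) u : R :=
  (2 * pi) ^- n * \int['leb_n]_xi (cos (dotrV u xi) * E t xi).

Lemma heat_kernel1E t x y : heat_kernel beta 1 t x y = stable_kernel t (x - y).
Proof. exact: heat_kernel_cos. Qed.

Let measurable_E t : measurable_fun setT (E t).
Proof.
apply: (measurableT_comp (@measurable_expR R)); apply: measurable_funM => //.
apply: measurable_funD; first by apply: measurable_funX; exact: measurable_enorm.
apply: measurable_funM => //.
by apply: (measurableT_comp (measurable_powR _)); exact: measurable_enorm.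
Qed.

Let E_ge0 t xi : 0 <= E t xi. Proof. exact: expR_ge0. Qed.

Let E_le t xi : 0 < t -> E t xi <= gaussV t xi.
Proof.
move=> t0; rewrite /E /gaussV ler_expR mulNr lerN2 -enorm_sqr ler_wpM2l ?(ltW t0)//.
by rewrite lerDl mul1r powR_ge0.
Qed.

Let E_le1 t xi : 0 < t -> E t xi <= 1.
Proof.
move=> t0; rewrite -expR0 ler_expR mulNr oppr_le0 mulr_ge0 ?(ltW t0)//.
by rewrite addr_ge0 ?sqr_ge0// mul1r powR_ge0.
Qed.

Let symbol_le xi : enorm xi ^+ 2 + 1 * enorm xi `^ beta <= 1 + 2 * enorm xi ^+ 2.
Proof.
have e0 := enorm_ge0 xi; rewrite mul1r addrC mulrDl mul1r addrA lerD2r.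
have [e1|e1] := lerP (enorm xi) 1.
  apply: (@le_trans _ _ 1); last by rewrite lerDl sqr_ge0.
  have -> : 1 = 1 `^ beta :> R by rewrite powR1.
  by apply: ge0_ler_powR; rewrite ?nnegrE// ltW.
apply: (@le_trans _ _ (enorm xi ^+ 2)); last by rewrite lerDr.
by rewrite -powR_mulrn//; apply: ler_powR => //; exact: ltW.
Qed.

Let sqr_gaussV_le (a : R) xi : 0 < a ->
  enorm xi ^+ 2 * gaussV a xi <= 2 / a * gaussV (a / 2) xi.
Proof.
move=> a0; rewrite enorm_sqr.
have -> : gaussV a xi = gaussV (a / 2) xi * gaussV (a / 2) xi.
  by rewrite /gaussV -expRD; congr expR; field.
rewrite mulrA ler_wpM2r//; pose y := a / 2 * dotrV xi xi.
have -> : dotrV xi xi = 2 / a * y by rewrite /y; field; rewrite gt_eqF.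
have a2 : 0 <= 2 / a by rewrite divr_ge0// ltW.
rewrite -(mulrA (2 / a)) ler_piMr// /gaussV expRN -/y.
rewrite ler_pdivrMr ?expR_gt0// mul1r.
by apply: le_trans (expR_ge1Dx y); rewrite lerDr.
Qed.

Lemma measurable_stable_kernel t : measurable_fun setT (stable_kernel t).
Proof.
apply: measurable_funM => //.
apply: (@measurable_Rint R _ _ _ _ (lebesgue_rV n)
  (fun p => cos (dotrV p.1 p.2) * E t p.2)).
apply: measurable_funM; last exact: (measurableT_comp (measurable_E t)).
by apply: (measurableT_comp (@measurable_cosR R)); exact: measurable_dotrV.
Qed.

Section at_time.
Variables (t c : R).
Hypotheses (t0 : 0 < t) (c0 : 0 < c).
Hypothesis hk_ge0 : forall u, 0 <= stable_kernel t (c *: u).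

Let hk u := stable_kernel t (c *: u).

Let hk0 u : 0 <= hk u. Proof. exact: hk_ge0. Qed.

Let measurable_hk : measurable_fun setT hk.
Proof.
apply: (measurableT_comp (measurable_stable_kernel t)).
exact: measurable_scalerV.
Qed.

Let gam (eta : R) := c ^+ 2 / (4 * eta).
Let K (eta : R) := (2 * pi) ^- n * Num.sqrt (pi / eta) ^+ n.

Let gam_gt0 eta : 0 < eta -> 0 < gam eta.
Proof. by move=> e0; rewrite /gam divr_gt0 ?exprn_gt0// mulr_gt0. Qed.

Let K_ge0 eta : 0 <= K eta.
Proof. by rewrite mulr_ge0 ?invr_ge0 ?exprn_ge0// mulr_ge0// ltW// pi_gt0. Qed.

Let K_gauss eta : 0 < eta -> K eta * Num.sqrt (pi / gam eta) ^+ n = c ^- n.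
Proof.
move=> e0; rewrite /K -!exprVn -!exprMn; congr (_ ^+ n).
have p0 : 0 < (pi : R) by exact: pi_gt0.
rewrite -mulrA -sqrtrM; last by rewrite divr_ge0// ltW.
have F (p : R) : p / eta * (p / gam eta) = (2 * p / c) ^+ 2.
  by rewrite /gam; field; rewrite !gt_eqF.
rewrite F sqrtr_sqr ger0_norm; last by rewrite divr_ge0 ?mulr_ge0 ?(ltW p0) ?(ltW c0).
by rewrite mulKf// gt_eqF// mulr_gt0.
Qed.

(** By Fubini: the Gaussian is its own Fourier transform, up to scaling, and so passes
    from the kernel to the symbol [E]. *)
Let hk_gauss eta : 0 < eta ->
  rintegrable 'leb_n (fun u => hk u * gaussV eta u) /\
  \int['leb_n]_u (hk u * gaussV eta u) =
  K eta * \int['leb_n]_xi (E t xi * gaussV (gam eta) xi).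
Proof.
move=> e0.
pose F (p : 'rV[R]_n * 'rV[R]_n) : R :=
  gaussV eta p.1 * (cos (dotrV (c *: p.1) p.2) * E t p.2).
have mF : measurable_fun setT F.
  apply: measurable_funM; first exact: measurable_gaussV.
  apply: measurable_funM; last exact: (measurableT_comp (measurable_E t)).
  apply: (measurableT_comp (@measurable_cosR R)); apply: measurable_dotrV => //.
  exact: measurable_scalerV.
have mnF : measurable_fun setT (fun p => `|F p|) by exact: measurableT_comp.
have iF : rintegrable (prodm (lebesgue_rV n) (lebesgue_rV n)) F.
  apply: rintegrable_prodP => //.
  apply: (@le_lt_trans _ _ (\int['leb_n]_u \int['leb_n]_xi
      (gaussV eta u * gaussV t xi)%:E)%E).
    apply: ge0_le_integral => //.
    - by move=> u _; apply: integral_ge0 => xi _; rewrite lee_fin.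
    - exact: (@measurable_int R _ _ _ _ (lebesgue_rV n) (fun p => `|F p|)).
    - apply: (@measurable_int R _ _ _ _ (lebesgue_rV n)
        (fun p : 'rV[R]_n * 'rV[R]_n => gaussV eta p.1 * gaussV t p.2)).
      + by apply: measurable_funM; exact: measurable_gaussV.
      + by move=> p; rewrite mulr_ge0.
    - move=> u _; apply: ge0_le_int => //.
      + exact: (measurable_section1 u mnF).
      + by apply: measurable_funM => //; exact: measurable_gaussV.
      + move=> xi; rewrite /F /= !normrM (ger0_norm (gaussV_ge0 _ _)) ler_wpM2l//.
        rewrite (ger0_norm (E_ge0 _ _)) (le_trans _ (E_le xi t0))//.
        by rewrite ler_piMl// cos_max.
  under eq_int => u.
    rewrite ge0_intZl//; last exact: measurable_gaussV.
    rewrite int_gaussV// -EFinM mulrC; over.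
  rewrite ge0_intZl ?exprn_ge0//; last exact: measurable_gaussV.
  by rewrite int_gaussV// -EFinM ltry.
have hkF u : hk u * gaussV eta u = (2 * pi) ^- n * \int['leb_n]_xi F (u, xi).
  rewrite /hk /stable_kernel mulrAC -mulrA; congr (_ * _).
  rewrite -RintZl//.
  apply: (@rintegrable_dominated _ _ _ 'leb_n _ _ _ (rintegrable_gaussV n t0)).
    apply: measurable_funM => //.
    by apply: (measurableT_comp (@measurable_cosR R)); exact: measurable_dotrV.
  move=> xi; rewrite normrM (ger0_norm (E_ge0 _ _)) (le_trans _ (E_le xi t0))//.
  by rewrite ler_piMl// cos_max.
split.
  rewrite (_ : (fun _ => _) = fun u => ((2 * pi) ^- n * \int['leb_n]_xi F (u, xi))%:E).
    by apply: rintegrableZl; exact: (rintegrable_Rint iF).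
  by apply/funext => u; rewrite hkF.
transitivity ((2 * pi) ^- n * \int['leb_n]_u \int['leb_n]_xi F (u, xi)).
  by rewrite -RintZl; [apply: eq_Rint => u; rewrite hkF|exact: (rintegrable_Rint iF)].
rewrite /K -mulrA; congr (_ * _).
rewrite (Rint_swap iF) -RintZl; last first.
  apply: (@rintegrable_dominated _ _ _ 'leb_n _ _ _ (rintegrable_gaussV n (gam_gt0 e0))).
    by apply: measurable_funM => //; exact: measurable_gaussV.
  by move=> xi; rewrite ger0_norm ?mulr_ge0// ler_piMl// E_le1.
apply: eq_Rint => xi.
transitivity (E t xi * \int['leb_n]_u (cos (dotrV (c *: xi) u) * gaussV eta u)).
  rewrite -RintZl; last first.
    apply: rintegrable_mul_gaussV => //; last by move=> u; exact: cos_max.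
    by apply: (measurableT_comp (@measurable_cosR R)); exact: measurable_dotrV.
  apply: eq_Rint => u; rewrite /F /= dotrVZl dotrVC -dotrVZl; ring.
rewrite fourier_gaussV// mulrCA; congr (_ * (_ * _)).
rewrite /gaussV dotrVZl dotrVZr /gam; congr (expR (- _)).
by field; rewrite gt_eqF.
Qed.

Let int_hk_gauss_le eta : 0 < eta ->
  (\int['leb_n]_u (hk u * gaussV eta u)%:E <= (c ^- n)%:E)%E.
Proof.
move=> e0; have [i eq] := hk_gauss e0.
rewrite -(EFin_Rint i) lee_fin eq -(K_gauss e0) ler_wpM2l//.
rewrite -lee_fin -int_gaussV ?gam_gt0// EFin_Rint; last first.
  apply: (@rintegrable_dominated _ _ _ 'leb_n _ _ _ (rintegrable_gaussV n (gam_gt0 e0))).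
    by apply: measurable_funM => //; exact: measurable_gaussV.
  by move=> xi; rewrite ger0_norm ?mulr_ge0// ler_piMl// E_le1.
apply: ge0_le_int.
- by apply: measurable_funM => //; exact: measurable_gaussV.
- exact: measurable_gaussV.
- by move=> xi; rewrite mulr_ge0.
- by move=> xi; rewrite ler_piMl// E_le1.
Qed.

(** Letting the Gaussian in [int_hk_gauss_le] spread out. *)
Lemma int_stable_kernel_le : (\int['leb_n]_u (stable_kernel t (c *: u))%:E <= (c ^- n)%:E)%E.
Proof.
pose g (k : nat) u := (hk u * gaussV k.+1%:R^-1 u)%:E.
have cvg_g u : g k u @[k --> \oo] --> (hk u)%:E.
  apply: cvg_EFin; first exact: nearW.
  rewrite -[X in _ --> X]mulr1; apply: cvgM; first exact: cvg_cst.
  rewrite -[X in _ --> X]expR0; apply: continuous_cvg; first exact: continuous_expR.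
  rewrite -[X in _ --> X]oppr0; apply: cvgN.
  rewrite -[X in _ --> X](mul0r (dotrV u u)).
  by apply: cvgM; [exact: (@cvg_harmonic R)|exact: cvg_cst].
have := @monotone_convergence _ _ _ 'leb_n setT measurableT g.
have -> : (\int['leb_n]_x limn (g^~ x) = \int['leb_n]_u (hk u)%:E)%E.
  by apply: eq_int => u; apply/cvg_lim => //; exact: cvg_g.
move=> ->.
- apply: lime_le.
    apply: ereal_nondecreasing_is_cvgn => i j ij; apply: ge0_le_integral => //.
    + by move=> u _; rewrite lee_fin mulr_ge0.
    + by apply: measurable_EFinW; apply: measurable_funM => //; exact: measurable_gaussV.
    + by apply: measurable_EFinW; apply: measurable_funM => //; exact: measurable_gaussV.
    + move=> u _; rewrite lee_fin ler_wpM2l// ler_expR lerN2 ler_wpM2r ?dotrV_ge0//.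
      by rewrite lef_pV2 ?posrE// ler_nat.
  by apply: nearW => k; apply: int_hk_gauss_le; rewrite invr_gt0.
- by move=> k; apply: measurable_EFinW; apply: measurable_funM => //; exact: measurable_gaussV.
- by move=> k u _; rewrite lee_fin mulr_ge0.
- move=> u _ i j ij; rewrite lee_fin ler_wpM2l// ler_expR lerN2 ler_wpM2r ?dotrV_ge0//.
  by rewrite lef_pV2 ?posrE// ler_nat.
Qed.

Lemma rintegrable_stable_kernel : rintegrable 'leb_n (fun u => stable_kernel t (c *: u)).
Proof.
apply: rintegrable_bound => //; last first.
  under eq_int do rewrite ger0_norm//.
  exact: int_stable_kernel_le.
Qed.

(** By [hk_gauss] the mass that the Gaussian cut-off removes is a Gaussian average of
    [1 - E t], which is at most [t] times the exponent of the symbol. *)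
Lemma int_stable_kernel_tail eta : 0 < eta ->
  (\int['leb_n]_u (stable_kernel t (c *: u) * (1 - gaussV eta u))%:E <=
   (K eta * (Num.sqrt (pi / gam eta) ^+ n +
      4 / gam eta * Num.sqrt (pi / (gam eta / 2)) ^+ n) * t)%:E)%E.
Proof.
move=> e0; have [i eq] := hk_gauss e0; have g0 := gam_gt0 e0.
have iE : rintegrable 'leb_n (fun xi => E t xi * gaussV (gam eta) xi).
  apply: (@rintegrable_dominated _ _ _ 'leb_n _ _ _ (rintegrable_gaussV n g0)).
    by apply: measurable_funM => //; exact: measurable_gaussV.
  by move=> xi; rewrite ger0_norm ?mulr_ge0// ler_piMl// E_le1.
have ig := rintegrable_gaussV n g0.
have g02 : 0 < gam eta / 2 by rewrite divr_gt0.
have ig2 := rintegrable_gaussV n g02.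
have Rg (a : R) : 0 < a -> \int['leb_n]_xi (gaussV a xi) = Num.sqrt (pi / a) ^+ n.
  by move=> a0; rewrite /Rintegral int_gaussV.
have eqB : \int['leb_n]_u (stable_kernel t (c *: u) * (1 - gaussV eta u)) =
    \int['leb_n]_u (stable_kernel t (c *: u)) - \int['leb_n]_u (hk u * gaussV eta u).
  rewrite -RintB//; last exact: rintegrable_stable_kernel.
  by apply: eq_Rint => u; rewrite mulrBr mulr1.
have iB : rintegrable 'leb_n (fun u => stable_kernel t (c *: u) * (1 - gaussV eta u)).
  have := rintegrableB rintegrable_stable_kernel i; apply: eq_integrable => //.
  by move=> u _; rewrite mulrBr mulr1.
rewrite -(EFin_Rint iB) lee_fin eqB eq.
have mass : \int['leb_n]_u (stable_kernel t (c *: u)) <=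
    K eta * \int['leb_n]_xi (gaussV (gam eta) xi).
  rewrite Rg// K_gauss// -lee_fin EFin_Rint; last exact: rintegrable_stable_kernel.
  exact: int_stable_kernel_le.
apply: (le_trans (lerB mass (lexx _))).
rewrite -mulrBr -mulrA ler_wpM2l// -RintB//.
have ig24 := rintegrableZl (4 / gam eta) ig2.
have igs := rintegrableD ig ig24.
have <- : \int['leb_n]_xi (t * (gaussV (gam eta) xi + 4 / gam eta * gaussV (gam eta / 2) xi))
   = (Num.sqrt (pi / gam eta) ^+ n +
     4 / gam eta * Num.sqrt (pi / (gam eta / 2)) ^+ n) * t.
  rewrite (RintZl t igs) (RintD ig ig24) (RintZl _ ig2) (Rg _ g0).
  by rewrite (Rg _ g02) mulrC.
apply: le_Rint.
- exact: rintegrableB.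
- exact: rintegrableZl.
move=> xi.
have h1 : 1 - E t xi <= t * (1 + 2 * enorm xi ^+ 2).
  rewrite lerBlDr addrC -lerBlDr (le_trans _ (expR_ge1Dx _))// mulNr lerD2l lerN2.
  by rewrite ler_wpM2l ?(ltW t0)// symbol_le.
rewrite -[X in X - _]mul1r -mulrBl.
apply: (le_trans (ler_wpM2r (gaussV_ge0 _ _) h1)).
rewrite -(mulrA t) ler_wpM2l ?(ltW t0)// mulrDl mul1r lerD2l -(mulrA 2).
apply: (le_trans (ler_wpM2l (ler0n _ 2) (sqr_gaussV_le xi g0))).
by rewrite !mulrA -natrM.
Qed.

End at_time.
End stable_kernel.

(** * Integrability of power singularities *)

Section layers.
Context {R : realType}.

Lemma powR_exprn (x p : R) k : 0 <= x -> (x ^+ k) `^ p = (x `^ p) ^+ k.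
Proof.
by move=> x0; rewrite -(powR_mulrn k x0) -(powR_mulrn k (powR_ge0 x p)) -!powRrM mulrC.
Qed.

Lemma powR_inv (x p : R) : 0 < x -> (x^-1) `^ p = (x `^ p)^-1.
Proof.
move=> x0; have xp : x `^ p != 0 by rewrite gt_eqF// powR_gt0.
apply: (mulIf xp); rewrite mulVf// -powRM ?invr_ge0 ?ltW// mulVf ?gt_eqF//.
by rewrite powR1.
Qed.

Lemma natr_le_exp2 k : k%:R <= 2 ^+ k :> R.
Proof. by rewrite -natrX ler_nat ltnW// ltn_expl. Qed.

Lemma dyadic_small (r : R) : 0 < r -> r <= 1 -> exists k, 2^-1 ^+ k.+1 < r <= 2^-1 ^+ k.
Proof.
move=> r0 r1; have ex : exists n, (2^-1 ^+ n < r).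
  exists (Num.truncn r^-1).+1; rewrite exprVn invf_plt ?posrE ?exprn_gt0//.
  exact: lt_le_trans (truncnS_gt _) (natr_le_exp2 _).
case: (ex_minnP ex) => -[|k] hk kmin; first by move: hk; rewrite expr0 ltNge r1.
exists k; rewrite hk/= leNgt; apply/negP => /kmin.
by rewrite ltnn.
Qed.

Lemma dyadic_large (r : R) : 1 < r -> exists k, 2 ^+ k < r <= 2 ^+ k.+1.
Proof.
move=> r1; have ex : exists n, (r <= 2 ^+ n).
  exists (Num.truncn r).+1; apply: ltW.
  exact: lt_le_trans (truncnS_gt _) (natr_le_exp2 _).
case: (ex_minnP ex) => -[|k] hk kmin; first by move: hk; rewrite expr0 leNgt r1.
exists k; rewrite hk andbT ltNge; apply/negP => /kmin.
by rewrite ltnn.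
Qed.

Context d (T : measurableType d) (mu : {measure set T -> \bar R}).

(** [f] is at most the sum over [k] of the constants [c k] on the layers [S k], which
    integrates to a geometric series. *)
Lemma int_layers_le (f : T -> R) (S : nat -> set T) (c : nat -> R) (C q : R) :
  measurable_fun setT f -> (forall x, 0 <= f x) -> (forall k, measurable (S k)) ->
  (forall k, 0 <= c k) -> (forall x, f x != 0 -> exists2 k, S k x & f x <= c k) ->
  0 <= C -> 0 <= q -> q < 1 ->
  (forall k, (c k)%:E * mu (S k) <= (C * q ^+ k)%:E)%E ->
  (\int[mu]_x (f x)%:E <= (C / (1 - q))%:E)%E.
Proof.
move=> mf f0 mS c0 fS C0 q0 q1 cS.
pose g k x : \bar R := (c k * \1_(S k) x)%:E.
have g0 k x : (0 <= g k x)%E by rewrite lee_fin mulr_ge0.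
have mg k : measurable_fun setT (g k).
  by apply: measurable_EFinW; apply: measurable_funM => //; exact: measurable_indic.
apply: (@le_trans _ _ (\int[mu]_x (\sum_(k <oo) g k x)%E)%E).
  apply: ge0_le_integral => //.
  - by move=> x _; rewrite lee_fin.
  - exact: measurable_EFinW.
  - exact: ge0_emeasurable_sum.
  - move=> x _; have [->|/fS[k Sk fk]] := eqVneq (f x) 0.
      exact: nneseries_ge0.
    rewrite (@nneseriesD1 _ _ k)//; apply: (@le_trans _ _ (g k x)).
      by rewrite /g indicE mem_set// mulr1 lee_fin.
    by rewrite leeDl//; exact: nneseries_ge0.
rewrite integral_nneseries//.
apply: lime_le.
  by apply: is_cvg_nneseries => k _ _; exact: integral_ge0.
apply: nearW => n.
apply: (@le_trans _ _ (\sum_(0 <= k < n) (C * q ^+ k)%:E)%E).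
  apply: lee_sum => k _; apply: le_trans (cS k); rewrite /g.
  have mi : measurable_fun setT (fun x => \1_(S k) x : R) by exact: measurable_indic.
  by rewrite (ge0_intZl mu (c0 k) mi)// integral_indic// setIT.
rewrite sumEFin lee_fin.
have := cvg_geometric_series (a := C) (z := q).
rewrite ger0_norm// => /(_ q1) cg.
rewrite -(cvg_lim _ cg)//; apply: nondecreasing_cvgn_le; last by apply/cvg_ex; exists (C / (1 - q)).
apply: nondecreasing_series => k _ _.
by rewrite /geometric /= mulr_ge0// exprn_ge0.
Qed.

Variables (rho : T -> R) (D : nat) (C : R).
Hypothesis mrho : measurable_fun setT rho.
Hypothesis rho0 : forall x, 0 <= rho x.
Hypothesis C0 : 0 <= C.
Hypothesis growth : forall r : R, 0 < r ->
  (mu [set x | rho x <= r]%R <= (C * r ^+ D)%:E)%E.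

Let measurable_ball r : measurable [set x | rho x <= r].
Proof.
rewrite (_ : [set x | _] = setT `&` rho @^-1` `]-oo, r]%classic).
  by apply: mrho.
by rewrite setTI; apply/seteqP; split => x /=; rewrite in_itv.
Qed.

Let measurable_pow p : measurable_fun setT (fun x => (rho x `^ p)^-1).
Proof. by apply: measurable_funV; apply: (measurableT_comp (measurable_powR _)). Qed.

(** On the dyadic shell of radius [2^-k] the integrand is at most [2^(p (k + 1))], and
    the volume of the shell is at most [C 2^(- k D)]. *)
Lemma int_power_near0 p : 0 < p -> p < D%:R ->
  (\int[mu]_x ((rho x `^ p)^-1 * \1_[set x | rho x <= 1] x)%:E < +oo)%E.
Proof.
move=> p0 pD; pose a : R := 2 `^ p.
have a0 : 0 < a by exact: powR_gt0.
have q1 : a / 2 ^+ D < 1.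
  rewrite ltr_pdivrMr ?exprn_gt0// mul1r -powR_mulrn// /a.
  by rewrite /powR !ifF ?gt_eqF// ltr_expR ltr_pM2r// ln_gt0// ltr1n.
apply: le_lt_trans (ltry (C * a / (1 - a / 2 ^+ D))).
apply: (@int_layers_le _ (fun k => [set x | rho x <= 2^-1 ^+ k]) (fun k => a ^+ k.+1)) => //.
- by apply: measurable_funM => //; exact: measurable_indic.
- by move=> x; rewrite mulr_ge0// invr_ge0 powR_ge0.
- by move=> k; rewrite exprn_ge0// ltW.
- move=> x; rewrite indicE; have [|] := boolP (x \in _); last by rewrite mulr0 eqxx.
  rewrite inE/= mulr1 => x1 xn0.
  have x0 : 0 < rho x.
    rewrite lt_neqAle rho0 andbT eq_sym; apply: contraNneq xn0 => ->.
    by rewrite powR0 ?invr0 ?eqxx// gt_eqF.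
  have [k /andP[k1 k2]] := dyadic_small x0 x1; exists k => //.
  rewrite -[leRHS]invrK lef_pV2 ?posrE ?powR_gt0 ?invr_gt0 ?exprn_gt0//.
  rewrite -exprVn -powR_inv// -powR_exprn ?invr_ge0//.
  by apply: ge0_ler_powR; rewrite ?nnegrE ?(ltW p0) ?exprn_ge0 ?invr_ge0// ltW.
- by rewrite mulr_ge0// ltW.
- by rewrite divr_ge0 ?exprn_ge0// ltW.
- move=> k; have h : 0 < (2^-1 : R) ^+ k by rewrite exprn_gt0// invr_gt0.
  apply: (le_trans (lee_wpmul2l _ (growth h))); first by rewrite lee_fin exprn_ge0// ltW.
  rewrite -EFinM lee_fin exprS exprMn !exprVn -exprM mulnC exprM.
  by rewrite le_eqVlt; apply/orP; left; apply/eqP; ring.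
Qed.

Lemma int_power_infty p : D%:R < p ->
  (\int[mu]_x ((rho x `^ p)^-1 * \1_[set x | 1 < rho x] x)%:E < +oo)%E.
Proof.
move=> Dp; pose a : R := 2 `^ p.
have p0 : 0 < p by rewrite (le_lt_trans _ Dp).
have a0 : 0 < a by exact: powR_gt0.
have q1 : 2 ^+ D / a < 1.
  rewrite ltr_pdivrMr// mul1r -powR_mulrn// /a.
  by rewrite /powR !ifF ?gt_eqF// ltr_expR ltr_pM2r// ln_gt0// ltr1n.
apply: le_lt_trans (ltry (C * 2 ^+ D / (1 - 2 ^+ D / a))).
have mS : measurable [set x | 1 < rho x].
  rewrite (_ : [set x | 1 < rho x] = ~` [set x | rho x <= 1]); first exact: measurableC.
  by apply/seteqP; split=> x /=; rewrite ltNge => /negP.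
apply: (@int_layers_le _ (fun k => [set x | rho x <= 2 ^+ k.+1]) (fun k => a^-1 ^+ k)) => //.
- by apply: measurable_funM => //; exact: measurable_indic.
- by move=> x; rewrite mulr_ge0// invr_ge0 powR_ge0.
- by move=> k; rewrite exprn_ge0// invr_ge0 ltW.
- move=> x; rewrite indicE; have [|] := boolP (x \in _); last by rewrite mulr0 eqxx.
  rewrite inE/= mulr1 => x1 xn0.
  have [k /andP[k1 k2]] := dyadic_large x1; exists k => //.
  rewrite exprVn lef_pV2 ?posrE ?powR_gt0 ?exprn_gt0 ?(lt_trans _ x1)//.
  rewrite -powR_exprn//.
  by apply: ge0_ler_powR; rewrite ?nnegrE ?(ltW p0) ?exprn_ge0// ltW.
- by rewrite mulr_ge0// exprn_ge0.
- by rewrite divr_ge0 ?exprn_ge0// ltW.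
- move=> k; have h : 0 < (2 : R) ^+ k.+1 by rewrite exprn_gt0.
  apply: (le_trans (lee_wpmul2l _ (growth h))); first by rewrite lee_fin exprn_ge0// invr_ge0 ltW.
  rewrite -EFinM lee_fin exprMn -exprM mulSn exprD (mulnC k) exprM.
  by rewrite le_eqVlt; apply/orP; left; apply/eqP; ring.
Qed.

End layers.

Section power_weights.
Context {R : realType}.
Local Notation leb := (@lebesgue_measure R).
Local Notation "'leb_ d" := (lebesgue_rV d : {measure set 'rV[R]_d -> \bar R})
  (at level 0, d at level 0).

Lemma powR_small (C kappa e : R) : 0 <= C -> 0 < kappa -> 0 < e ->
  exists2 delta, 0 < delta <= 1 & C * delta `^ kappa <= e.
Proof.
move=> C0 k0 e0; have C1 : 0 < C + 1 by rewrite ltr_wpDl.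
pose x := Num.min 1 (e / (C + 1)).
have x0 : 0 < x by rewrite lt_min ltr01 divr_gt0.
exists (x `^ kappa^-1).
  rewrite powR_gt0//=; apply: (@le_trans _ _ (1 `^ kappa^-1)); last by rewrite powR1.
  by apply: ge0_ler_powR; rewrite ?nnegrE ?invr_ge0 ?(ltW k0) ?(ltW x0)// ge_min lexx.
rewrite -powRrM mulVf ?gt_eqF// powRr1 ?(ltW x0)//.
apply: (@le_trans _ _ ((C + 1) * (e / (C + 1)))); last by rewrite mulrCA divff ?mulr1// gt_eqF.
by apply: ler_pM; rewrite ?(ltW x0) ?lerDl// ge_min lexx orbT.
Qed.

Lemma lebesgue_ball_growth (r : R) : 0 < r ->
  (leb [set t : R | `|t| <= r]%R <= (2 * r ^+ 1)%:E)%E.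
Proof.
move=> r0; rewrite (_ : [set t : R | _] = `[- r, r]%classic); last first.
  by apply/seteqP; split => t /=; rewrite in_itv/= ler_norml.
rewrite lebesgue_measure_itv/= lte_fin; case: ifP => _; rewrite -?EFinD lee_fin; lra.
Qed.

(** A power [t0^kappa] is taken out of the integrable weight [s^-(theta + kappa)]. *)
Lemma int_time_weight (theta : R) : 0 < theta -> theta < 1 ->
  exists C kappa : R, [/\ 0 <= C, 0 < kappa & forall t0 : R, 0 < t0 <= 1 ->
    (\int[leb]_s ((s `^ theta)^-1 * \1_(`]0%R, t0[ : set R) s)%:E <= (C * t0 `^ kappa)%:E)%E].
Proof.
move=> th0 th1; pose k := (1 - theta) / 2.
have k0 : 0 < k by rewrite divr_gt0// subr_gt0.
have mn : measurable_fun setT (fun t : measurableTypeR R => `|t : R| : R).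
  exact: (measurableT_comp (@normr_measurable R setT) (@measurable_time R)).
have tk1 : theta + k < 1%:R by rewrite /k; lra.
have tk0 : 0 < theta + k by rewrite addr_gt0.
have fin := int_power_near0 mn (fun t => normr_ge0 _) (ler0n _ 2) lebesgue_ball_growth tk0 tk1.
set I := (\int[_]_x _)%E in fin.
have I0 : (0 <= I)%E by apply: integral_ge0 => x _; rewrite lee_fin mulr_ge0// invr_ge0 powR_ge0.
exists (fine I), k; split=> //; first by rewrite fine_ge0.
move=> t0 /andP[t00 t01].
rewrite mulrC EFinM fineK ?ge0_fin_numE// /I.
have m2 p : measurable_fun setT (fun t : measurableTypeR R => (`|t : R| `^ p)^-1 : R).
  apply: measurable_funV; exact: (measurableT_comp (measurable_powR p) mn).
have mu1 : measurable_fun setT (fun t : measurableTypeR R =>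
    (`|t : R| `^ (theta + k))^-1 * \1_[set x : measurableTypeR R | `|x : R| <= 1] t : R).
  apply: measurable_funM => //; apply: measurable_indic.
  rewrite (_ : [set x | _] = `[(-1 : R), 1]%classic); first exact: measurable_itv.
  by apply/seteqP; split => t /=; rewrite in_itv/= ler_norml.
rewrite -(ge0_intZl _ (powR_ge0 t0 k) mu1); last first.
  by move=> x; rewrite mulr_ge0// invr_ge0 powR_ge0.
apply: ge0_le_int.
- apply: measurable_funM; last exact: measurable_indic.
  apply: measurable_funV; exact: (measurableT_comp (measurable_powR theta) (@measurable_time R)).
- exact: measurable_funM.
- by move=> s; rewrite mulr_ge0// invr_ge0 powR_ge0.
move=> s; rewrite [X in _ * X <= _]indicE; have [|_] := boolP (s \in _); last first.
  by rewrite mulr0 mulr_ge0 ?powR_ge0// mulr_ge0// invr_ge0 powR_ge0.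
rewrite inE/= in_itv/= => /andP[s0 st]; rewrite mulr1 ger0_norm ?(ltW s0)//.
rewrite indicE mem_set/=; last by rewrite ger0_norm ?(ltW s0)// (le_trans (ltW st)).
rewrite mulr1 powRD ?(gt_eqF s0) ?implybT// invfM mulrCA ler_peMr ?invr_ge0 ?powR_ge0//.
rewrite ler_pdivlMr ?powR_gt0// mul1r.
by apply: ge0_ler_powR; rewrite ?nnegrE ?(ltW k0) ?(ltW s0) ?(ltW t00) ?(ltW st).
Qed.

Variables (d : nat) (beta : R).
Hypotheses (d_ge1 : (1 <= d)%N) (beta_gt0 : 0 < beta) (beta_lt2 : beta < 2).
Implicit Types w : 'rV[R]_d.

(** The density of the rotation-invariant [beta]-stable Levy measure, up to a constant. *)
Definition levy w : R := (enorm w `^ (d%:R + beta))^-1.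

(** An exponent strictly between [beta / 2] and [1]: the lower bound makes
    [levy_cut * levy] integrable near the origin, the upper one makes [s^-theta]
    integrable near [0]. *)
Definition theta : R := (2 + beta) / 4.

(** A weight between the two bounds for second differences, [1] and [|w|^2], that
    scales like [s^theta] in parabolic units. *)
Definition levy_cut w : R := Num.min 1 (enorm w `^ (2 * theta)).

Lemma theta_gt0 : 0 < theta. Proof. by rewrite /theta divr_gt0// addr_gt0. Qed.
Lemma theta_lt1 : theta < 1.
Proof. rewrite /theta ltr_pdivrMr//. by move: beta_lt2; lra. Qed.

Lemma levy_ge0 w : 0 <= levy w. Proof. by rewrite invr_ge0 powR_ge0. Qed.

Lemma levy_cut_ge0 w : 0 <= levy_cut w.
Proof. by rewrite le_min ler01 powR_ge0. Qed.

Lemma measurable_levy : measurable_fun setT levy.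
Proof.
apply: measurable_funV; apply: (measurableT_comp (measurable_powR _)).
exact: measurable_enorm.
Qed.

Lemma measurable_levy_cut : measurable_fun setT levy_cut.
Proof.
apply: measurable_minr => //; apply: (measurableT_comp (measurable_powR _)).
exact: measurable_enorm.
Qed.

Lemma measurable_enorm_le (r : R) : measurable [set w : 'rV[R]_d | enorm w <= r].
Proof.
have me : measurable_fun setT (@enorm R d) by exact: measurable_enorm.
have := me measurableT `]-oo, r]%classic (measurable_itv _).
rewrite setTI; have -> // : (@enorm R d) @^-1` `]-oo, r]%classic = [set w | enorm w <= r].
by apply/seteqP; split => x /=; rewrite in_itv.
Qed.

Lemma measurable_enorm_gt (r : R) : measurable [set w : 'rV[R]_d | r < enorm w].
Proof.
have me : measurable_fun setT (@enorm R d) by exact: measurable_enorm.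
have := me measurableT `]r, +oo[%classic (measurable_itv _).
rewrite setTI; have -> // : (@enorm R d) @^-1` `]r, +oo[%classic = [set w | r < enorm w].
by apply/seteqP; split => x /=; rewrite in_itv/= andbT.
Qed.

Lemma measurable_box (u v : 'rV[R]_d) :
  measurable [set x : 'rV[R]_d | forall i, u ord0 i <= x ord0 i <= v ord0 i].
Proof.
rewrite (_ : [set x | _] = \big[setI/setT]_(i < d)
    [set x : 'rV[R]_d | x ord0 i \in `[u ord0 i, v ord0 i]]).
  apply: bigsetI_measurable => i _.
  rewrite -[X in measurable X]setTI.
  exact: (@measurable_coord _ R d i measurableT _ (measurable_itv _)).
rewrite -bigcap_seq; apply/seteqP; split => x /= h i.
  by move=> _ /=; rewrite in_itv/=; exact: h.
by have /= := h i; rewrite in_itv/=; apply; rewrite mem_index_enum.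
Qed.

Lemma enorm_growth (r : R) : 0 < r ->
  ('leb_d [set w | enorm w <= r]%R <= (2 ^+ d * r ^+ d)%:E)%E.
Proof.
move=> r0; pose u : 'rV[R]_d := const_mx (- r); pose v : 'rV[R]_d := const_mx r.
have uv i : u ord0 i <= v ord0 i by rewrite !mxE; lra.
apply: (@le_trans _ _ (\prod_(i < d) (v ord0 i - u ord0 i))%:E).
  rewrite -(lebesgue_rV_box uv); apply: le_measure; rewrite ?inE.
  - exact: measurable_enorm_le.
  - exact: measurable_box.
  - move=> w /= wr i; rewrite !mxE -ler_norml.
    exact: le_trans (coord_le_enorm _ _) wr.
rewrite lee_fin -exprMn (eq_bigr (fun=> 2 * r)); last by move=> i _; rewrite !mxE; lra.
by rewrite prodr_const card_ord.
Qed.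

Let fin_near (p : R) : 0 < p -> p < d%:R ->
  (\int['leb_d]_w ((enorm w `^ p)^-1 * \1_[set w | enorm w <= 1] w)%:E < +oo)%E.
Proof.
have me : measurable_fun setT (@enorm R d) by exact: measurable_enorm.
have c0 : 0 <= (2 : R) ^+ d by exact: exprn_ge0.
exact: (int_power_near0 me (@enorm_ge0 R d) c0 enorm_growth).
Qed.

Let cut_small w : enorm w <= 1 -> levy_cut w = enorm w `^ (2 * theta).
Proof.
move=> w1; apply/min_idPr; apply: (@le_trans _ _ (1 `^ (2 * theta))); last by rewrite powR1.
by apply: ge0_ler_powR; rewrite ?nnegrE ?enorm_ge0// mulr_ge0// ltW// theta_gt0.
Qed.

Lemma int_levy_small : exists C kappa : R, [/\ 0 <= C, 0 < kappa &
  forall delta : R, 0 < delta <= 1 ->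
  (\int['leb_d]_w (levy_cut w * levy w * \1_[set w | enorm w <= delta] w)%:E <=
    (C * delta `^ kappa)%:E)%E].
Proof.
pose k := (1 - beta / 2) / 2; pose p := d%:R - k.
have [b0 b2] := (beta_gt0, beta_lt2).
have k0 : 0 < k by rewrite /k; lra.
have d1 : 1 <= d%:R :> R by rewrite ler1n.
have p0 : 0 < p by rewrite /p /k; lra.
have pd : p < d%:R by rewrite /p; lra.
have fin := fin_near p0 pd.
set I := (\int[_]_x _)%E in fin.
have I0 : (0 <= I)%E by apply: integral_ge0 => x _; rewrite lee_fin mulr_ge0// invr_ge0 powR_ge0.
exists (fine I), k; split=> //; first by rewrite fine_ge0.
move=> delta /andP[de0 de1].
rewrite mulrC EFinM fineK ?ge0_fin_numE// /I.
have mI r : measurable_fun setT (fun w => \1_[set w | enorm w <= r] w : R).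
  by apply: measurable_indic; exact: measurable_enorm_le.
have mp : measurable_fun setT (fun w => (enorm w `^ p)^-1 * \1_[set w | enorm w <= 1] w).
  apply: measurable_funM => //; apply: measurable_funV.
  by apply: (measurableT_comp (measurable_powR _)); exact: measurable_enorm.
rewrite -(ge0_intZl _ (powR_ge0 delta k) mp); last first.
  by move=> x; rewrite mulr_ge0// invr_ge0 powR_ge0.
apply: ge0_le_int.
- apply: measurable_funM => //.
  by apply: measurable_funM; [exact: measurable_levy_cut|exact: measurable_levy].
- exact: measurable_funM.
- by move=> w; rewrite !mulr_ge0 ?levy_cut_ge0 ?levy_ge0.
move=> w; rewrite [X in _ * X <= _]indicE; have [|_] := boolP (w \in _); last first.
  by rewrite mulr0 mulr_ge0 ?powR_ge0// mulr_ge0// invr_ge0 powR_ge0.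
rewrite inE/= => wd; have w1 := le_trans wd de1.
rewrite mulr1 indicE mem_set//= mulr1 cut_small//.
have [->|w0] := eqVneq w 0.
  rewrite /levy enorm0 [X in _ * X^-1 <= _]powR0 ?invr0 ?mulr0; last by rewrite gt_eqF// ltr_wpDl.
  by rewrite mulr_ge0 ?invr_ge0 ?powR_ge0.
have e0 : 0 < enorm w by rewrite enorm_gt0.
rewrite ler_pdivlMr ?powR_gt0// /levy -powRN -!powRD ?(gt_eqF e0) ?implybT//.
have -> : 2 * theta - (d%:R + beta) + p = k by rewrite /theta /p /k; lra.
by apply: ge0_ler_powR; rewrite ?nnegrE ?(ltW k0) ?enorm_ge0 ?(ltW de0).
Qed.

Lemma rintegrable_levy : rintegrable 'leb_d (fun w => levy_cut w * levy w).
Proof.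
have mcl : measurable_fun setT (fun w => levy_cut w * levy w).
  by apply: measurable_funM; [exact: measurable_levy_cut|exact: measurable_levy].
have mI r : measurable_fun setT (fun w => \1_[set w | enorm w <= r] w : R).
  by apply: measurable_indic; exact: measurable_enorm_le.
have mS := measurable_enorm_gt 1.
have mI2 : measurable_fun setT (fun w => \1_[set w | 1 < enorm w] w : R).
  exact: measurable_indic.
have [C [k [C0 k0 h]]] := int_levy_small.
have small : rintegrable 'leb_d (fun w => levy_cut w * levy w * \1_[set w | enorm w <= 1] w).
  apply: (rintegrable_bound (c := C * 1 `^ k)); first exact: measurable_funM.
  under eq_int do rewrite ger0_norm ?mulr_ge0 ?levy_cut_ge0 ?levy_ge0//.
  by apply: h; rewrite ltr01 lexx.
have large : rintegrable 'leb_d (fun w => levy w * \1_[set w | 1 < enorm w] w).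
  apply: rintegrableP; first by apply: measurable_funM => //; exact: measurable_levy.
  under eq_int do rewrite ger0_norm ?mulr_ge0 ?levy_ge0//.
  have me : measurable_fun setT (@enorm R d) by exact: measurable_enorm.
  have c0 : 0 <= (2 : R) ^+ d by exact: exprn_ge0.
  apply: (int_power_infty me (@enorm_ge0 R d) c0 enorm_growth).
  by rewrite ltrDl.
apply: (@rintegrable_dominated _ _ _ 'leb_d _ _ mcl (rintegrableD small large)) => w.
rewrite ger0_norm ?mulr_ge0 ?levy_cut_ge0 ?levy_ge0// !indicE.
have [w1|w1] := leP (enorm w) 1.
  by rewrite mem_set//= mulr1 lerDl mulr_ge0// levy_ge0.
rewrite (_ : (w \in [set w | 1 < enorm w]) = true); last by apply/mem_set.
rewrite mulr1 -[leLHS]add0r lerD//.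
  by rewrite !mulr_ge0 ?levy_cut_ge0 ?levy_ge0.
by rewrite ler_piMl ?levy_ge0// ge_min lexx.
Qed.

(** As [min(1, r) <= r^theta], the parabolic scale is traded for an integrable power
    of time. *)
Lemma min_parabolic_le (s : R) w : 0 < s <= 1 ->
  Num.min 1 (dotrV w w / (4 * s)) <= (s `^ theta)^-1 * levy_cut w.
Proof.
move=> /andP[s0 s1].
have st1 : 1 <= (s `^ theta)^-1.
  rewrite invf_ge1 ?powR_gt0//; apply: (@le_trans _ _ (1 `^ theta)); last by rewrite powR1.
  by apply: ge0_ler_powR; rewrite ?nnegrE ?(ltW s0)// ltW// theta_gt0.
rewrite /levy_cut minr_pMr ?invr_ge0 ?powR_ge0// le_min; apply/andP; split.
  by rewrite mulr1 (le_trans _ st1)// ge_min lexx.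
set x := dotrV w w / (4 * s).
have x0 : 0 <= x by rewrite divr_ge0 ?dotrV_ge0// mulr_ge0// ltW.
apply: (@le_trans _ _ (x `^ theta)).
  have [x1|x1] := lerP x 1.
    have [->|xn0] := eqVneq x 0; first exact: powR_ge0.
    have xp : 0 < x by rewrite lt_neqAle eq_sym xn0.
    rewrite -[leLHS]powRr1// /powR (negbTE xn0) ler_expR.
    by rewrite ler_wnM2r ?ln_le0// ltW// theta_lt1.
  apply: (@le_trans _ _ (1 `^ theta)); first by rewrite powR1.
  by apply: ge0_ler_powR; rewrite ?nnegrE ?(ltW x1) ?(ltW theta_gt0).
apply: (@le_trans _ _ ((s^-1 * enorm w ^+ 2) `^ theta)).
  apply: ge0_ler_powR; rewrite ?nnegrE ?(ltW theta_gt0)//.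
    by rewrite mulr_ge0 ?sqr_ge0// invr_ge0 ltW.
  rewrite /x enorm_sqr mulrC invfM -mulrA ler_piMl//.
    by rewrite mulr_ge0 ?dotrV_ge0// invr_ge0 ltW.
  by rewrite invf_le1// ler1n.
rewrite powRM ?invr_ge0 ?sqr_ge0 ?(ltW s0)// powR_inv// ler_wpM2l ?invr_ge0 ?powR_ge0//.
by rewrite -(powR_mulrn 2 (enorm_ge0 w)) -powRrM.
Qed.

End power_weights.

(** * The nonlocal operator on the heat kernel *)

Section nonlocal_gauss.
Context {R : realType}.
Local Notation leb := (@lebesgue_measure R).
Local Notation "'leb_ d" := (lebesgue_rV d : {measure set 'rV[R]_d -> \bar R})
  (at level 0, d at level 0).
#[local] Hint Extern 0 (is_true (0 <= gk _ _)) => solve [apply: gk_ge0] : core.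

Lemma expR_taylor2 (x : R) : 0 <= expR x - 1 - x <= x ^+ 2 * expR `|x|.
Proof.
have le1 (y : R) : expR y - 1 <= y * expR y.
  have e0 := expR_gt0 y.
  have : (1 - y) * expR y <= (expR y)^-1 * expR y.
    by rewrite ler_wpM2r ?(ltW e0)// -expRN; exact: (expR_ge1Dx (- y)).
  rewrite mulVf ?gt_eqF//; lra.
apply/andP; split; first by have := expR_ge1Dx x; lra.
apply: (@le_trans _ _ (x * (expR x - 1))); first by have := le1 x; lra.
have ab : `|expR x - 1| <= `|x| * expR `|x|.
  have [x0|x0] := leP 0 x.
    rewrite (ger0_norm x0) ger0_norm; first exact: le1.
    by rewrite subr_ge0 -expR0 ler_expR.
  rewrite (ler0_norm (ltW x0)) ler0_norm; last by rewrite subr_le0 -[leRHS]expR0 ler_expR ltW.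
  rewrite opprB; have h := expR_ge1Dx x.
  apply: (@le_trans _ _ (- x)); first lra.
  by rewrite ler_peMr ?oppr_ge0 ?(ltW x0)// -expR0 ler_expR oppr_ge0 ltW.
apply: (le_trans (ler_norm _)); rewrite normrM.
rewrite -(real_normK (num_real x)) expr2 -mulrA.
by rewrite ler_wpM2l.
Qed.

Variables (d : nat) (beta : R).
Hypotheses (d_ge1 : (1 <= d)%N) (beta_gt0 : 0 < beta) (beta_lt2 : beta < 2).
Implicit Types x y z u w : 'rV[R]_d.

Lemma gk_le0 (s : R) u : 0 < s -> gk s u <= gk s (0 : 'rV[R]_d).
Proof.
move=> s0; rewrite /gk ler_wpM2l ?invr_ge0 ?exprn_ge0//.
rewrite /gaussV ler_expR dotrV0 mulr0 oppr0 oppr_le0.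
by rewrite mulr_ge0 ?dotrV_ge0// invr_ge0 mulr_ge0// ltW.
Qed.

Lemma derive_gk (s : R) y z w : s != 0 ->
  'D_w (fun x => gk s (x - y)) z = - gk s (z - y) * (dotrV (z - y) w / (2 * s)).
Proof.
move=> s0; set u := z - y.
pose phi (h : R) := gk s u * (expR (- (h ^+ 2 * (dotrV w w / (4 * s)))) *
                        expR (- (h * (dotrV u w / (2 * s))))).
have phiE h : gk s (h *: w + z - y) = phi h.
  rewrite -addrA addrC -/u gk_shiftE dotrVZl !dotrVZr; congr (_ * (expR _ * expR _)).
    by rewrite expr2 !mulrA.
  by rewrite !mulrA.
have dphi : is_derive (0 : R) 1 phi (- gk s u * (dotrV u w / (2 * s))).
  apply: is_derive_eq; rewrite /= /GRing.scale/=.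
  rewrite !(expr0n, mul0r, mulr0, mulr1, mul1r, oppr0, expR0, add0r, addr0)/=.
  by rewrite mulrN mulNr.
have [_ <-] := dphi.
rewrite /derive; have -> : (fun h : R => h^-1 *: (((fun x => gk s (x - y)) \o shift z) (h *: w)
    - gk s (z - y))) = (fun h : R => h^-1 *: ((phi \o shift 0) (h *: 1) - phi 0)) => //.
apply/funext => h /=; congr (_ *: (_ - _)); first by rewrite phiE scaler1 addr0.
by rewrite -phiE scale0r add0r.
Qed.

Lemma gradient_gk (s : R) y z w : s != 0 ->
  dotrV (gradient (fun x => gk s (x - y)) z) w = - gk s (z - y) * (dotrV (z - y) w / (2 * s)).
Proof.
move=> s0; rewrite /dotrV /gradient.
rewrite (eq_bigr (fun i => - gk s (z - y) * ((z - y) ord0 i * w ord0 i / (2 * s)))).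
  by rewrite -mulr_sumr -mulr_suml.
move=> i _; rewrite mxE derive_gk//.
have -> : dotrV (z - y) (delta_mx ord0 i) = (z - y) ord0 i.
  rewrite /dotrV (bigD1 i)//= big1 ?addr0; first by rewrite [X in _ * X]mxE !eqxx mulr1.
  by move=> j ji; rewrite [X in _ * X]mxE eqxx/= (negbTE ji) mulr0.
by rewrite !mulrA mulrAC.
Qed.

Lemma levy_cut_large w : 1 < enorm w -> levy_cut beta w = 1.
Proof.
move=> w1; apply/min_idPl; apply: (@le_trans _ _ (1 `^ (2 * theta beta))); first by rewrite powR1.
by apply: ge0_ler_powR; rewrite ?nnegrE ?enorm_ge0 ?(ltW w1)// mulr_ge0// ltW// theta_gt0.
Qed.

Lemma sqr_le_levy_cut w : enorm w <= 1 -> dotrV w w <= levy_cut beta w.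
Proof.
move=> w1; rewrite -enorm_sqr le_min; apply/andP; split.
  by rewrite expr_le1// enorm_ge0.
have [->|w0] := eqVneq w 0; first by rewrite enorm0 expr0n powR_ge0.
have e0 : 0 < enorm w by rewrite enorm_gt0.
rewrite -(powR_mulrn 2 (enorm_ge0 w)) /powR gt_eqF// ler_expR ler_wnM2r ?ln_le0//.
by rewrite -[leRHS]mulr1 ler_wpM2l// ltW// theta_lt1.
Qed.

(** The compensated increment has a second-order zero at the origin. *)
Lemma compensated_gk_le (s : R) u : 0 < s -> exists2 C, 0 <= C &
  forall w, `|gk s (u + w) - gk s u - (- gk s u * (dotrV u w / (2 * s))) *
              \1_[set w | enorm w <= 1] w| <= C * levy_cut beta w.
Proof.
move=> s0; pose S : R := \sum_(i < d) `|u ord0 i|.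
have S0 : 0 <= S by apply: sumr_ge0.
pose B := (4 * s)^-1 + S / (2 * s).
have s40 : 0 <= (4 * s)^-1 by rewrite invr_ge0 mulr_ge0// ltW.
have s20 : 0 <= (2 * s)^-1 by rewrite invr_ge0 mulr_ge0// ltW.
have B0 : 0 <= B by rewrite addr_ge0// mulr_ge0.
pose C1 := gk s u * (B ^+ 2 * expR B + (4 * s)^-1).
have C10 : 0 <= C1 by rewrite mulr_ge0// addr_ge0// mulr_ge0 ?sqr_ge0// expR_ge0.
exists (gk s (0 : 'rV[R]_d) + C1); first by rewrite addr_ge0.
move=> w; have [w1|w1] := leP (enorm w) 1; last first.
  rewrite indicE memNset ?mulr0 ?subr0/=; last by apply/negP; rewrite -ltNge.
  rewrite levy_cut_large// mulr1 (@le_trans _ _ (gk s (0 : 'rV[R]_d)))//; last by rewrite lerDl.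
  have := gk_le0 u s0; have := gk_le0 (u + w) s0.
  have := gk_ge0 s u; have := gk_ge0 s (u + w).
  by rewrite ler_norml; move: (gk s u) (gk s (u + w)) (gk s (0 : 'rV[R]_d)) => p q r *; lra.
rewrite indicE mem_set//= mulr1.
apply: (@le_trans _ _ (C1 * dotrV w w)); last first.
  apply: ler_pM => //; [exact: dotrV_ge0|by rewrite lerDr|exact: sqr_le_levy_cut].
rewrite gk_shiftE -expRD; set r := dotrV w w / (4 * s); set a := dotrV u w / (2 * s).
have -> : gk s u * expR (- r + - a) - gk s u - - gk s u * a =
    gk s u * ((expR (- r + - a) - 1 - (- r + - a)) - r) by ring.
rewrite normrM (ger0_norm (gk_ge0 _ _)) /C1 -mulrA ler_wpM2l//.
set x := - r + - a.
have r0 : 0 <= r by rewrite divr_ge0 ?dotrV_ge0// mulr_ge0// ltW.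
have x_le : `|x| <= B * enorm w.
  rewrite (le_trans (ler_normD _ _))// !normrN (ger0_norm r0) /B mulrDl lerD//.
    by rewrite /r -enorm_sqr mulrC ler_wpM2l// expr2 ler_piMr// enorm_ge0.
  rewrite /a normrM (ger0_norm s20) mulrAC ler_wpM2r//.
  exact: dotrV_norm_le.
have /andP[t0 t1] := expR_taylor2 x.
rewrite (le_trans (ler_normB _ _))// (ger0_norm r0) (ger0_norm t0) mulrDl lerD//; last first.
  by rewrite /r mulrC.
apply: (le_trans t1); rewrite [leRHS]mulrAC; apply: ler_pM; rewrite ?sqr_ge0 ?expR_ge0//.
  rewrite -(real_normK (num_real x)) -enorm_sqr -exprMn.
  by rewrite ler_pXn2r ?nnegrE ?mulr_ge0 ?enorm_ge0.
rewrite ler_expR (le_trans x_le)// -[leRHS]mulr1 ler_wpM2l//.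
Qed.

(** As [b z] is even, averaging the integrand over [w] and [- w] removes the
    compensator. *)
Lemma nonlocal_op_gk (b : 'rV[R]_d -> 'rV[R]_d -> R) (M s : R) y z : 0 < s ->
  measurable_fun setT (b z) -> (forall w, `|b z w| <= M) ->
  (forall w, b z w = b z (- w)) ->
  nonlocal_op beta b (fun x => heat_kernel beta 0 s x y) z =
  2^-1 * \int['leb_d]_w (gkD2 s (z - y) w * (b z w * levy beta w)).
Proof.
move=> s0 mb bM bs; have s_neq0 : s != 0 by rewrite gt_eqF.
set u := z - y; have [C C0 hC] := compensated_gk_le u s0.
have -> : (fun x => heat_kernel beta 0 s x y) = (fun x => gk s (x - y)).
  by apply/funext => x; rewrite heat_kernel0E.
pose G w := gk s (u + w) - gk s u - (- gk s u * (dotrV u w / (2 * s))) *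
              \1_[set w | enorm w <= 1] w.
pose F w := G w * (b z w * levy beta w).
have -> : nonlocal_op beta b (fun x => gk s (x - y)) z = \int['leb_d]_w F w.
  apply: eq_Rint => w; rewrite gradient_gk// /F /G -/u.
  by rewrite (addrAC z w).
have mbl : measurable_fun setT (fun w => b z w * levy beta w).
  by apply: measurable_funM => //; exact: measurable_levy.
have mI : measurable_fun setT (fun w => \1_[set w | enorm w <= 1] w : R).
  by apply: measurable_indic; exact: measurable_enorm_le.
have mG : measurable_fun setT G.
  apply: measurable_funB.
    apply: measurable_funB => //.
    by apply: measurable_gk => //; exact: measurable_addrV.
  apply: measurable_funM => //; apply: measurable_funM => //.
  by apply: measurable_funM => //; exact: measurable_dotrV.
have mF : measurable_fun setT F by exact: measurable_funM.
have M0 : 0 <= M := le_trans (normr_ge0 _) (bM 0).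
have iF : rintegrable 'leb_d F.
  apply: (@rintegrable_dominated _ _ _ 'leb_d _ _ mF
    (rintegrableZl (C * M) (rintegrable_levy d_ge1 beta_gt0 beta_lt2))) => w.
  rewrite /F !normrM (ger0_norm (levy_ge0 _ _)) mulrA.
  have -> : C * M * (levy_cut beta w * levy beta w) = C * levy_cut beta w * M * levy beta w by ring.
  by rewrite ler_wpM2r ?levy_ge0// ler_pM// ?hC ?bM.
have iF' : rintegrable 'leb_d (fun w => F (- w)).
  apply: rintegrableP.
    by apply: (measurableT_comp mF); exact: measurable_opprV.
  rewrite (int_opp (f := fun w => (`|F w|)%:E)); first exact: rintegrable_lty.
  by apply: measurable_EFinW; exact: measurableT_comp.
transitivity (2^-1 * (\int['leb_d]_w F w + \int['leb_d]_w F (- w))).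
  by rewrite (Rint_opp mF); lra.
congr (_ * _); rewrite -RintD//; apply: eq_Rint => w.
rewrite /F /G -bs /levy enormN -mulrDl; congr (_ * _).
rewrite !indicE /gkD2 dotrVNr.
have -> : (- w \in [set w | enorm w <= 1]) = (w \in [set w | enorm w <= 1]).
  by apply/idP/idP; rewrite !inE /= enormN.
by ring.
Qed.

End nonlocal_gauss.

(** * Kernel operators *)

Section kernel_operator.
Context (R : realType) d1 d2 (X : measurableType d1) (Y : measurableType d2).
Variables (mX : {sigma_finite_measure set X -> \bar R}).
Variables (mY : {sigma_finite_measure set Y -> \bar R}).
Variables (k : X * Y -> R) (C : R).
Hypothesis mk : measurable_fun setT k.
Hypothesis kC : forall x, (\int[mY]_y (`|k (x, y)|)%:E <= C%:E)%E.

Definition kop (phi : Y -> R) (x : X) : R := \int[mY]_y (k (x, y) * phi y).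

Let mnk : measurable_fun setT (fun p => `|k p|). Proof. exact: measurableT_comp. Qed.

Lemma kop_rintegrable (phi : Y -> R) (B : R) (x : X) : measurable_fun setT phi ->
  (forall y, `|phi y| <= B) -> rintegrable mY (fun y => k (x, y) * phi y).
Proof.
move=> mphi phiB; apply: (rintegrable_mulr _ mphi phiB).
exact: (rintegrable_bound (measurable_section1 x mk) (kC x)).
Qed.

Lemma measurable_kop (phi : Y -> R) : measurable_fun setT phi ->
  measurable_fun setT (kop phi).
Proof.
move=> mphi; apply: (@measurable_Rint R _ _ X Y mY (fun p => k p * phi p.2)).
apply: measurable_funM => //; exact: (measurableT_comp mphi).
Qed.

Lemma kop_norm_le (phi : Y -> R) (B : R) (x : X) : 0 <= B -> measurable_fun setT phi ->
  (forall y, `|phi y| <= B) -> `|kop phi x| <= C * B.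
Proof.
move=> B0 mphi phiB; have mkx := measurable_section1 x mk.
have mnkx := measurable_section1 x mnk.
apply: Rint_norm_le; first exact: measurable_funM.
apply: (@le_trans _ _ (\int[mY]_y (B * `|k (x, y)|)%:E)%E).
  apply: ge0_le_int => //.
  - by apply: measurableT_comp => //; exact: measurable_funM.
  - exact: measurable_funM.
  - by move=> y; rewrite normrM mulrC ler_wpM2r.
rewrite (ge0_intZl _ B0 mnkx)// mulrC EFinM.
by apply: lee_wpmul2l; rewrite ?lee_fin.
Qed.

Lemma kopB (phi psi : Y -> R) (B B' : R) (x : X) :
  measurable_fun setT phi -> (forall y, `|phi y| <= B) ->
  measurable_fun setT psi -> (forall y, `|psi y| <= B') ->
  kop (fun y => phi y - psi y) x = kop phi x - kop psi x.
Proof.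
move=> m1 b1 m2 b2; rewrite /kop -RintB; last 2 first.
- exact: kop_rintegrable m1 b1.
- exact: kop_rintegrable m2 b2.
by apply: eq_Rint => y; rewrite mulrBr.
Qed.

Lemma kopD (phi psi : Y -> R) (B B' : R) (x : X) :
  measurable_fun setT phi -> (forall y, `|phi y| <= B) ->
  measurable_fun setT psi -> (forall y, `|psi y| <= B') ->
  kop (fun y => phi y + psi y) x = kop phi x + kop psi x.
Proof.
move=> m1 b1 m2 b2; rewrite /kop -RintD; last 2 first.
- exact: kop_rintegrable m1 b1.
- exact: kop_rintegrable m2 b2.
by apply: eq_Rint => y; rewrite mulrDr.
Qed.

Lemma kopZ (c : R) (phi : Y -> R) (B : R) (x : X) :
  measurable_fun setT phi -> (forall y, `|phi y| <= B) ->
  kop (fun y => c * phi y) x = c * kop phi x.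
Proof.
move=> m1 b1; rewrite /kop -RintZl; last exact: kop_rintegrable m1 b1.
by apply: eq_Rint => y; rewrite mulrCA.
Qed.

Lemma rintegrable_kernel_mul (Q : X -> R) : rintegrable mX Q ->
  rintegrable (prodm mX mY) (fun p => Q p.1 * k p).
Proof.
move=> iQ; have mQ := rintegrable_measurable iQ.
have mQk : measurable_fun setT (fun p : X * Y => Q p.1 * k p).
  by apply: measurable_funM => //; exact: (measurableT_comp mQ).
apply: rintegrable_prodP => //.
apply: (@le_lt_trans _ _ (\int[mX]_x (C * `|Q x|)%:E)%E); last first.
  have := rintegrable_lty (rintegrableZl C (rintegrable_norm iQ)).
  apply: le_lt_trans; apply: ge0_le_integral => //.
  - by move=> x _; rewrite lee_fin mulr_ge0// -lee_fin (le_trans _ (kC x))// integral_ge0.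
  - by apply: measurable_EFinW; apply: measurable_funM => //; exact: measurableT_comp.
  - by apply: measurable_EFinW; apply: measurableT_comp => //; apply: measurable_funM => //; exact: measurableT_comp.
  - by move=> x _; rewrite lee_fin ler_norm.
apply: ge0_le_integral => //.
- by move=> x _; apply: integral_ge0 => y _; rewrite lee_fin.
- by apply: (@measurable_int R _ _ _ _ mY (fun p => `|Q p.1 * k p|)) => //; exact: measurableT_comp.
- by apply: measurable_EFinW; apply: measurable_funM => //; exact: measurableT_comp.
- move=> x _; under eq_int do rewrite /= normrM.
  have mnkx : measurable_fun setT (fun y => `|k (x, y)|) := measurable_section1 x mnk.
  rewrite (ge0_intZl _ (normr_ge0 _) mnkx)// mulrC EFinM.
  by apply: lee_wpmul2l; rewrite ?lee_fin.
Qed.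

(** Fubini for a finite signed measure pushed through the kernel. *)
Lemma kop_dual (Q : X -> R) (phi : Y -> R) (B : R) : rintegrable mX Q ->
  measurable_fun setT phi -> (forall y, `|phi y| <= B) ->
  \int[mX]_x (Q x * kop phi x) =
  \int[mY]_y ((\int[mX]_x (Q x * k (x, y))) * phi y).
Proof.
move=> iQ mphi phiB; have iQk := rintegrable_kernel_mul iQ.
have iF : rintegrable (prodm mX mY) (fun p => Q p.1 * k p * phi p.2).
  apply: (rintegrable_mulr iQk (c := B)); last by [].
  exact: (measurableT_comp mphi).
transitivity (\int[mX]_x \int[mY]_y (Q x * k (x, y) * phi y)).
  apply: eq_Rint => x; rewrite /kop -RintZl; last exact: kop_rintegrable mphi phiB.
  by apply: eq_Rint => y; rewrite mulrA.
rewrite (Rint_swap iF); apply: ae_eq_Rint.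
- apply: (@measurable_Rint R _ _ Y X mX (fun p => Q p.2 * k (p.2, p.1) * phi p.1)).
  exact: (measurableT_comp (rintegrable_measurable iF) (@measurable_swap _ _ Y X)).
- apply: measurable_funM => //.
  apply: (@measurable_Rint R _ _ Y X mX (fun p => Q p.2 * k (p.2, p.1))).
  exact: (measurableT_comp (rintegrable_measurable iQk) (@measurable_swap _ _ Y X)).
apply: filterS (ae_integrable2 iQk) => y iy.
transitivity (\int[mX]_x (phi y * (Q x * k (x, y)))).
  by apply: eq_Rint => x; rewrite mulrC.
by rewrite RintZl// mulrC.
Qed.

End kernel_operator.

Section countable_valued.
Context d (T : measurableType d) (R : realType) (I : countType).

Lemma measurable_countable_range (h : T -> I) (F : I -> R) :
  (forall i, measurable (h @^-1` [set i])) ->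
  measurable_fun setT (fun t => F (h t)).
Proof.
move=> mh _ B mB; rewrite setTI.
pose S (k : nat) : set T := if unpickle k is Some i then
  (if F i \in B then h @^-1` [set i] else set0) else set0.
rewrite (_ : _ @^-1` _ = \bigcup_k S k).
  apply: bigcup_measurable => k _; rewrite /S; case: (unpickle k) => // i.
  by case: ifP.
apply/seteqP; split => [t /= Bt|t [k _]].
  by exists (pickle (h t)) => //; rewrite /S pickleK (mem_set Bt).
rewrite /S; case: (unpickle k) => // i; case: ifPn => //.
by rewrite inE /= => Fi ->.
Qed.

End countable_valued.

Section measurable_continuous.
Context {R : realType} {d : nat}.
Local Notation V := 'rV[R]_d.

Let code (n : nat) (p : measurableTypeR R * V) : int * 'rV[int]_d :=
  (Num.floor ((p.1 : R) * n.+1%:R), \row_j Num.floor (p.2 ord0 j * n.+1%:R)).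

Let grid (n : nat) (c : int * 'rV[int]_d) : R * V :=
  (c.1%:~R / n.+1%:R, \row_j ((c.2 ord0 j)%:~R / n.+1%:R)).

Let measurable_code n c : measurable (code n @^-1` [set c]).
Proof.
have mf d' (T' : measurableType d') (g : T' -> R) (i : int) : measurable_fun setT g ->
    measurable [set t | Num.floor (g t * n.+1%:R) = i].
  move=> mg; have mgn : measurable_fun setT (fun t => g t * n.+1%:R).
    exact: measurable_funM.
  have := mgn measurableT `[i%:~R, (i + 1)%:~R[%classic (measurable_itv _).
  rewrite setTI; congr measurable; apply/seteqP; split => t /=; rewrite in_itv/=.
    by rewrite -floor_eq => /eqP.
  by rewrite -floor_eq => /eqP.
have E : code n @^-1` [set c] = [set p : measurableTypeR R * V | Num.floor ((p.1 : R) * n.+1%:R) = c.1] `&`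
    \big[setI/setT]_(j < d) [set p : measurableTypeR R * V | Num.floor (p.2 ord0 j * n.+1%:R) = c.2 ord0 j].
  rewrite -bigcap_seq; apply/seteqP; split => [p /= pc|p [/= p1 p2]].
    by rewrite -pc; split => //= j _; rewrite mxE.
  case: c p1 p2 => c1 c2 /= p1 p2; rewrite /code p1; congr pair.
  by apply/rowP => j; rewrite mxE; apply: p2; rewrite /= mem_index_enum.
rewrite E; apply: measurableI.
  by apply: mf; exact: (measurableT_comp (@measurable_time R) measurable_fst).
apply: bigsetI_measurable => j _; apply: mf.
exact: (measurableT_comp (measurable_coord j) measurable_snd).
Qed.

Let dist_floor n (r : R) : `|r - (Num.floor (r * n.+1%:R))%:~R / n.+1%:R| <= n.+1%:R^-1.
Proof.
have n0 : 0 < n.+1%:R :> R by [].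
have /andP[h1 h2] := floor_itv (r * n.+1%:R).
rewrite -[X in X - _](mulfK (lt0r_neq0 n0)) -mulrBl normrM ger0_norm; last by rewrite subr_ge0.
rewrite [X in _ * X]ger0_norm; last by rewrite invr_ge0 ltW.
rewrite ler_piMl ?invr_ge0 ?(ltW n0)// lerBlDl ltW//.
by move: h2; rewrite intrD.
Qed.

Let grid_cvg (p : R * V) : grid n (code n p) @[n --> \oo] --> p.
Proof.
have sm e : 0 < e -> \forall n \near \oo, n.+1%:R^-1 < e :> R.
  by move=> e0; near=> n; near: n; exact: near_infty_natSinv_lt (PosNum e0).
case: p => t y.
have c1 : (grid n (code n (t, y))).1 @[n --> \oo] --> t.
  apply/cvgrPdist_lt => e e0; near=> n.
  apply: (le_lt_trans (dist_floor n t)); near: n; exact: sm.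
have c2 : (grid n (code n (t, y))).2 @[n --> \oo] --> y.
  apply/cvgrPdist_lt => e e0; near=> n.
  apply: (@le_lt_trans _ _ n.+1%:R^-1); last by near: n; exact: sm.
  rewrite [leLHS]mx_normrE; apply: bigmax_le => [|[i j] _]; first by rewrite invr_ge0.
  by rewrite (ord1 i) /= !mxE; exact: dist_floor.
exact: (cvg_pair c1 c2).
Unshelve. all: end_near. Qed.

(** Rounding the argument to finer and finer grids shows that the function is a limit
    of functions with countably many values. *)
Lemma measurable_continuous_pos (f : R * V -> R) (t0 : R) :
  (forall p : R * V, 0 < p.1 -> f x @[x --> p] --> f p) ->
  measurable_fun setT (fun p : measurableTypeR R * V =>
    f (p.1 : R, p.2) * \1_(`]0%R, t0[ : set R) p.1 : R).
Proof.
move=> cf.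
apply: (@measurable_fun_cvg _ _ _ _ (fun n (p : measurableTypeR R * V) =>
  f (grid n (code n p)) * \1_(`]0%R, t0[ : set R) p.1 : R)).
  move=> n; apply: measurable_funM.
    by apply: (@measurable_countable_range _ _ R _ (code n) (f \o grid n)).
  by apply: (measurableT_comp _ measurable_fst); exact: measurable_indic.
move=> [t y] _ /=; rewrite indicE; case: (boolP (t \in _)); last first.
  by rewrite !mulr0 => _; under eq_fun do rewrite mulr0; exact: cvg_cst.
rewrite inE /= in_itv/= => /andP[tp _]; rewrite mulr1; under eq_fun do rewrite mulr1.
have cfp := cf (t : R, y) tp.
exact: (cvg_comp (fun n => grid n (code n (t, y))) f (@grid_cvg (t : R, y)) cfp).
Qed.

End measurable_continuous.

(** * Space-time kernels *)

Lemma int_le_eq d (T : measurableType d) (R : realType)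
    (mu : {measure set T -> \bar R}) (f g : T -> \bar R) :
  (forall x, f x = g x) -> (\int[mu]_x f x <= \int[mu]_x g x)%E.
Proof. by move=> fg; rewrite (eq_int mu fg). Qed.

Section reflections.
Context {R : realType}.
Local Notation leb := (@lebesgue_measure R).
Local Notation "'leb_ d" := (lebesgue_rV d : {measure set 'rV[R]_d -> \bar R})
  (at level 0, d at level 0).

Lemma int_sub d (z : 'rV[R]_d) (f : 'rV[R]_d -> \bar R) : measurable_fun setT f ->
  (\int['leb_d]_y f (z - y)%R = \int['leb_d]_u f u)%E.
Proof.
move=> mf; rewrite -(int_shift z mf) -[RHS]int_opp.
  by apply: eq_int => y; rewrite addrC.
apply: (measurableT_comp mf); exact: measurable_addrV.
Qed.

Lemma ge0_int_sub1 (a : R) (f : R -> \bar R) : measurable_fun setT f ->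
  (forall t, 0 <= f t)%E -> (\int[leb]_s f (s - a)%R = \int[leb]_s f s)%E.
Proof. by move=> mf f0; rewrite -(ge0_int_shift1 (- a) mf f0). Qed.

Lemma Rint_sub1 (a : R) (f : R -> R) : measurable_fun setT f ->
  \int[leb]_s f (a - s) = \int[leb]_s f s.
Proof.
move=> mf; have mE := measurable_EFinW mf; congr fine.
have H (g : R -> \bar R) : measurable_fun setT g -> (forall t, 0 <= g t)%E ->
    (\int[leb]_s g (a - s)%R = \int[leb]_s g s)%E.
  move=> mg g0; rewrite -(ge0_int_shift1 a mg g0).
  rewrite -(@ge0_int_opp1 R (fun s => g (s + a)%R)).
  - by apply: eq_int => s; rewrite addrC.
  - by apply: (measurableT_comp mg); exact: measurable_funD.
  - by move=> s; exact: g0.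
rewrite integralE [RHS]integralE; congr (_ - _)%E.
- rewrite -(H ((fun s => (f s)%:E)^\+)%E)//; last exact: measurable_funepos.
  by apply: eq_int => x; rewrite !funeposE.
- rewrite -(H ((fun s => (f s)%:E)^\-)%E)//; last exact: measurable_funeneg.
  by apply: eq_int => x; rewrite !funenegE.
Qed.

End reflections.

Section spacetime.
Context {R : realType} {d : nat}.
Local Notation leb := (@lebesgue_measure R).
Local Notation V := 'rV[R]_d.
Local Notation lebV := (lebesgue_rV d).

Definition spacetime := (measurableTypeR R * 'rV[R]_d)%type.
Definition mst : {sigma_finite_measure set spacetime -> \bar R} :=
  prodm leb (lebesgue_rV d).

Variables (beta : R).
Hypotheses (d_ge1 : (1 <= d)%N) (beta_gt0 : 0 < beta) (beta_lt2 : beta < 2).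
Variables (t0 tau : R).
Hypotheses (t0_gt0 : 0 < t0) (t0_le1 : t0 <= 1).
Hypothesis tauP : (\int[leb]_s ((s `^ theta beta)^-1 * \1_(`]0%R, t0[ : set R) s)%:E <= tau%:E)%E.

(** The restriction of the time steps to ]0, t0[ makes the kernels below integrable over
    the whole of space-time; it has no effect on the functions that vanish outside the
    times ]0, t0[, seen from a time in [0, t0[. *)
Definition window (p : spacetime * spacetime) : R :=
  \1_(`]0%R, t0[ : set R) ((p.2.1 : R) - p.1.1).

Definition lag (p : spacetime * spacetime) : R := (p.2.1 : R) - p.1.1.

Lemma measurable_lag : measurable_fun setT lag.
Proof.
apply: measurable_funB; apply: (measurableT_comp (@measurable_time R)).
  exact: (measurableT_comp measurable_fst measurable_snd).
exact: (measurableT_comp measurable_fst measurable_fst).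
Qed.

Lemma measurable_window : measurable_fun setT window.
Proof.
have mi : measurable_fun setT (\1_(`]0%R, t0[ : set R) : R -> R) by exact: measurable_indic.
exact: (measurableT_comp mi measurable_lag).
Qed.

Lemma measurable_spread : measurable_fun setT
  (fun p : spacetime * spacetime => p.1.2 - p.2.2 : V).
Proof.
apply: measurable_addrV.
  exact: (measurableT_comp measurable_snd measurable_fst).
apply: measurable_opprV; exact: (measurableT_comp measurable_snd measurable_snd).
Qed.

(** [kop mst heatk phi (r, z)] is the heat potential of [phi], the integral over [s > r]
    of the heat semigroup at time [s - r] applied to [phi (s, .)]. *)
Definition heatk (p : spacetime * spacetime) : R :=
  gk (lag p) (p.1.2 - p.2.2) * window p.

Lemma measurable_heatk : measurable_fun setT heatk.
Proof.
apply: measurable_funM; last exact: measurable_window.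
exact: measurable_gk measurable_lag measurable_spread.
Qed.

Lemma heatk_ge0 p : 0 <= heatk p.
Proof. by rewrite mulr_ge0 ?gk_ge0. Qed.

Lemma int_window (p : spacetime) :
  (\int[leb]_s (\1_(`]0%R, t0[ : set R) ((s : R) - p.1))%:E = t0%:E)%E.
Proof.
rewrite (ge0_int_sub1 (p.1 : R) (f := fun s => (\1_(`]0%R, t0[ : set R) s)%:E)).
- by rewrite integral_indic//= setIT lebesgue_measure_itv/= lte_fin t0_gt0 oppr0 adde0.
- by apply: measurable_EFinW; exact: measurable_indic.
- by move=> s; rewrite lee_fin.
Qed.

Lemma int_heatk (p : spacetime) : (\int[mst]_p' (heatk (p, p'))%:E = t0%:E)%E.
Proof.
rewrite ge0_int_prod; first last.
- by move=> p'; exact: heatk_ge0.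
- exact: (measurable_section1 p measurable_heatk).
rewrite -(int_window p); apply: eq_int => s.
rewrite /heatk /window /lag /= indicE; case: (boolP (_ \in _)) => [|_]; last first.
  by under eq_int do rewrite mulr0; rewrite integral0.
rewrite inE/= in_itv/= => /andP[s0 _].
by under eq_int do rewrite mulr1; rewrite int_gk_sub.
Qed.

Lemma int_norm_heatk (p : spacetime) : (\int[mst]_p' (`|heatk (p, p')|)%:E <= t0%:E)%E.
Proof. by under eq_int do rewrite (ger0_norm (heatk_ge0 _)); rewrite int_heatk. Qed.

Section jump_kernel.
Variables (J : V -> V -> R) (h : V -> R) (A : R).
Hypothesis mJ : measurable_fun setT (fun p : V * V => J p.1 p.2).
Hypothesis mh : measurable_fun setT h.
Hypothesis Jh : forall z w, `|J z w| <= h w.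
Hypothesis hA : (\int[lebV]_w (levy_cut beta w * h w)%:E <= A%:E)%E.

Let h0 w : 0 <= h w. Proof. exact: le_trans (normr_ge0 _) (Jh 0 w). Qed.

Let A0 : 0 <= A.
Proof.
rewrite -lee_fin; apply: le_trans hA; apply: integral_ge0 => w _.
by rewrite lee_fin mulr_ge0// levy_cut_ge0.
Qed.

(** The nonlocal operator with jump kernel [J], applied to the heat kernel, in the form
    given by [nonlocal_op_gk]. *)
Definition jump_heat (s : R) (z y : V) : R :=
  2^-1 * \int[lebV]_w (gkD2 s (z - y) w * J z w).

Definition stk (p : spacetime * spacetime) : R :=
  jump_heat (lag p) p.1.2 p.2.2 * window p.

Let integrand (q : (spacetime * spacetime) * V) : R :=
  gkD2 (lag q.1) (q.1.1.2 - q.1.2.2) q.2 * J q.1.1.2 q.2.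

Let measurable_integrand : measurable_fun setT integrand.
Proof.
apply: measurable_funM.
  apply: measurable_gkD2; last exact: measurable_snd.
  - exact: (measurableT_comp measurable_lag measurable_fst).
  - exact: (measurableT_comp measurable_spread measurable_fst).
apply: (measurableT_comp mJ (g := fun q : (spacetime * spacetime) * V => (q.1.1.2, q.2))).
apply: measurable_fun_pair; last exact: measurable_snd.
apply: (measurableT_comp measurable_snd).
exact: (measurableT_comp measurable_fst measurable_fst).
Qed.

Lemma measurable_stk : measurable_fun setT stk.
Proof.
apply: measurable_funM; last exact: measurable_window.
apply: measurable_funM => //.
exact: (measurable_Rint lebV measurable_integrand).
Qed.

(** Integrating in space first: by [int_gkD2_min] the jumps are then weighed with
    [min(1, |w|^2 / (4 s))]. *)
Lemma int_int_gkD2 (s : R) (z : V) : 0 < s <= 1 ->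
  (\int[lebV]_y \int[lebV]_w (`|gkD2 s (z - y) w * J z w|)%:E <=
    (4 * A * (s `^ theta beta)^-1)%:E)%E.
Proof.
move=> s01; have /andP[s0 s1] := s01.
have mJz : measurable_fun setT (J z) := measurable_section1 z mJ.
have mF : measurable_fun setT (fun p : V * V => `|gkD2 s (z - p.1) p.2 * J z p.2|).
  apply: measurableT_comp => //; apply: measurable_funM.
    apply: measurable_gkD2 => //; apply: measurable_addrV => //.
    exact: measurable_opprV.
  exact: (measurableT_comp mJz).
rewrite (ge0_int_swap lebV lebV mF)//=.
pose c : R := 4 * (s `^ theta beta)^-1.
have c0 : 0 <= c by rewrite mulr_ge0// invr_ge0 powR_ge0.
apply: (@le_trans _ _ (\int[lebV]_w (c * (levy_cut beta w * h w))%:E)%E); last first.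
  rewrite ge0_intZl//.
  - rewrite (_ : 4 * A * _ = c * A); last by rewrite /c; ring.
    by rewrite [X in (_ <= X)%E]EFinM; apply: lee_wpmul2l; rewrite ?lee_fin.
  - by apply: measurable_funM => //; exact: measurable_levy_cut.
  - by move=> w; rewrite mulr_ge0// levy_cut_ge0.
apply: ge0_le_integral => //.
- by move=> w _; apply: integral_ge0 => y _; rewrite lee_fin.
- exact: (@measurable_int R _ _ V V lebV (fun p => `|gkD2 s (z - p.2) p.1 * J z p.1|)
    (measurableT_comp mF (@measurable_swap _ _ V V)) (fun p => normr_ge0 _)).
- apply: measurable_EFinW; apply: measurable_funM => //.
  by apply: measurable_funM => //; exact: measurable_levy_cut.
move=> w _.
have mg : measurable_fun setT (fun u : V => `|gkD2 s u w|).
  by apply: measurableT_comp => //; exact: measurable_gkD2.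
apply: (@le_trans _ _ (\int[lebV]_y (`|J z w| * `|gkD2 s (z - y) w|)%:E)%E).
  by apply: int_le_eq => y; rewrite normrM mulrC.
rewrite ge0_intZl//; last first.
  apply: (measurableT_comp mg); apply: measurable_addrV => //; exact: measurable_opprV.
rewrite (int_sub z (f := fun u => (`|gkD2 s u w|)%:E)); last exact: measurable_EFinW.
apply: (@le_trans _ _ ((h w)%:E * (4 * Num.min 1 (dotrV w w / (4 * s)))%:E)%E).
  apply: lee_pmul; rewrite ?lee_fin//; last exact: int_gkD2_min.
  by apply: integral_ge0 => u _; rewrite lee_fin.
rewrite -EFinM lee_fin /c mulrC -!mulrA ler_wpM2l// mulrA ler_wpM2r//.
exact: min_parabolic_le.
Qed.

Lemma int_int_integrand (p : spacetime) :
  (\int[mst]_p' \int[lebV]_w (`|integrand ((p, p'), w) * window (p, p')|)%:E <=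
   (4 * A * tau)%:E)%E.
Proof.
have mI : measurable_fun setT (fun q : (spacetime * spacetime) * V =>
    `|integrand q * window q.1|).
  apply: measurableT_comp => //; apply: measurable_funM; first exact: measurable_integrand.
  exact: (measurableT_comp measurable_window measurable_fst).
have mIp : measurable_fun setT (fun q : spacetime * V =>
    `|integrand ((p, q.1), q.2) * window (p, q.1)|).
  apply: (measurableT_comp mI (g := fun q : spacetime * V => ((p, q.1), q.2))).
  by apply: measurable_fun_pair => //; apply: measurable_fun_pair.
have mE : measurable_fun setT (fun p' : measurableTypeR R * V =>
    \int[lebV]_w (`|integrand ((p, p'), w) * window (p, p')|)%:E)%E.
  exact: (measurable_int lebV mIp (fun q => normr_ge0 _)).
have E0 p' : (0 <= \int[lebV]_w (`|integrand ((p, p'), w) * window (p, p')|)%:E)%E.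
  by apply: integral_ge0 => w _; rewrite lee_fin.
rewrite (fubini_tonelli1 (fun p' => \int[lebV]_w (`|integrand ((p, p'), w) * window (p, p')|)%:E)%E)//.
pose H (s : R) : R := (s `^ theta beta)^-1 * \1_(`]0%R, t0[ : set R) s.
have H0 s : 0 <= H s by rewrite mulr_ge0// invr_ge0 powR_ge0.
have mH : measurable_fun setT (H : R -> R).
  apply: measurable_funM; last exact: measurable_indic.
  by apply: measurable_funV; exact: measurable_powR.
apply: (@le_trans _ _ (\int[leb]_s (4 * A * H (s - p.1))%:E)%E); last first.
  rewrite (ge0_int_sub1 (p.1 : R) (f := fun s => (4 * A * H s)%:E)).
  - by rewrite ge0_intZl ?mulr_ge0// [X in (_ <= X)%E]EFinM; apply: lee_wpmul2l; rewrite ?lee_fin ?mulr_ge0.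
  - have mcH : measurable_fun setT (fun s : R => 4 * A * H s) by exact: measurable_funM.
    exact: (measurable_EFinW mcH).
  - by move=> s; rewrite lee_fin; exact: (mulr_ge0 (mulr_ge0 (ler0n R 4) A0) (H0 s)).
apply: ge0_le_integral => //.
- by move=> s _; apply: integral_ge0 => y _; exact: E0.
- exact: (@measurable_fun_fubini_tonelli_F _ _ _ _ R lebV _ mE E0).
- apply: measurable_EFinW; apply: measurable_funM => //.
  by apply: (measurableT_comp mH); apply: measurable_funB => //; exact: measurable_time.
move=> s _; rewrite /fubini_F /H /window /lag /=.
rewrite indicE; case: (boolP (_ \in _)) => [|_]; last first.
  rewrite !mulr0 (eq_int _ (g := fun=> 0%E)) ?integral0//.
  by move=> y; under eq_int do rewrite mulr0 normr0; rewrite integral0.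
rewrite inE/= in_itv/= => /andP[s0 s1]; rewrite mulr1.
apply: le_trans (int_int_gkD2 p.2 _).
  by apply: int_le_eq => y; apply: eq_int => w; rewrite mulr1.
by rewrite s0 (le_trans (ltW s1)).
Qed.

Lemma jump_heat_window p : stk p =
  2^-1 * \int[lebV]_w (integrand (p, w) * window p).
Proof.
rewrite /stk /jump_heat /window -mulrA; congr (_ * _).
rewrite indicE; case: (_ \in _).
  by rewrite mulr1; apply: eq_Rint => w; rewrite mulr1.
rewrite mulr0 (_ : (fun _ => _) = fun=> 0); last by apply/funext => w; rewrite mulr0.
by rewrite /Rintegral integral0.
Qed.

Let measurable_slice (p : spacetime) : measurable_fun setT
  (fun q : spacetime * V => integrand ((p, q.1), q.2) * window (p, q.1)).
Proof.
have mI : measurable_fun setT (fun q : (spacetime * spacetime) * V =>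
    integrand q * window q.1).
  apply: measurable_funM; first exact: measurable_integrand.
  exact: (measurableT_comp measurable_window measurable_fst).
apply: (measurableT_comp mI (g := fun q : spacetime * V => ((p, q.1), q.2))).
by apply: measurable_fun_pair => //; apply: measurable_fun_pair.
Qed.

Lemma rintegrable_slice (p : spacetime) : rintegrable (prodm mst lebV)
  (fun q => integrand ((p, q.1), q.2) * window (p, q.1)).
Proof.
apply: rintegrable_prodP; first exact: measurable_slice.
exact: le_lt_trans (int_int_integrand p) (ltry _).
Qed.

Lemma int_norm_stk (p : spacetime) : (\int[mst]_p' (`|stk (p, p')|)%:E <= (2 * A * tau)%:E)%E.
Proof.
have mn : measurable_fun setT (fun q : spacetime * V =>
    `|integrand ((p, q.1), q.2) * window (p, q.1)|).
  by apply: measurableT_comp => //; exact: measurable_slice.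
have mi : measurable_fun setT (fun p' : spacetime =>
    \int[lebV]_w (integrand ((p, p'), w) * window (p, p'))).
  exact: (measurable_Rint lebV (measurable_slice p)).
apply: (@le_trans _ _ (\int[mst]_p'
    (2^-1 * `|\int[lebV]_w (integrand ((p, p'), w) * window (p, p'))|)%:E)%E).
  by apply: int_le_eq => p'; rewrite jump_heat_window normrM ger0_norm.
rewrite ge0_intZl//; last exact: measurableT_comp.
rewrite (_ : 2 * A * tau = 2^-1 * (4 * A * tau)); last by lra.
rewrite [X in (_ <= X)%E]EFinM; apply: lee_wpmul2l; first by rewrite lee_fin.
apply: le_trans (int_int_integrand p).
exact: (int_norm_Rint_le mst lebV (measurable_slice p)).
Qed.

(** [stk] is the nonlocal operator applied to the heat potential: averaging the second
    differences of the heat kernel averages those of the potential. *)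
Lemma kop_stk (phi : spacetime -> R) (B : R) (p : spacetime) :
  measurable_fun setT phi -> (forall p', `|phi p'| <= B) ->
  kop mst stk phi p = 2^-1 * \int[lebV]_w (J p.2 w *
    (kop mst heatk phi (p.1, p.2 + w) + kop mst heatk phi (p.1, p.2 - w)
       - 2 * kop mst heatk phi p)).
Proof.
move=> mphi phiB.
pose F (q : spacetime * V) : R := integrand ((p, q.1), q.2) * window (p, q.1) * phi q.1.
have mphi1 : measurable_fun setT (fun q : spacetime * V => phi q.1).
  exact: (measurableT_comp mphi measurable_fst).
have iF : rintegrable (prodm mst lebV) F.
  exact: (rintegrable_mulr (rintegrable_slice p) mphi1 (fun q => phiB q.1)).
have iS := rintegrable_Rint (rintegrable_slice p).
have mS := rintegrable_measurable iS.
transitivity (2^-1 * \int[mst]_p' \int[lebV]_w F (p', w)).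
  rewrite -RintZl; last exact: rintegrable_Rint iF.
  apply: ae_eq_Rint.
  - apply: measurable_funM => //; exact: (measurable_section1 p measurable_stk).
  - apply: measurable_funM => //; exact: (measurable_Rint lebV (rintegrable_measurable iF)).
  apply: filterS (ae_rintegrable (rintegrable_slice p)) => p' ip'.
  rewrite jump_heat_window -mulrA; congr (_ * _).
  rewrite mulrC -RintZl//; apply: eq_Rint => w; rewrite /F /=; exact: mulrC.
rewrite (Rint_swap iF); congr (_ * _); apply: eq_Rint => w.
have ih (q : spacetime) : rintegrable mst (fun p' => heatk (q, p') * phi p').
  exact: (kop_rintegrable measurable_heatk int_norm_heatk q mphi phiB).
pose q1 : spacetime := (p.1, p.2 + w); pose q2 : spacetime := (p.1, p.2 - w).
have i12 := rintegrableD (ih q1) (ih q2).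
have i3 := rintegrableZl 2 (ih p).
rewrite /kop -(RintD (ih q1) (ih q2)) -(RintZl 2 (ih p)) -(RintB i12 i3).
rewrite -RintZl; last exact: rintegrableB.
apply: eq_Rint => p'; rewrite /F /integrand /heatk /gkD2 /window /lag /=.
rewrite (addrAC p.2 w) (addrAC p.2 (- w)); ring.
Qed.

End jump_kernel.
End spacetime.

(** * Duhamel's formula in space-time *)

Lemma rintegrable_Rint_swap (R : realType) d1 d2 (X : measurableType d1)
    (Y : measurableType d2) (mX : {sigma_finite_measure set X -> \bar R})
    (mY : {sigma_finite_measure set Y -> \bar R}) (f : X * Y -> R) :
  rintegrable (prodm mX mY) f -> rintegrable mY (fun y => \int[mX]_x f (x, y)).
Proof.
move=> fi; have mf := rintegrable_measurable fi.
have mn : measurable_fun setT (fun p => `|f p|) by exact: measurableT_comp.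
have ms : measurable_fun setT (fun p : Y * X => f (p.2, p.1)).
  exact: (measurableT_comp mf (@measurable_swap _ _ Y X)).
apply: rintegrableP; first exact: (measurable_Rint mX ms).
apply: le_lt_trans (int_norm_Rint_le mY mX ms) _.
rewrite -(ge0_int_swap mX mY mn)// -(ge0_int_prod mX mY mn)//.
exact: rintegrable_lty.
Qed.

Section duhamel.
Context {R : realType} {d : nat}.
Local Notation leb := (@lebesgue_measure R).
Local Notation V := 'rV[R]_d.
Local Notation lebV := (lebesgue_rV d).
Local Notation spacetime := (@spacetime R d).
Local Notation mst := (@mst R d).
#[local] Hint Extern 0 (is_true (0 <= gk _ _)) => solve [apply: gk_ge0] : core.

Variables (beta : R) (b : V -> V -> R) (q : R -> V -> V -> R) (M eps c1 c2 : R).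
Hypotheses (d_ge1 : (1 <= d)%N) (beta_gt0 : 0 < beta) (beta_lt2 : beta < 2).
Hypothesis mb : measurable_fun [set: V * V] (fun p : V * V => b p.1 p.2).
Hypothesis bM : forall x z, `|b x z| <= M.
Hypothesis b_sym : forall x z, b x z = b x (- z).
Hypothesis cq : {within [set p : R * V * V | 0 < p.1.1],
      continuous (fun p => q p.1.1 p.1.2 p.2)}.
Hypotheses (eps0 : 0 < eps) (c10 : 0 < c1) (c20 : 0 < c2).
Hypothesis q_le : forall (t : R) x y, 0 < t <= eps ->
  `|q t x y| <= c1 * heat_kernel beta 1 t (c2 *: x) (c2 *: y).
Hypothesis q_duhamel : forall (t : R) x y, 0 < t <= eps ->
  q t x y = heat_kernel beta 0 t x y +
          \int[lebesgue_measure]_(s in `]0, t[)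
            \int[lebesgue_rV d]_z
              (q (t - s) x z *
               nonlocal_op beta b (fun w => heat_kernel beta 0 s w y) z).

Definition jump (z w : V) : R := b z w * levy beta w.

Lemma measurable_jump : measurable_fun setT (fun p : V * V => jump p.1 p.2).
Proof.
apply: measurable_funM => //.
exact: (measurableT_comp (measurable_levy beta) measurable_snd).
Qed.

Lemma jump_le z w : `|jump z w| <= M * levy beta w.
Proof. by rewrite normrM (ger0_norm (levy_ge0 _ _)) ler_wpM2r ?levy_ge0. Qed.

Let M0 : 0 <= M := le_trans (normr_ge0 _) (bM 0 0).

Definition levy_mass : R := \int[lebV]_w (levy_cut beta w * levy beta w).

Lemma int_jump_weight :
  (\int[lebV]_w (levy_cut beta w * (M * levy beta w))%:E <= (M * levy_mass)%:E)%E.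
Proof.
under eq_int do rewrite mulrCA.
have i := rintegrable_levy d_ge1 beta_gt0 beta_lt2.
rewrite ge0_intZl//.
- by rewrite EFinM (EFin_Rint i).
- exact: rintegrable_measurable i.
- by move=> w; rewrite mulr_ge0 ?levy_ge0// levy_cut_ge0.
Qed.

Lemma q_continuous_at x (p : R * V) : 0 < p.1 ->
  (fun p : R * V => q p.1 x p.2) r @[r --> p] --> q p.1 x p.2.
Proof.
move=> p0; have oS : open [set p : R * V * V | 0 < p.1.1].
  apply: (@open_comp _ _ (fun p : R * V * V => p.1.1) [set t : R | 0 < t]); last exact: open_gt.
  by move=> r _; apply: continuous_comp; exact: cvg_fst.
have := cq; rewrite continuous_open_subspace// => cqS.
have cp := cqS (p.1, x, p.2) (mem_set p0).
apply: (@cvg_comp _ _ _ (fun r : R * V => (r.1, x, r.2)) (fun r => q r.1.1 r.1.2 r.2) _ _ _ _ cp).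
apply: (@cvg_pair _ _ _ (nbhs p) (nbhs (p.1, x)) (nbhs p.2)).
  by apply: (@cvg_pair _ _ _ (nbhs p) (nbhs p.1) (nbhs x)); [exact: cvg_fst|exact: cvg_cst].
exact: cvg_snd.
Qed.

Lemma stable_kernel_ge0 (t : R) (u : V) : 0 < t <= eps -> 0 <= stable_kernel beta t (c2 *: u).
Proof.
move=> tE; have := le_trans (normr_ge0 _) (q_le u 0 tE).
by rewrite heat_kernel1E scaler0 subr0 pmulr_rge0.
Qed.

Lemma q_le_stable (t : R) (x y : V) : 0 < t <= eps ->
  `|q t x y| <= c1 * stable_kernel beta t (c2 *: (x - y)).
Proof. by move=> /(q_le x y); rewrite heat_kernel1E scalerBr. Qed.

Variables (t0 tau : R) (x : V).
Hypotheses (t0_gt0 : 0 < t0) (t0_le1 : t0 <= 1) (t0_eps : t0 <= eps).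
Hypothesis tauP : (\int[leb]_s ((s `^ theta beta)^-1 * \1_(`]0%R, t0[ : set R) s)%:E <= tau%:E)%E.

(** The solution started at [x], as a density on space-time. *)
Definition qst (p : spacetime) : R := q (p.1 : R) x p.2 * \1_(`]0%R, t0[ : set R) p.1.

Lemma measurable_qst : measurable_fun setT qst.
Proof.
exact: (@measurable_continuous_pos R d (fun p => q p.1 x p.2) t0 (@q_continuous_at x)).
Qed.

Lemma int_qst_slice (r : R) :
  (\int[lebV]_z (`|qst (r, z)|)%:E <= (c1 * c2 ^- d * \1_(`]0%R, t0[ : set R) r)%:E)%E.
Proof.
rewrite /qst /= indicE; case: (boolP (_ \in _)) => [|_]; last first.
  by under eq_int do rewrite mulr0 normr0; rewrite integral0 mulr0.
rewrite inE/= in_itv/= => /andP[r0 rt0]; rewrite mulr1.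
have rE : 0 < r <= eps by rewrite r0 (le_trans (ltW rt0)).
have msk : measurable_fun setT (fun u : V => stable_kernel beta r (c2 *: u)).
  apply: (measurableT_comp (measurable_stable_kernel beta r)).
  exact: measurable_scalerV.
have msk' : measurable_fun setT (fun z : V => stable_kernel beta r (c2 *: (x - z))).
  apply: (measurableT_comp msk); apply: measurable_addrV => //; exact: measurable_opprV.
apply: (@le_trans _ _ (\int[lebV]_z (c1 * stable_kernel beta r (c2 *: (x - z)))%:E)%E).
  apply: ge0_le_int => //.
  - have := measurable_section1 (r : measurableTypeR R) measurable_qst.
    rewrite /qst /= indicE mem_set; last by rewrite /= in_itv/= r0 rt0.
    by move=> mq; apply: measurableT_comp.
  - exact: measurable_funM.
  - by move=> z; rewrite mulr1; exact: q_le_stable.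
rewrite ge0_intZl ?(ltW c10)//; last by move=> z; exact: stable_kernel_ge0.
rewrite (int_sub x (f := fun u => (stable_kernel beta r (c2 *: u))%:E)); last exact: measurable_EFinW.
rewrite [X in (_ <= X)%E]EFinM; apply: lee_wpmul2l; first by rewrite lee_fin ltW.
apply: int_stable_kernel_le => //.
by move=> u; exact: stable_kernel_ge0.
Qed.

Lemma int_qst : (\int[mst]_p (`|qst p|)%:E <= (c1 * c2 ^- d * t0)%:E)%E.
Proof.
have mn : measurable_fun setT (fun p => `|qst p|).
  by apply: measurableT_comp => //; exact: measurable_qst.
rewrite (ge0_int_prod leb lebV mn)//.
have C0 : 0 <= c1 * c2 ^- d by rewrite mulr_ge0 ?invr_ge0 ?exprn_ge0// ltW.
have mi : measurable_fun setT (\1_(`]0%R, t0[ : set R) : R -> R) by exact: measurable_indic.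
apply: (@le_trans _ _ (\int[leb]_r (c1 * c2 ^- d * \1_(`]0%R, t0[ : set R) r)%:E)%E).
  apply: ge0_le_integral => //.
  - by move=> r _; apply: integral_ge0 => z _; rewrite lee_fin.
  - exact: (measurable_int lebV mn).
  - have mc : measurable_fun setT (fun r : R => c1 * c2 ^- d * \1_(`]0%R, t0[ : set R) r).
      exact: measurable_funM.
    exact: (measurable_EFinW mc).
  - by move=> r _; exact: int_qst_slice.
rewrite ge0_intZl// EFinM integral_indic//= setIT lebesgue_measure_itv/= lte_fin t0_gt0.
by rewrite oppr0 adde0.
Qed.

Lemma rintegrable_qst : rintegrable mst qst.
Proof. exact: rintegrable_bound measurable_qst int_qst. Qed.

Local Notation stkJ := (stk t0 jump).
Local Notation heat := (heatk t0).

Let mstk := measurable_stk t0 measurable_jump.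
Let int_stk := int_norm_stk beta_gt0 beta_lt2 t0_le1 tauP measurable_jump
  (measurable_funM (measurable_cst M) (measurable_levy beta)) jump_le int_jump_weight.

(** Duhamel's formula, with the elapsed time [s] replaced by the date [t - s]. *)
Lemma qst_duhamel (p' : spacetime) : 0 < (p'.1 : R) < t0 ->
  rintegrable mst (fun p => qst p * stkJ (p, p')) ->
  qst p' = heat ((0, x), p') + \int[mst]_p (qst p * stkJ (p, p')).
Proof.
case: p' => t y /= /andP[tp tt0] iqs.
have tE : 0 < t <= eps by rewrite tp (le_trans (ltW tt0)).
have t_in : (t : R) \in (`]0%R, t0[%classic : set R) by rewrite inE/= in_itv/= tp tt0.
rewrite /qst /= /heatk /window /lag /= subr0 !indicE t_in !mulr1 q_duhamel// heat_kernel0E//.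
congr (_ + _).
have mF : measurable_fun setT (fun p => qst p * stkJ (p, (t, y))).
  exact: rintegrable_measurable iqs.
rewrite (Rint_prod iqs).
rewrite -(Rint_sub1 (t : R) (f := fun r : R => \int[lebV]_z (qst (r, z) * stkJ ((r, z), (t, y)))));
  last exact: (measurable_Rint lebV mF).
rewrite Rintegral_mkcond; apply: eq_Rint => s.
rewrite patchE; case: ifPn => [|].
  rewrite inE/= in_itv/= => /andP[s0 st]; apply: eq_Rint => z.
  rewrite /qst /stk /window /lag /= !indicE.
  have -> : (t : R) - (t - s) = s by rewrite opprB addrC subrK.
  rewrite !mem_set/= ?in_itv/= ?subr_gt0 ?s0 ?st/= ?(lt_trans st)// ?mulr1; last first.
    by rewrite ltrBlDr (lt_trans tt0)// ltrDl.
  congr (_ * _); rewrite (@nonlocal_op_gk _ d beta d_ge1 beta_gt0 beta_lt2 b M)//.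
  exact: (measurable_section1 z mb).
rewrite notin_setE/= in_itv/= => /negP; rewrite negb_and -!leNgt => s_out.
rewrite -[LHS](_ : \int[lebV]_z (0 : R) = 0); last by rewrite /Rintegral integral0.
apply: eq_Rint => z; rewrite /qst /stk /window /lag /= !indicE.
have -> : (t : R) - (t - s) = s by rewrite opprB addrC subrK.
case/orP: s_out => s_out.
  case: (boolP (s \in _)) => [|_]; last by rewrite !mulr0.
  by rewrite inE/= in_itv/= ltNge s_out.
case: (boolP (t - s \in _)) => [|_]; last by rewrite mulr0 mul0r.
by rewrite inE/= in_itv/= subr_gt0 ltNge s_out.
Qed.

(** Duhamel's formula at almost every point, integrated against [phi]; by Fubini the
    kernel [stk] passes from [qst] to [phi]. *)
Lemma int_qst_duhamel (phi : spacetime -> R) (B : R) : measurable_fun setT phi ->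
  (forall p, `|phi p| <= B) -> (forall p, ~ (0 < (p.1 : R) < t0) -> phi p = 0) ->
  \int[mst]_p (qst p * phi p) =
  kop mst heat phi (0, x) + \int[mst]_p (qst p * kop mst stkJ phi p).
Proof.
move=> mphi phiB phi0.
have iK := rintegrable_kernel_mul mstk int_stk rintegrable_qst.
rewrite (kop_dual mstk int_stk rintegrable_qst mphi phiB).
have ih : rintegrable mst (fun p' => heat ((0, x), p') * phi p').
  exact: (kop_rintegrable (measurable_heatk t0) (int_norm_heatk t0_gt0) _ mphi phiB).
have ir := rintegrable_mulr (rintegrable_Rint_swap iK) mphi phiB.
rewrite /kop -(RintD ih ir); apply: ae_eq_Rint.
- by apply: measurable_funM => //; exact: measurable_qst.
- exact: rintegrable_measurable (rintegrableD ih ir).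
apply: filterS (ae_integrable2 iK) => p' ip'.
have [p'0|/phi0 ->] := pselect (0 < (p'.1 : R) < t0); last by rewrite !mulr0 addr0.
by rewrite qst_duhamel// mulrDl.
Qed.

End duhamel.

(** * Positivity of the potential under a positivity-preserving operator *)

Lemma le0_of_geometric {R : realType} (a B k : R) : 0 <= k -> k < 1 ->
  (forall n, a <= k ^+ n * B) -> a <= 0.
Proof.
move=> k0 k1 aB.
have c : (k ^+ n * B) @[n --> \oo] --> (0 : R).
  rewrite -[X in _ --> X](mul0r B); apply: cvgM; last exact: cvg_cst.
  by apply: cvg_expr; rewrite ger0_norm.
rewrite -(cvg_lim (@Rhausdorff R) c); apply: limr_ge; first by apply/cvg_ex; exists 0.
by apply: nearW => n; exact: aB.
Qed.

Lemma int_indic_itv {R : realType} (f : R -> R) (a b : R) : measurable_fun setT f ->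
  (\int[@lebesgue_measure R]_s (f s * \1_(`]a, b[ : set R) s)%:E =
   \int[@lebesgue_measure R]_(s in `[a, b]) (f s)%:E)%E.
Proof.
move=> mf; rewrite integral_itv_bndoo; last first.
  exact: (measurable_funTS (measurable_EFinW mf)).
rewrite [RHS]integral_mkcond; apply: eq_int => s; rewrite patchE indicE.
by case: ifPn => _; rewrite ?mulr1 ?mulr0.
Qed.

Lemma int_exp_lag {R : realType} (k r l : R) : 0 < k -> 0 <= l ->
  (\int[@lebesgue_measure R]_s (expR (- k * (s - r)) * \1_(`]0%R, l[ : set R) (s - r))%:E =
    ((1 - expR (- k * l)) / k)%:E)%E.
Proof.
move=> k0 l0; have mE : measurable_fun setT
    (fun s : R => (expR (- k * s) * \1_(`]0%R, l[ : set R) s)%:E).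
  apply: measurable_EFinW; apply: measurable_funM; last exact: measurable_indic.
  by apply: continuous_measurable_fun => s; apply: continuous_comp; [exact: mulrl_continuous|exact: continuous_expR].
rewrite (ge0_int_sub1 r mE); last by move=> s; rewrite lee_fin mulr_ge0 ?expR_ge0.
pose F (s : R) : R := - (expR (- k * s) / k).
have dF (s : R) : is_derive s 1 F (expR (- k * s)).
  apply: is_derive_eq; rewrite /= /GRing.scale/=.
  have := lt0r_neq0 k0; move: (expR _) => e; clear; move=> k0; field.
  exact: k0.
have cf : continuous (fun s : R => expR (- k * s)).
  by move=> s; apply: continuous_comp; [exact: mulrl_continuous|exact: continuous_expR].
have := integral_derivative_segment l0 dF cf; rewrite /F mulr0 expR0.
rewrite (_ : _ - _ = (1 - expR (- k * l)) / k); last by move: (expR _) => e; clear; ring.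
by move=> <-; apply: int_indic_itv; exact: continuous_measurable_fun.
Qed.

Lemma measurable_exp_lag {R : realType} (k r l : R) : measurable_fun setT
  (fun s : R => expR (- k * (s - r)) * \1_(`]0%R, l[ : set R) (s - r)).
Proof.
have mB : measurable_fun setT (fun s : R => s - r) by exact: measurable_funB.
have mi : measurable_fun setT (\1_(`]0%R, l[ : set R) : R -> R) by exact: measurable_indic.
apply: measurable_funM; last exact: (measurableT_comp mi mB).
apply: (measurableT_comp (@measurable_expR R)).
exact: (measurable_funM (measurable_cst (- k)) mB).
Qed.

Section resolvent.
Context {R : realType} {d : nat}.
Local Notation leb := (@lebesgue_measure R).
Local Notation V := 'rV[R]_d.
Local Notation lebV := (lebesgue_rV d).
Local Notation spacetime := (@spacetime R d).
Local Notation mst := (@mst R d).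
#[local] Hint Extern 0 (is_true (0 <= gk _ _)) => solve [apply: gk_ge0] : core.

Variables (t0 k : R).
Hypotheses (t0_gt0 : 0 < t0) (k_gt0 : 0 < k).

(** The heat kernel killed at rate [k]. *)
Definition kheatk (p : spacetime * spacetime) : R := expR (- k * lag p) * heatk t0 p.

Lemma measurable_kheatk : measurable_fun setT kheatk.
Proof.
apply: measurable_funM; last exact: measurable_heatk.
apply: (measurableT_comp (@measurable_expR R)).
by apply: measurable_funM => //; exact: measurable_lag.
Qed.

Lemma kheatk_ge0 p : 0 <= kheatk p.
Proof. by rewrite mulr_ge0 ?expR_ge0 ?heatk_ge0. Qed.

Lemma int_kheatk (p : spacetime) :
  (\int[mst]_p' (kheatk (p, p'))%:E = ((1 - expR (- k * t0)) / k)%:E)%E.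
Proof.
rewrite ge0_int_prod; first last.
- by move=> p'; exact: kheatk_ge0.
- exact: (measurable_section1 p measurable_kheatk).
rewrite -(int_exp_lag (p.1 : R) k_gt0 (ltW t0_gt0)); apply: eq_int => s.
rewrite /kheatk /heatk /window /lag /= indicE; case: (boolP (_ \in _)) => [|_]; last first.
  by rewrite mulr0; under eq_int do rewrite !mulr0; rewrite integral0.
rewrite inE/= in_itv/= => /andP[s0 _]; rewrite mulr1.
under eq_int do rewrite mulr1.
rewrite ge0_intZl ?expR_ge0//; first by rewrite int_gk_sub// mule1.
apply: measurable_gk => //; apply: measurable_addrV => //; exact: measurable_opprV.
Qed.

Lemma int_norm_kheatk (p : spacetime) :
  (\int[mst]_p' (`|kheatk (p, p')|)%:E <= ((1 - expR (- k * t0)) / k)%:E)%E.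
Proof. by rewrite -(int_kheatk p); apply: int_le_eq => p'; rewrite ger0_norm ?kheatk_ge0. Qed.

(** The resolvent equation for the heat semigroup: Chapman--Kolmogorov in space, then
    integration of the killing factor over the intermediate time. *)
Lemma int_kheatk_heatk (p p' : spacetime) : 0 <= (p.1 : R) -> (p'.1 : R) < t0 ->
  (\int[mst]_r (kheatk (p, r) * heatk t0 (r, p'))%:E =
   ((1 - expR (- k * lag (p, p'))) / k * heatk t0 (p, p'))%:E)%E.
Proof.
case: p p' => [a x] [c y] /= a0 c0.
have mF : measurable_fun setT (fun r : spacetime => kheatk ((a, x), r) * heatk t0 (r, (c, y))).
  apply: measurable_funM; first exact: (measurable_section1 (a, x) measurable_kheatk).
  exact: (measurable_section2 (c, y) (measurable_heatk t0)).
rewrite (ge0_int_prod leb lebV mF); last by move=> r; rewrite mulr_ge0 ?kheatk_ge0 ?heatk_ge0.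
have [ca|ac] := leP c a.
  rewrite (eq_int _ (g := fun=> 0%E)) ?integral0.
    by rewrite [in RHS]/heatk /window /lag /= indicE memNset ?mulr0//= in_itv/= subr_gt0 ltNge ca.
  move=> s; rewrite (eq_int _ (g := fun=> 0%E)) ?integral0// => z.
  rewrite /kheatk /heatk /window /lag /= !indicE.
  case: (boolP (s - a \in _)) => [|_]; last by rewrite !mulr0 mul0r.
  case: (boolP (c - s \in _)) => [|_]; last by rewrite !mulr0.
  rewrite !inE/= !in_itv/= => /andP[h1 _] /andP[h2 _].
  move: ca; rewrite leNgt => /negP; case; apply: (@lt_trans _ _ (s : R)); first by rewrite -subr_gt0.
  by rewrite -subr_gt0.
have l0 : 0 <= c - a by rewrite subr_ge0 ltW.
have ct0 : c - a < t0 by rewrite ltrBlDr ltr_wpDr.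
have E : heatk t0 ((a, x), (c, y)) = gk (c - a) (x - y).
  by rewrite /heatk /window /lag /= indicE mem_set ?mulr1//= in_itv/= subr_gt0 ac ct0.
rewrite E [X in _ = X]EFinM /lag/= -(int_exp_lag a k_gt0 l0) muleC.
rewrite -ge0_intZl ?gk_ge0//; last exact: measurable_exp_lag.
apply: eq_int => s; rewrite /kheatk /heatk /window /lag /= !indicE.
case: (boolP (s - a \in (`]0, c - a[%classic : set R))) => [|out]; last first.
  rewrite !mulr0 (eq_int _ (g := fun=> 0%E)) ?integral0// => z; congr EFin.
  case: (boolP (s - a \in _)) => [|_]; last by rewrite !mulr0 mul0r.
  case: (boolP (c - s \in _)) => [|_]; last by rewrite !mulr0.
  rewrite !inE/= !in_itv/= => /andP[h1 _] /andP[h2 _].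
  move: out; rewrite notin_setE/= in_itv/= => -[]; clear -h1 h2; apply/andP; split; lra.
rewrite inE/= in_itv/= => /andP[sa sc]; rewrite mulr1.
have s1 : 0 < c - s by lra.
rewrite !mem_set/= ?in_itv/= ?sa ?s1 ?(lt_trans sc)//=; last by lra.
rewrite [in RHS]mulrC [X in _ = X]EFinM.
have -> : c - a = (s - a) + (c - s) by lra.
have mg : measurable_fun setT (fun z : V => gk (s - a) (x - z) * gk (c - s) (z - y)).
  apply: measurable_funM.
    by apply: measurable_gk => //; apply: measurable_addrV => //; exact: measurable_opprV.
  by apply: measurable_gk => //; apply: measurable_addrV.
rewrite -(int_gk_gk x y sa s1).
transitivity (\int[lebV]_z (expR (- k * (s - a)) * (gk (s - a) (x - z) * gk (c - s) (z - y)))%:E)%E.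
  by apply: eq_int => z; rewrite !mulr1 mulrA.
apply: (ge0_intZl lebV (expR_ge0 (- k * (s - a))) mg).
by move=> z; rewrite mulr_ge0.
Qed.

End resolvent.

Lemma lower_bound_step {R : realFieldType} (k r c v f I eta : R) :
  (k - r) * (- c) <= (k - r) * v -> - c * r <= I -> - eta <= f - (I - r * v) ->
  - (eta + c * k) <= f + k * v.
Proof. lra. Qed.

Section max_principle.
Context {R : realType} {d : nat}.
Local Notation leb := (@lebesgue_measure R).
Local Notation V := 'rV[R]_d.
Local Notation lebV := (lebesgue_rV d).
Local Notation spacetime := (@spacetime R d).
Local Notation mst := (@mst R d).

Variables (beta : R).
Hypotheses (d_ge1 : (1 <= d)%N) (beta_gt0 : 0 < beta) (beta_lt2 : beta < 2).
Variables (t0 tau k : R).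
Hypotheses (t0_gt0 : 0 < t0) (t0_le1 : t0 <= 1) (k_gt0 : 0 < k).
Hypothesis tauP : (\int[leb]_s ((s `^ theta beta)^-1 * \1_(`]0%R, t0[ : set R) s)%:E <= tau%:E)%E.
Variables (J : V -> V -> R) (h : V -> R) (A : R).
Hypothesis mJ : measurable_fun setT (fun p : V * V => J p.1 p.2).
Hypothesis mh : measurable_fun setT h.
Hypothesis Jh : forall z w, `|J z w| <= h w.
Hypothesis hA : (\int[lebV]_w (levy_cut beta w * h w)%:E <= A%:E)%E.
Hypothesis J_ge0 : forall z w, 0 <= J z w.
Hypothesis J_sym : forall z w, J z (- w) = J z w.
Hypothesis Jk : forall z, (\int[lebV]_w (J z w)%:E <= k%:E)%E.

Local Notation heat := (heatk t0).
Local Notation stkJ := (stk t0 J).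

Let iJ z : rintegrable lebV (J z).
Proof.
apply: (rintegrable_bound (c := k)); first exact: (measurable_section1 z mJ).
by apply: le_trans (Jk z); apply: int_le_eq => w; rewrite ger0_norm.
Qed.

Let rate z := \int[lebV]_w J z w.

Let rate_le z : rate z <= k.
Proof. by rewrite -lee_fin (EFin_Rint (iJ z)). Qed.

Let second_difference_sym (v : V -> R) (c : R) (z : V) : measurable_fun setT v ->
  (forall z, `|v z| <= c) ->
  2^-1 * \int[lebV]_w (J z w * (v (z + w) + v (z - w) - 2 * v z)) =
  \int[lebV]_w (J z w * v (z + w)) - rate z * v z.
Proof.
move=> mv vc; have iJp := iJ z; have mJp := rintegrable_measurable iJp.
have mvp : measurable_fun setT (fun w : V => v (z + w)).
  by apply: (measurableT_comp mv); exact: measurable_addrV.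
have mvm : measurable_fun setT (fun w : V => v (z - w)).
  by apply: (measurableT_comp mv); apply: measurable_addrV => //; exact: measurable_opprV.
have ip : rintegrable lebV (fun w => J z w * v (z + w)).
  exact: (rintegrable_mulr iJp mvp (fun w => vc _)).
have im : rintegrable lebV (fun w => J z w * v (z - w)).
  exact: (rintegrable_mulr iJp mvm (fun w => vc _)).
have i0 := rintegrableZl (2 * v z) iJp.
have eq_pm : \int[lebV]_w (J z w * v (z - w)) = \int[lebV]_w (J z w * v (z + w)).
  rewrite -[RHS]Rint_opp; last exact: (measurable_funM mJp mvp).
  by apply: eq_Rint => w; rewrite J_sym.
transitivity (2^-1 * \int[lebV]_w (J z w * v (z + w) + J z w * v (z - w) - 2 * v z * J z w)).
  by congr (_ * _); apply: eq_Rint => w; ring.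
rewrite (RintB (rintegrableD ip im) i0) (RintD ip im) (RintZl _ iJp) eq_pm -/(rate z).
by move: (Rintegral _ _ _) (rate _) (v z) => a r e; field.
Qed.

Variables (phi : spacetime -> R) (B : R).
Hypothesis mphi : measurable_fun setT phi.
Hypothesis phiB : forall p, `|phi p| <= B.
Hypothesis phi0 : forall p, ~ (0 < (p.1 : R) < t0) -> phi p = 0.

Local Notation u := (kop mst heat phi).

Let B0 : 0 <= B := le_trans (normr_ge0 _) (phiB (0, 0)).

Let mheat := @measurable_heatk R d t0.
Let iheat := int_norm_heatk (d := d) t0_gt0.

Lemma measurable_potential : measurable_fun setT u.
Proof. exact: (@measurable_kop R _ _ _ _ mst heat mheat phi mphi). Qed.

Lemma potential_norm_le p : `|u p| <= t0 * B.
Proof. exact: (kop_norm_le mheat iheat p B0 mphi phiB). Qed.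

Lemma potential_late p : t0 <= (p.1 : R) -> u p = 0.
Proof.
move=> tp; rewrite /kop; transitivity (\int[mst]_p' (0 : R)); last by rewrite /Rintegral integral0.
apply: eq_Rint => p'.
have [p'0|/phi0 ->] := pselect (0 < (p'.1 : R) < t0); last by rewrite mulr0.
rewrite /heatk /window /= indicE; case: (boolP (_ \in _)) => [|_]; last by rewrite mulr0 mul0r.
rewrite inE/= in_itv/= subr_gt0 => /andP[pp' _].
by move: p'0 => /andP[_ /(lt_le_trans)/(_ tp)/(lt_trans pp')]; rewrite ltxx.
Qed.

(** For a symmetric kernel of finite mass the second differences reduce to first ones. *)
Lemma kop_stk_bounded (p : spacetime) :
  kop mst stkJ phi p = \int[lebV]_w (J p.2 w * u (p.1, p.2 + w)) - rate p.2 * u p.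
Proof.
rewrite (kop_stk beta_gt0 beta_lt2 t0_gt0 t0_le1 tauP mJ mh Jh hA p mphi phiB).
have up : u p = u (p.1, p.2) by case: p.
rewrite up; apply: (@second_difference_sym (fun z => u (p.1, z)) (t0 * B)).
  exact: (measurable_section1 p.1 measurable_potential).
by move=> z; exact: potential_norm_le.
Qed.

Let phi' (p : spacetime) := phi p + k * u p.

Let mphi' : measurable_fun setT phi'.
Proof.
apply: measurable_funD => //; apply: measurable_funM => //; exact: measurable_potential.
Qed.

Let phi'B p : `|phi' p| <= B + k * (t0 * B).
Proof.
rewrite (le_trans (ler_normD _ _))// lerD// normrM (ger0_norm (ltW k_gt0)).
by rewrite ler_wpM2l ?(ltW k_gt0)// potential_norm_le.
Qed.

Let mkheat := @measurable_kheatk R d t0 k.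
Let ikheat := int_norm_kheatk (d := d) t0_gt0 k_gt0.

(** The resolvent equation: adding [k * u] to the source compensates the killing at
    rate [k]. *)
Lemma potential_resolvent p : 0 <= (p.1 : R) -> u p = kop mst (kheatk t0 k) phi' p.
Proof.
move=> p0; have mp : measurable_fun setT (fun p' => kheatk t0 k (p, p')).
  exact: (measurable_section1 p mkheat).
have iK : rintegrable mst (fun p' => kheatk t0 k (p, p')).
  exact: (rintegrable_bound mp (ikheat p)).
have mku : measurable_fun setT (fun p => k * u p).
  by apply: measurable_funM => //; exact: measurable_potential.
have kuB p' : `|k * u p'| <= k * (t0 * B).
  by rewrite normrM (ger0_norm (ltW k_gt0)) ler_wpM2l ?(ltW k_gt0)// potential_norm_le.
rewrite /phi' (kopD mkheat ikheat p mphi phiB mku kuB).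
rewrite (kopZ mkheat ikheat k p measurable_potential potential_norm_le).
have ih : rintegrable mst (fun p' => heat (p, p') * phi p').
  exact: (kop_rintegrable mheat iheat p mphi phiB).
have ik : rintegrable mst (fun p' => kheatk t0 k (p, p') * phi p').
  exact: (kop_rintegrable mkheat ikheat p mphi phiB).
have -> : kop mst (kheatk t0 k) u p = \int[mst]_p' (k^-1 * (heat (p, p') * phi p' - kheatk t0 k (p, p') * phi p')).
  rewrite [LHS](kop_dual mheat iheat iK mphi phiB); apply: eq_Rint => p'.
  have [/andP[_ p't]|/phi0 ->] := pselect (0 < (p'.1 : R) < t0); last by rewrite !mulr0 subr0 mulr0.
  rewrite /Rintegral int_kheatk_heatk//= /kheatk.
  by move: (expR _) (heatk _ _) (phi p'); clear => a b c; rewrite mulrC; ring.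
rewrite (RintZl _ (rintegrableB ih ik)) (RintB ih ik) /kop mulVKf ?lt0r_neq0//.
by rewrite addrC subrK.
Qed.

Let kappa := 1 - expR (- k * t0).

Let kappa_ge0 : 0 <= kappa.
Proof. by rewrite subr_ge0 expR_le1 mulNr oppr_le0 mulr_ge0// ltW. Qed.

Let kappa_lt1 : kappa < 1.
Proof. by rewrite gtrDl oppr_lt0 expR_gt0. Qed.

Let source_potential m p : 0 <= m -> (forall p', 0 < (p'.1 : R) < t0 -> - m <= phi' p') ->
  0 <= (p.1 : R) -> - (kappa / k * m) <= u p.
Proof.
move=> m0 phim p0; have mp : measurable_fun setT (fun p' => kheatk t0 k (p, p')).
  exact: (measurable_section1 p mkheat).
have iK : rintegrable mst (fun p' => kheatk t0 k (p, p')).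
  exact: (rintegrable_bound mp (ikheat p)).
have ik : rintegrable mst (fun p' => kheatk t0 k (p, p') * phi' p').
  exact: (kop_rintegrable mkheat ikheat p mphi' phi'B).
rewrite (potential_resolvent p0).
have -> : - (kappa / k * m) = \int[mst]_p' (- m * kheatk t0 k (p, p')).
  by rewrite (RintZl _ iK) [in RHS]/Rintegral int_kheatk//= mulrC mulNr.
apply: le_Rint => //; first exact: rintegrableZl.
move=> p'; rewrite mulrC.
have [p't|tp'] := ltP (p'.1 : R) t0; last first.
  have -> : phi' p' = 0.
    rewrite /phi' potential_late// mulr0 addr0; apply: phi0 => /andP[_].
    by rewrite ltNge tp'.
  by rewrite mulr0 mulrN oppr_le0 mulr_ge0// kheatk_ge0.
have [p'0|p'0] := ltP 0 (p'.1 : R).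
  by rewrite ler_wpM2l ?kheatk_ge0// phim// p'0.
suff -> : kheatk t0 k (p, p') = 0 by rewrite !mul0r.
rewrite /kheatk /heatk /window /= indicE; case: (boolP (_ \in _)) => [|_]; last by rewrite !mulr0.
rewrite inE/= in_itv/= subr_gt0 => /andP[pp' _].
by move: (lt_le_trans pp' p'0); rewrite ltNge p0.
Qed.

(** The hypothesis reads [phi' >= - eta + N u] for the positive operator
    [N u (z) = \int J z w * u (z + w) dw + (k - rate z) * u z], of mass [k]; with
    [source_potential], a lower bound [- m] for [phi'] improves to [- (eta + kappa * m)],
    and [kappa < 1]. *)
Lemma potential_ge (eta : R) : 0 <= eta ->
  (forall p, 0 < (p.1 : R) < t0 -> - eta <= phi p - kop mst stkJ phi p) ->
  forall p, 0 <= (p.1 : R) -> - (expR (k * t0) / k * eta) <= u p.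
Proof.
move=> eta0 sub.
pose B' := B + k * (t0 * B).
pose e := expR (k * t0) * eta.
have e0 : 0 <= e by rewrite mulr_ge0 ?expR_ge0.
have eE : eta + kappa * e = e.
  have := expRxMexpNx_1 (k * t0).
  rewrite /kappa /e mulNr; move: (expR (k * t0)) (expR (- (k * t0))) => a b ab.
  have -> : eta + (1 - b) * (a * eta) = a * eta + (1 - a * b) * eta by ring.
  by rewrite ab subrr mul0r addr0.
have B'0 : 0 <= B' by rewrite addr_ge0 ?mulr_ge0// ltW.
have step n p : 0 < (p.1 : R) < t0 -> - (e + kappa ^+ n * B') <= phi' p.
  elim: n p => [|n IH] p p0t.
    rewrite expr0 mul1r; apply: le_trans (_ : - B' <= _); first by rewrite lerN2 lerDr.
    by have := phi'B p; rewrite ler_norml => /andP[].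
  have /andP[/ltW p0 _] := p0t; set m := e + kappa ^+ n * B' in IH.
  have m0 : 0 <= m by rewrite addr_ge0// mulr_ge0// exprn_ge0.
  have ue := source_potential m0 IH.
  have := sub p p0t; rewrite kop_stk_bounded.
  have iJp := iJ p.2.
  have mup : measurable_fun setT (fun w : V => u ((p.1, p.2 + w) : spacetime)).
    have mu1 : measurable_fun setT (fun z : V => u ((p.1, z) : spacetime)).
      exact: (measurable_section1 p.1 measurable_potential).
    by apply: (measurableT_comp mu1); exact: measurable_addrV.
  have ip : rintegrable lebV (fun w : V => J p.2 w * u (p.1, p.2 + w)).
    apply: (@rintegrable_mulr _ V R lebV (J p.2) (fun w : V => u (p.1, p.2 + w)) (t0 * B) iJp mup) => w.
  exact: potential_norm_le.
  have : - (kappa / k * m) * rate p.2 <= \int[lebV]_w (J p.2 w * u (p.1, p.2 + w)).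
    rewrite -(RintZl _ iJp); apply: le_Rint => //; first exact: rintegrableZl.
    by move=> w; rewrite mulrC ler_wpM2l// ue.
  have := ler_wpM2l (_ : 0 <= k - rate p.2) (ue p p0); rewrite subr_ge0 => /(_ (rate_le _)).
  have -> : e + kappa ^+ n.+1 * B' = eta + kappa * m by rewrite /m [in RHS]mulrDr [RHS]addrA eE exprS mulrA.
  rewrite /phi'; set I := Rintegral _ _ _; set r := rate _.
  have kk : kappa * m = kappa / k * m * k by rewrite mulrAC divfK// lt0r_neq0.
  by rewrite kk; exact: lower_bound_step.
move=> p p0.
have phie p' : 0 < (p'.1 : R) < t0 -> - e <= phi' p'.
  move=> p't; rewrite -subr_le0; apply: (@le0_of_geometric _ _ B' kappa) => // n.
  by have := step n p' p't; rewrite opprD lerBlDr -lerBlDl.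
apply: le_trans (source_potential e0 phie p0); rewrite lerN2.
have -> : kappa / k * e = kappa * (expR (k * t0) / k * eta).
  by rewrite /e; move: (expR _) k^-1 => a c; clear; ring.
apply: ler_piMl; last exact: ltW.
by rewrite mulr_ge0// divr_ge0 ?expR_ge0// ltW.
Qed.

End max_principle.

Section jump_split.
Context {R : realType} {d : nat}.
Local Notation leb := (@lebesgue_measure R).
Local Notation V := 'rV[R]_d.
Local Notation lebV := (lebesgue_rV d).
Local Notation spacetime := (@spacetime R d).
Local Notation mst := (@mst R d).

Variables (beta : R).
Hypotheses (beta_gt0 : 0 < beta) (beta_lt2 : beta < 2).
Variables (t0 tau : R).
Hypotheses (t0_gt0 : 0 < t0) (t0_le1 : t0 <= 1).
Hypothesis tauP : (\int[leb]_s ((s `^ theta beta)^-1 * \1_(`]0%R, t0[ : set R) s)%:E <= tau%:E)%E.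
Variables (J J1 J2 : V -> V -> R) (h : V -> R) (A : R).
Hypothesis mJ : measurable_fun setT (fun p : V * V => J p.1 p.2).
Hypothesis mJ1 : measurable_fun setT (fun p : V * V => J1 p.1 p.2).
Hypothesis mJ2 : measurable_fun setT (fun p : V * V => J2 p.1 p.2).
Hypothesis mh : measurable_fun setT h.
Hypothesis J1h : forall z w, `|J1 z w| <= h w.
Hypothesis J2h : forall z w, `|J2 z w| <= h w.
Hypothesis hA : (\int[lebV]_w (levy_cut beta w * h w)%:E <= A%:E)%E.
Hypothesis J12 : forall z, {ae lebV, forall w, J z w = J1 z w + J2 z w}.

Lemma jump_heat_ae_split (p p' : spacetime) :
  rintegrable lebV (fun w => gkD2 (lag (p, p')) (p.2 - p'.2) w * J1 p.2 w * window t0 (p, p')) ->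
  rintegrable lebV (fun w => gkD2 (lag (p, p')) (p.2 - p'.2) w * J2 p.2 w * window t0 (p, p')) ->
  stk t0 J (p, p') = stk t0 J1 (p, p') + stk t0 J2 (p, p').
Proof.
move=> i1 i2; rewrite 3!jump_heat_window -mulrDr /= -(RintD i1 i2); congr (_ * _).
have mg : measurable_fun setT (gkD2 (lag (p, p')) (p.2 - p'.2)) by exact: measurable_gkD2.
apply: ae_eq_Rint.
- apply: measurable_funM => //; apply: measurable_funM => //.
  exact: (measurable_section1 p.2 mJ).
- apply: measurable_funD; apply: measurable_funM => //; apply: measurable_funM => //.
    exact: (measurable_section1 p.2 mJ1).
  exact: (measurable_section1 p.2 mJ2).
by apply: filterS (J12 p.2) => w ->; rewrite mulrDr mulrDl.
Qed.

(** The jump kernels enter through integrals in [w] only, and for almost every [p'] these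
    converge absolutely. *)
Lemma kop_stkD (phi : spacetime -> R) (B : R) (p : spacetime) :
  measurable_fun setT phi -> (forall p', `|phi p'| <= B) ->
  kop mst (stk t0 J) phi p = kop mst (stk t0 J1) phi p + kop mst (stk t0 J2) phi p.
Proof.
move=> mphi phiB.
have i1 := kop_rintegrable (measurable_stk t0 mJ1)
  (int_norm_stk beta_gt0 beta_lt2 t0_le1 tauP mJ1 mh J1h hA) p mphi phiB.
have i2 := kop_rintegrable (measurable_stk t0 mJ2)
  (int_norm_stk beta_gt0 beta_lt2 t0_le1 tauP mJ2 mh J2h hA) p mphi phiB.
rewrite /kop -(RintD i1 i2); apply: ae_eq_Rint.
- apply: measurable_funM => //; exact: (measurable_section1 p (measurable_stk t0 mJ)).
- exact: rintegrable_measurable (rintegrableD i1 i2).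
have s1 := ae_rintegrable (rintegrable_slice beta_gt0 beta_lt2 t0_le1 tauP mJ1 mh J1h hA p).
have s2 := ae_rintegrable (rintegrable_slice beta_gt0 beta_lt2 t0_le1 tauP mJ2 mh J2h hA p).
apply: filterS2 s1 s2 => p' s1 s2.
by rewrite (jump_heat_ae_split s1 s2) mulrDl.
Qed.

End jump_split.

(** * Nonnegative jump intensities give a nonnegative kernel *)

Lemma sum_lower_bound {R : realFieldType} (f a c e u v : R) :
  - e <= u -> - c <= v -> - a <= f -> - (u + f + v) - c <= e + a.
Proof. lra. Qed.

Lemma in_window {R : realFieldType} (t0 t s r : R) : t - s <= r -> r <= t + s ->
  s <= t / 2 -> s <= (t0 - t) / 2 -> 0 < t -> t < t0 -> 0 < r < t0.
Proof. by move=> *; apply/andP; split; lra. Qed.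

Lemma in_ball {R : realFieldType} (e t s r : R) : 0 < e -> s <= e / 2 ->
  t - s <= r -> r <= t + s -> t - e < r < t + e.
Proof. by move=> *; apply/andP; split; lra. Qed.

Section nonnegative_jumps.
Context {R : realType} {d : nat}.
Local Notation leb := (@lebesgue_measure R).
Local Notation V := 'rV[R]_d.
Local Notation lebV := (lebesgue_rV d).
Local Notation spacetime := (@spacetime R d).
Local Notation mst := (@mst R d).

Variables (beta : R) (b : V -> V -> R) (q : R -> V -> V -> R) (M eps c1 c2 : R).
Hypotheses (d_ge1 : (1 <= d)%N) (beta_gt0 : 0 < beta) (beta_lt2 : beta < 2).
Hypothesis mb : measurable_fun [set: V * V] (fun p : V * V => b p.1 p.2).
Hypothesis bM : forall x z, `|b x z| <= M.
Hypothesis b_sym : forall x z, b x z = b x (- z).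
Hypothesis cq : {within [set p : R * V * V | 0 < p.1.1],
      continuous (fun p => q p.1.1 p.1.2 p.2)}.
Hypotheses (eps0 : 0 < eps) (c10 : 0 < c1) (c20 : 0 < c2).
Hypothesis q_le : forall (t : R) x y, 0 < t <= eps ->
  `|q t x y| <= c1 * heat_kernel beta 1 t (c2 *: x) (c2 *: y).
Hypothesis q_duhamel : forall (t : R) x y, 0 < t <= eps ->
  q t x y = heat_kernel beta 0 t x y +
          \int[lebesgue_measure]_(s in `]0, t[)
            \int[lebesgue_rV d]_z
              (q (t - s) x z *
               nonlocal_op beta b (fun w => heat_kernel beta 0 s w y) z).
Hypothesis b_ge0 : forall x, {ae lebV, forall z, 0 <= b x z}.

Variables (t0 tau : R).
Hypotheses (t0_gt0 : 0 < t0) (t0_le1 : t0 <= 1) (t0_eps : t0 <= eps).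
Hypothesis tauP : (\int[leb]_s ((s `^ theta beta)^-1 * \1_(`]0%R, t0[ : set R) s)%:E <= tau%:E)%E.

Let A : R := M * @levy_mass R d beta.
Hypothesis tau_small : 2 * A * tau <= 2^-1.

Let M0 : 0 <= M := le_trans (normr_ge0 _) (bM 0 0).
Let h (w : V) : R := M * levy beta w.
Let mh : measurable_fun setT (h : V -> R).
Proof. by apply: measurable_funM => //; exact: measurable_levy. Qed.
Let hA : (\int[lebV]_w (levy_cut beta w * h w)%:E <= A%:E)%E.
Proof. exact: (int_jump_weight d_ge1 beta_gt0 beta_lt2 bM). Qed.
Let h0 w : 0 <= h w. Proof. by rewrite mulr_ge0// levy_ge0. Qed.

Let tau0 : 0 <= tau.
Proof.
rewrite -lee_fin; apply: le_trans tauP; apply: integral_ge0 => s _.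
by rewrite lee_fin mulr_ge0// invr_ge0 powR_ge0.
Qed.

Let J := jump beta b.
Let mJ := measurable_jump beta mb.

Section truncation.
Variable dl : R.
Hypothesis dl01 : 0 < dl <= 1.

(* The jumps of size larger than [dl], with the negative values of [b], which
   occur on a null set only, replaced by [0]. *)
Let J1 (z w : V) : R := Num.max (b z w) 0 * levy beta w * \1_[set w : V | dl < enorm w] w.
Let J2 (z w : V) : R := jump beta b z w * \1_[set w : V | enorm w <= dl] w.

Let measurable_far : measurable_fun setT (fun p : V * V => \1_[set w : V | dl < enorm w] p.2 : R).
Proof.
have mi : measurable_fun setT (\1_[set w : V | dl < enorm w] : V -> R).
  by apply: measurable_indic; exact: measurable_enorm_gt.
exact: (measurableT_comp mi measurable_snd).
Qed.

Let measurable_near1 : measurable_fun setT (\1_[set w : V | enorm w <= dl] : V -> R).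
Proof. by apply: measurable_indic; exact: measurable_enorm_le. Qed.

Let mJ1 : measurable_fun setT (fun p : V * V => J1 p.1 p.2).
Proof.
apply: measurable_funM => //; apply: measurable_funM; first exact: measurable_maxr.
exact: (measurableT_comp (measurable_levy beta) measurable_snd).
Qed.

Let mJ2 : measurable_fun setT (fun p : V * V => J2 p.1 p.2).
Proof.
apply: measurable_funM => //; exact: (measurableT_comp measurable_near1 measurable_snd).
Qed.

Let J1_ge0 z w : 0 <= J1 z w.
Proof. by rewrite !mulr_ge0 ?levy_ge0// le_max lexx orbT. Qed.

Let indic01 (T : Type) (S : set T) x : 0 <= (\1_S x : R) <= 1.
Proof. by rewrite indicE; case: (_ \in _); rewrite ?lexx ?ler01. Qed.

Let J1_le z w : J1 z w <= h w * \1_[set w : V | dl < enorm w] w.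
Proof.
rewrite ler_wpM2r// ler_wpM2r ?levy_ge0// ge_max M0 andbT.
exact: le_trans (ler_norm _) (bM z w).
Qed.

Let J1h z w : `|J1 z w| <= h w.
Proof.
rewrite ger0_norm//; apply: le_trans (J1_le z w) _; apply: ler_piMr; first exact: h0.
by have /andP[] := indic01 [set w : V | dl < enorm w] w.
Qed.

Let h2 w := h w * \1_[set w : V | enorm w <= dl] w.

Let J2h2 z w : `|J2 z w| <= h2 w.
Proof. by rewrite normrM [X in _ * X]ger0_norm// ler_wpM2r// jump_le. Qed.

Let J2h z w : `|J2 z w| <= h w.
Proof.
apply: le_trans (J2h2 z w) _; apply: ler_piMr; first exact: h0.
by have /andP[] := indic01 [set w : V | enorm w <= dl] w.
Qed.

Let J12 z : {ae lebV, forall w, J z w = J1 z w + J2 z w}.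
Proof.
apply: filterS (b_ge0 z) => w bw; rewrite /J /jump /J1 /J2 /jump max_l// !indicE.
have [dw|dw] := ltP dl (enorm w).
  by rewrite mem_set// memNset ?mulr1 ?mulr0 ?addr0//= leNgt dw.
by rewrite [X in _ * (nat_of_bool X)%:R + _]memNset/= ?ltNge ?dw// mem_set ?mulr1 ?mulr0 ?add0r.
Qed.

Let J1_sym z w : J1 z (- w) = J1 z w.
Proof.
rewrite /J1 -b_sym /levy enormN !indicE; congr (_ * _%:R); congr nat_of_bool.
by apply/idP/idP; rewrite !inE/= enormN.
Qed.

Let cdl : R := Num.min 1 (dl `^ (2 * theta beta)).
(* A bound for the rate of the truncated jumps. *)
Let k : R := cdl^-1 * A + 1.

Let cdl_gt0 : 0 < cdl.
Proof. by rewrite lt_min ltr01 powR_gt0//; case/andP: dl01. Qed.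

Let A0 : 0 <= A.
Proof.
rewrite -lee_fin; apply: le_trans hA; apply: integral_ge0 => w _.
by rewrite lee_fin mulr_ge0// levy_cut_ge0.
Qed.

Let k_gt0 : 0 < k.
Proof. by rewrite ltr_wpDl// mulr_ge0// invr_ge0 ltW. Qed.

Let J1k z : (\int[lebV]_w (J1 z w)%:E <= k%:E)%E.
Proof.
have mch : measurable_fun setT (fun w : V => levy_cut beta w * h w).
  by apply: measurable_funM => //; exact: measurable_levy_cut.
have ch0 (w : V) : 0 <= levy_cut beta w * h w by rewrite mulr_ge0// levy_cut_ge0.
apply: (@le_trans _ _ (\int[lebV]_w (cdl^-1 * (levy_cut beta w * h w))%:E)%E).
  apply: ge0_le_int => //.
  - exact: (measurable_section1 z mJ1).
  - exact: measurable_funM.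
  move=> w; apply: le_trans (J1_le z w) _; rewrite indicE.
  case: (boolP (_ \in _)) => [|_]; last by rewrite mulr0 mulr_ge0// invr_ge0 ltW.
  rewrite inE/= => dw; rewrite mulr1 mulrA ler_peMl// ler_pdivlMl// mulr1.
  rewrite /cdl /levy_cut le_min ge_min lexx/= ge_min; apply/orP; right.
  have /andP[d0 _] := dl01.
  apply: ge0_ler_powR; rewrite ?nnegrE ?enorm_ge0 ?(ltW d0) ?(ltW dw)//.
  by rewrite mulr_ge0// ltW// theta_gt0.
have c0 : 0 <= cdl^-1 by rewrite invr_ge0 ltW.
rewrite (ge0_intZl lebV c0 mch)//; apply: (@le_trans _ _ (cdl^-1 * A)%:E).
  rewrite [X in (_ <= X)%E]EFinM; apply: lee_wpmul2l.
    by rewrite lee_fin.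
  exact: hA.
by rewrite lee_fin lerDl.
Qed.

Variables (psi : spacetime -> R).
Hypothesis mpsi : measurable_fun setT psi.
Hypothesis psi01 : forall p, 0 <= psi p <= 1.
Hypothesis psi0 : forall p, ~ (0 < (p.1 : R) < t0) -> psi p = 0.

Let inside (p : spacetime) : R := \1_(`]0%R, t0[ : set R) p.1.

Let measurable_inside : measurable_fun setT inside.
Proof.
have mi : measurable_fun setT (\1_(`]0%R, t0[ : set R) : R -> R) by exact: measurable_indic.
apply: (measurableT_comp mi); exact: (measurableT_comp (@measurable_time R) measurable_fst).
Qed.

(* The partial sums of the Neumann series for [phi - stk phi = psi]. *)
Let step (phi : spacetime -> R) (p : spacetime) : R := kop mst (stk t0 J1) phi p * inside p.
Fixpoint neumann n (p : spacetime) : R :=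
  if n is n'.+1 then psi p + step (neumann n') p else psi p.

Let mstk1 := measurable_stk t0 mJ1.
Let istk1 := int_norm_stk beta_gt0 beta_lt2 t0_le1 tauP mJ1 mh J1h hA.

Let step_le (phi : spacetime -> R) (B : R) (p : spacetime) : 0 <= B -> measurable_fun setT phi ->
  (forall p, `|phi p| <= B) -> `|step phi p| <= 2^-1 * B.
Proof.
move=> B0 mphi phiB; rewrite normrM; apply: (@le_trans _ _ `|kop mst (stk t0 J1) phi p|).
  rewrite ler_piMr// ger0_norm//.
  by have /andP[] := indic01 (`]0%R, t0[ : set R) (p.1 : R).
apply: le_trans (kop_norm_le mstk1 istk1 p B0 mphi phiB) _.
by rewrite ler_wpM2r.
Qed.

Let measurable_step (phi : spacetime -> R) : measurable_fun setT phi -> measurable_fun setT (step phi).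
Proof. by move=> mphi; apply: measurable_funM => //; exact: measurable_kop. Qed.

Let measurable_neumann n : measurable_fun setT (neumann n).
Proof. by elim: n => [//|n IH]; apply: measurable_funD => //; exact: measurable_step. Qed.

Let neumann_le2 n (p : spacetime) : `|neumann n p| <= 2.
Proof.
have psi1 p' : `|psi p'| <= 1 by have /andP[? ?] := psi01 p'; rewrite ger0_norm.
elim: n p => [|n IH] p /=; first by rewrite (le_trans (psi1 p))// ler1n.
rewrite (le_trans (ler_normD _ _))//.
have := step_le p (ler0n R 2) (measurable_neumann n) IH.
by rewrite mulVf ?pnatr_eq0// => h1; rewrite (_ : 2 = 1 + 1)// lerD.
Qed.

Let neumann0 n (p : spacetime) : ~ (0 < (p.1 : R) < t0) -> neumann n p = 0.
Proof.
move=> p0; case: n => [|n] /=; rewrite psi0//.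
by rewrite /step /inside indicE memNset ?mulr0 ?addr0//= in_itv.
Qed.

Let neumann_step n (p : spacetime) : `|neumann n.+1 p - neumann n p| <= 2^-1 ^+ n.+1.
Proof.
elim: n p => [|n IH] p.
  rewrite /= addrC addKr expr1; have := @step_le psi 1 p ler01 mpsi.
  rewrite mulr1; apply => p'.
  by have /andP[? ?] := psi01 p'; rewrite ger0_norm.
rewrite [neumann n.+2 p]/= [neumann n.+1 p]/= opprD addrACA subrr add0r.
rewrite /step -mulrBl -(kopB mstk1 istk1 p (measurable_neumann n.+1) (neumann_le2 n.+1)
  (measurable_neumann n) (neumann_le2 n)).
rewrite -/(step _ _) [X in _ <= X]exprS; apply: step_le => //.
apply: measurable_funB; exact: measurable_neumann.
Qed.

Variables (x : V) (A2 : R).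
Hypothesis hA2 : (\int[lebV]_w (levy_cut beta w * h2 w)%:E <= A2%:E)%E.

Let mh2 : measurable_fun setT h2.
Proof. exact: measurable_funM. Qed.

Let neumann_sub n (p : spacetime) : 0 < (p.1 : R) < t0 ->
  - 2^-1 ^+ n.+1 <= neumann n p - kop mst (stk t0 J1) (neumann n) p.
Proof.
move=> pt; have := neumann_step n p; rewrite /= /step /inside indicE mem_set/= ?in_itv// mulr1.
rewrite ler_norml => /andP[_]; have /andP[h1 _] := psi01 p.
move: (kop _ _ _ _) (neumann _ _) (_ ^+ _) (psi p) h1 => a c e f; clear.
by move=> h1 h2; rewrite lerNl opprB; apply: le_trans h2; rewrite lerD2r lerDr.
Qed.

(** [int_qst_duhamel] for [neumann n]: the potential is almost nonnegative by
    [potential_ge], the remainder of the Neumann series decreases geometrically, and the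
    jumps of size at most [dl] account for the factor [A2]. *)
Lemma qst_psi_truncated : - (\int[mst]_p (qst q t0 x p * psi p)) <= c1 * c2 ^- d * t0 * (4 * A2 * tau).
Proof.
set Q := qst q t0 x; set Cq := c1 * c2 ^- d * t0.
have mQ : measurable_fun setT Q := measurable_qst cq t0 x.
have iQ : rintegrable mst Q := rintegrable_qst cq c10 c20 q_le x t0_gt0 t0_eps.
have Qle : (\int[mst]_p (`|Q p|)%:E <= Cq%:E)%E := int_qst cq c10 c20 q_le x t0_gt0 t0_eps.
have Cq0 : 0 <= Cq by rewrite !mulr_ge0 ?invr_ge0 ?exprn_ge0 ?ltW.
have Qg (g : spacetime -> R) (G : R) : measurable_fun setT g -> 0 <= G ->
    (forall p, `|g p| <= G) -> `|\int[mst]_p (Q p * g p)| <= Cq * G.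
  move=> mg G0 gG; apply: Rint_norm_le; first exact: measurable_funM.
  have mnQ : measurable_fun setT (fun p => `|Q p|) by exact: measurableT_comp.
  apply: (@le_trans _ _ (\int[mst]_p (G * `|Q p|)%:E)%E).
    apply: ge0_le_int => //.
    - by apply: measurableT_comp => //; exact: measurable_funM.
    - exact: measurable_funM.
    - by move=> p; rewrite normrM mulrC ler_wpM2r.
  rewrite (ge0_intZl mst G0 mnQ)// mulrC [X in (_ <= X)%E]EFinM.
  by apply: lee_wpmul2l; rewrite ?lee_fin.
pose K2 n := kop mst (stk t0 J2) (neumann n).
have istk2 := int_norm_stk beta_gt0 beta_lt2 t0_le1 tauP mJ2 mh2 J2h2 hA2.
have mK2 n : measurable_fun setT (K2 n).
  exact: (measurable_kop mst (measurable_stk t0 mJ2) (measurable_neumann n)).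
have K2le n p : `|K2 n p| <= 2 * A2 * tau * 2.
  exact: (kop_norm_le (measurable_stk t0 mJ2) istk2 p (ler0n R 2) (measurable_neumann n) (neumann_le2 n)).
have K20 : 0 <= 2 * A2 * tau * 2 := le_trans (normr_ge0 _) (K2le 0%N (0, 0)).
have diff n : \int[mst]_p (Q p * psi p) = kop mst (heatk t0) (neumann n) (0, x) +
    \int[mst]_p (Q p * (neumann n.+1 p - neumann n p)) + \int[mst]_p (Q p * K2 n p).
  have mN := measurable_neumann n; have mN1 := measurable_neumann n.+1.
  have := int_qst_duhamel d_ge1 beta_gt0 beta_lt2 mb bM b_sym cq c10 c20 q_le q_duhamel
    x t0_gt0 t0_le1 t0_eps tauP mN (neumann_le2 n) (neumann0 n).
  rewrite -/Q.
  have i1 : rintegrable mst (fun p => Q p * neumann n.+1 p).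
    exact: (rintegrable_mulr iQ mN1 (neumann_le2 n.+1)).
  have i2 : rintegrable mst (fun p => Q p * psi p).
    by apply: (rintegrable_mulr iQ mpsi (c := 1)) => p; have /andP[? ?] := psi01 p; rewrite ger0_norm.
  have i3 : rintegrable mst (fun p => Q p * K2 n p).
    exact: (rintegrable_mulr iQ (mK2 n) (K2le n)).
  have i4 : rintegrable mst (fun p => Q p * neumann n p).
    exact: (rintegrable_mulr iQ mN (neumann_le2 n)).
  have -> : \int[mst]_p (Q p * (neumann n.+1 p - neumann n p)) =
      \int[mst]_p (Q p * neumann n.+1 p) - \int[mst]_p (Q p * neumann n p).
    by rewrite -(RintB i1 i4); apply: eq_Rint => p; rewrite mulrBr.
  have -> : \int[mst]_p (Q p * kop mst (stk t0 (jump beta b)) (neumann n) p) =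
      \int[mst]_p (Q p * neumann n.+1 p) - \int[mst]_p (Q p * psi p) + \int[mst]_p (Q p * K2 n p).
    rewrite -(RintB i1 i2) -(RintD (rintegrableB i1 i2) i3); apply: eq_Rint => p.
    rewrite (kop_stkD beta_gt0 beta_lt2 t0_le1 tauP mJ mJ1 mJ2 mh J1h J2h hA J12 p mN (neumann_le2 n)).
    rewrite mulrDr; congr (_ + _); rewrite /= mulrDr addrAC subrr add0r /step mulrCA.
    rewrite /Q /qst /inside mulrCA -!mulrA; congr (_ * _).
    by rewrite indicE; case: (_ \in _); rewrite ?mul1r ?mulr1 ?mul0r ?mulr0.
  move: (kop _ _ _ _) (\int[mst]_p (Q p * neumann n.+1 p)) (\int[mst]_p (Q p * neumann n p)).
  by move: (\int[mst]_p (Q p * psi p)) (\int[mst]_p (Q p * K2 n p)) => a e f g i ->; ring.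
rewrite -subr_le0; apply: (@le0_of_geometric _ _ ((expR (k * t0) / k + Cq) / 2) (2^-1)) => //.
  by rewrite invf_lt1// ltr1n.
move=> n; rewrite (diff n).
have half0 : 0 <= 2^-1 ^+ n.+1 :> R by rewrite exprn_ge0.
have b1 : - (expR (k * t0) / k * 2^-1 ^+ n.+1) <= kop mst (heatk t0) (neumann n) (0, x).
  exact: (potential_ge beta_gt0 beta_lt2 t0_gt0 t0_le1 k_gt0 tauP mJ1 mh J1h hA
    J1_ge0 J1_sym J1k (measurable_neumann n) (neumann_le2 n) (neumann0 n) half0 (neumann_sub n)
    (p := (0, x)) (lexx 0)).
have mD : measurable_fun setT (fun p : spacetime => neumann n.+1 p - neumann n p).
  apply: measurable_funB; exact: measurable_neumann.
have := Qg _ _ mD half0 (neumann_step n).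
have := Qg _ _ (mK2 n) K20 (K2le n).
rewrite !ler_norml => /andP[b2 _] /andP[b3 _].
have -> : 4 * A2 * tau = 2 * A2 * tau * 2 by ring.
rewrite (_ : 2^-1 ^+ n * _ = expR (k * t0) / k * 2^-1 ^+ n.+1 + Cq * 2^-1 ^+ n.+1); last first.
  by rewrite exprSr; move: (_ ^+ _) (expR _ / _) => a e; ring.
move: b1 b2 b3; move: (kop _ _ _ _) (\int[mst]_p (Q p * K2 n p)).
move: (\int[mst]_p _) (Cq * _) (Cq * _) (expR _ / _ * _); exact: sum_lower_bound.
Qed.

End truncation.

Lemma qst_psi_ge0 (x : V) (psi : spacetime -> R) : measurable_fun setT psi ->
  (forall p, 0 <= psi p <= 1) -> (forall p, ~ (0 < (p.1 : R) < t0) -> psi p = 0) ->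
  0 <= \int[mst]_p (qst q t0 x p * psi p).
Proof.
move=> mpsi psi01 psi0; rewrite -oppr_le0.
have [C [kappa [C0 kappa0 small]]] := int_levy_small d_ge1 beta_gt0 beta_lt2.
pose Cq := c1 * c2 ^- d * t0.
have Cq0 : 0 <= Cq by rewrite !mulr_ge0 ?invr_ge0 ?exprn_ge0 ?ltW.
have CC : 0 <= Cq * (4 * (M * C) * tau) by apply: mulr_ge0 => //; rewrite !mulr_ge0.
apply/ler_addgt0Pr => e e0; rewrite add0r.
have [dl dl01 dle] := powR_small CC kappa0 e0; apply: le_trans dle.
have hA2 : (\int[lebV]_w (levy_cut beta w * (M * levy beta w * \1_[set w : V | (enorm w <= dl)%R] w))%:E <=
    (M * (C * dl `^ kappa))%:E)%E.
  have mF : measurable_fun setT (fun w : V =>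
      levy_cut beta w * levy beta w * \1_[set w : V | enorm w <= dl] w).
    apply: measurable_funM; last by apply: measurable_indic; exact: measurable_enorm_le.
    by apply: measurable_funM; [exact: measurable_levy_cut|exact: measurable_levy].
  apply: (@le_trans _ _ (\int[lebV]_w (M * (levy_cut beta w * levy beta w * \1_[set w : V | (enorm w <= dl)%R] w))%:E)%E).
    by apply: int_le_eq => w; congr EFin; ring.
  rewrite (ge0_intZl lebV M0 mF); last first.
    by move=> w; rewrite !mulr_ge0 ?levy_ge0// levy_cut_ge0.
  by rewrite [X in (_ <= X)%E]EFinM; apply: lee_wpmul2l; rewrite ?lee_fin// small.
have := qst_psi_truncated dl01 mpsi psi01 psi0 x hA2.
by move=> /le_trans; apply; rewrite /Cq le_eqVlt; apply/orP; left; apply/eqP; ring.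
Qed.

(** Testing with the indicator of a small box around a point where [q] were negative. *)
Lemma fundsol_ge0_small (t : R) (x y : V) : 0 < t < t0 -> 0 <= q t x y.
Proof.
move=> /andP[tp tt0]; rewrite leNgt; apply/negP => qneg.
have q2 : q t x y < q t x y / 2 by rewrite ltr_pdivlMr// mulr_natr mulr2n gtrDl.
have cp := @q_continuous_at _ _ _ cq x (t, y) tp.
have qlt : nbhs ((t, y) : R * V) [set r : R * V | q r.1 x r.2 < q t x y / 2].
  exact: (cvgr_lt (q t x y) cp _ q2).
have [e /= e0 eP] := (nbhs_ballP _ _).1 qlt.
pose s := Num.min (e / 2) (Num.min (t / 2) ((t0 - t) / 2)).
have s0 : 0 < s by rewrite !lt_min !divr_gt0// subr_gt0.
have [se [st st0]] : s <= e / 2 /\ s <= t / 2 /\ s <= (t0 - t) / 2.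
  by rewrite /s !ge_min !lexx/= !orbT.
pose I : set (measurableTypeR R) := `[t - s, t + s]%classic.
pose u : V := y - const_mx s; pose v : V := y + const_mx s.
pose Bx := [set z : V | forall i, u ord0 i <= z ord0 i <= v ord0 i].
have mI : measurable I by exact: measurable_itv.
have mB : measurable Bx by exact: measurable_box.
have mIB : measurable (I `*` Bx) by exact: measurableX.
have uv i : v ord0 i - u ord0 i = s * 2 by rewrite !mxE; ring.
pose vol := s * 2 * (s * 2) ^+ d.
have volE : mst (I `*` Bx) = vol%:E.
  rewrite [LHS]product_measure1E// [X in (X * _)%E]lebesgue_measure_itv/= lte_fin ltrD2l gtrN// -EFinB.
  rewrite lebesgue_rV_box -?EFinM; last by move=> i; rewrite -subr_ge0 uv mulr_ge0// ltW.
  congr (_ * _)%:E; first by ring.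
  by rewrite (eq_bigr (fun=> s * 2)) ?prodr_const ?card_ord// => i _; exact: uv.
have vol0 : 0 < vol by rewrite mulr_gt0 ?exprn_gt0// mulr_gt0.
have inB (p : spacetime) : (I `*` Bx) p -> 0 < (p.1 : R) < t0 /\ q p.1 x p.2 < q t x y / 2.
  case: p => r z [/= rI zB]; move: rI; rewrite /I/= in_itv/= => /andP[r1 r2]; split.
    exact: (in_window r1 r2).
  apply: (eP (r, z)); split => /=.
    by rewrite /ball/= ltr_distlC; exact: (in_ball e0 se).
  split=> // i j; rewrite (ord1 i) /ball/= ltr_distlC; have := zB j; rewrite !mxE => /andP[z1 z2].
  exact: (in_ball e0 se).
have mi : measurable_fun setT (\1_(I `*` Bx) : spacetime -> R) by exact: measurable_indic.
have := @qst_psi_ge0 x (\1_(I `*` Bx)) mi.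
have i01 p : 0 <= (\1_(I `*` Bx) p : R) <= 1 by rewrite indicE; case: (_ \in _); rewrite ?lexx ?ler01.
have i0 (p : spacetime) : ~ (0 < (p.1 : R) < t0) -> \1_(I `*` Bx) p = 0 :> R.
  by move=> np; rewrite indicE memNset// => /inB[].
move=> /(_ i01 i0); apply/negP; rewrite -ltNge.
have iQ : rintegrable mst (qst q t0 x) := rintegrable_qst cq c10 c20 q_le x t0_gt0 t0_eps.
have iE : (\int[mst]_p (\1_(I `*` Bx) p)%:E = vol%:E)%E.
  by rewrite integral_indic// setIT; exact: volE.
have ib : rintegrable mst (\1_(I `*` Bx) : spacetime -> R).
  apply: rintegrableP => //; under eq_int do rewrite ger0_norm//.
  by rewrite iE ltry.
apply: (@le_lt_trans _ _ (q t x y / 2 * vol)); last by rewrite pmulr_llt0// pmulr_llt0// invr_gt0.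
have -> : q t x y / 2 * vol = \int[mst]_p (q t x y / 2 * \1_(I `*` Bx) p).
  rewrite (RintZl _ ib); congr (_ * _).
  by rewrite /Rintegral iE.
apply: le_Rint.
- by apply: (rintegrable_mulr iQ mi (c := 1)) => p; have /andP[? ?] := i01 p; rewrite ger0_norm.
- exact: rintegrableZl.
- move=> p; rewrite indicE; case: (boolP (_ \in _)) => [|_]; last by rewrite !mulr0.
  rewrite inE !mulr1 => /inB[p0 /ltW]; apply: le_trans.
  by rewrite /qst indicE mem_set ?mulr1//= in_itv.
Qed.

End nonnegative_jumps.

(** * Short-time averages of the heat and stable kernels *)

(** A bounded substitute for the square of the Euclidean norm. *)
Definition bump {R : realType} {d : nat} (u : 'rV[R]_d) : R := 1 - gaussV 1 u.

Section moments.
Context {R : realType} {d : nat}.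
Local Notation leb := (@lebesgue_measure R).
Local Notation V := 'rV[R]_d.
Local Notation lebV := (lebesgue_rV d).
#[local] Hint Extern 0 (is_true (0 <= gk _ _)) => solve [apply: gk_ge0] : core.
Implicit Types (s : R) (u : V).

Lemma bump_ge0 u : 0 <= bump u.
Proof. by rewrite subr_ge0 /gaussV expR_le1 oppr_le0 mul1r dotrV_ge0. Qed.

Lemma bump_le1 u : bump u <= 1.
Proof. by rewrite gerBl gaussV_ge0. Qed.

Lemma bump_le_dotrV u : bump u <= dotrV u u.
Proof.
rewrite /bump /gaussV mul1r lerBlDr -lerBlDl.
exact: expR_ge1Dx.
Qed.

Lemma le_bump (a : R) u : a <= dotrV u u -> 1 - expR (- a) <= bump u.
Proof. by move=> au; rewrite lerB// /gaussV mul1r ler_expR lerN2. Qed.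

Lemma measurable_bump d' (T : measurableType d') (f : T -> V) :
  measurable_fun setT f -> measurable_fun setT (fun t => bump (f t)).
Proof. by move=> mf; apply: measurable_funB => //; exact: measurable_gaussV. Qed.

Lemma gk_widen s u : 0 < s ->
  gk s u * expR (dotrV u u / (8 * s)) = Num.sqrt 2 ^+ d * gk (2 * s) u.
Proof.
move=> s0; have p0 : 0 < 4 * pi * s by rewrite !mulr_gt0// pi_gt0.
rewrite /gk /gaussV -[LHS]mulrA -expRD [RHS]mulrA; congr (_ * expR _).
  rewrite (_ : 4 * pi * (2 * s) = 2 * (4 * pi * s)); last by ring.
  rewrite [in RHS]sqrtrM// -!exprVn -exprMn; congr (_ ^+ _).
  by rewrite invfM mulrA divff ?mul1r// lt0r_neq0// sqrtr_gt0.
by have := lt0r_neq0 s0; move: (dotrV u u) => a s00; field; exact: s00.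
Qed.

Lemma exprn_le_expR (a : R) (k : nat) : 0 <= a -> a ^+ k <= k`!%:R * expR a.
Proof.
move=> a0; case: k => [|k]; first by rewrite expr0 fact0 mul1r -expR0 ler_expR.
rewrite mulrC -ler_pdivrMr ?ltr0n ?fact_gt0//.
by apply: le_trans (expR_ge1Dxn k a0); rewrite lerDr.
Qed.

(** The power is absorbed into a wider Gaussian, by [exprn_le_expR] and [gk_widen]. *)
Lemma int_gk_moment s (k : nat) (h : V -> R) (z : V) (C : R) : 0 < s -> 0 <= C ->
  measurable_fun setT h -> (forall u, 0 <= h u) ->
  (forall u, h u <= C * dotrV (z - u) (z - u) ^+ k) ->
  (\int[lebV]_u (gk s (z - u) * h u)%:E <= (C * k`!%:R * 8 ^+ k * Num.sqrt 2 ^+ d * s ^+ k)%:E)%E.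
Proof.
move=> s0 C0 mh h0 hC; pose c := C * k`!%:R * 8 ^+ k * Num.sqrt 2 ^+ d * s ^+ k.
have c0 : 0 <= c by rewrite !mulr_ge0 ?exprn_ge0 ?sqrtr_ge0// ltW.
have s2 : 0 < 2 * s by rewrite mulr_gt0.
have mz : measurable_fun setT (fun u : V => z - u).
  apply: measurable_addrV => //; exact: measurable_opprV.
apply: (@le_trans _ _ (\int[lebV]_u (c * gk (2 * s) (z - u))%:E)%E); last first.
  rewrite ge0_intZl//; first by rewrite int_gk_sub// mule1.
  exact: measurable_gk.
apply: ge0_le_int.
- by apply: measurable_funM => //; exact: measurable_gk.
- by apply: measurable_funM => //; exact: measurable_gk.
- by move=> u; rewrite mulr_ge0.
move=> u; set a := dotrV (z - u) (z - u) in hC *.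
have s8 : 0 < 8 * s by rewrite mulr_gt0.
have a0 : 0 <= a / (8 * s) by rewrite divr_ge0 ?dotrV_ge0// ltW.
have hE : h u <= C * k`!%:R * (8 * s) ^+ k * expR (a / (8 * s)).
  apply: le_trans (hC u) _; rewrite -!mulrA ler_wpM2l// mulrCA -/a.
  have -> : a ^+ k = (8 * s) ^+ k * (a / (8 * s)) ^+ k.
    by rewrite -exprMn mulrC divfK// lt0r_neq0.
  by rewrite ler_wpM2l ?exprn_ge0 ?(ltW s8)// exprn_le_expR.
apply: le_trans (ler_wpM2l (gk_ge0 s (z - u)) hE) _.
rewrite mulrCA gk_widen// /c exprMn.
by move: (k`!%:R) (gk _ _) (s ^+ k) => e f g; rewrite le_eqVlt; apply/orP; left; apply/eqP; ring.
Qed.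

End moments.

Section cylinders.
Context {R : realType} {d : nat}.
Local Notation leb := (@lebesgue_measure R).
Local Notation V := 'rV[R]_d.
Local Notation lebV := (lebesgue_rV d).
Local Notation spacetime := (@spacetime R d).
Local Notation mst := (@mst R d).
#[local] Hint Extern 0 (is_true (0 <= gk _ _)) => solve [apply: gk_ge0] : core.

Definition cyl (g : R -> R) (h : V -> R) (p : spacetime) : R := g (p.1 : R) * h p.2.

Lemma measurable_cyl g h : measurable_fun setT g -> measurable_fun setT h ->
  measurable_fun setT (cyl g h).
Proof.
move=> mg mh; have mt := measurableT_comp (@measurable_time R) (@measurable_fst _ _ (measurableTypeR R) V).
apply: measurable_funM; first exact: (measurableT_comp mg mt).
exact: (measurableT_comp mh measurable_snd).
Qed.

Lemma cyl_le g h (C B : R) p : (forall s, `|g s| <= C) -> (forall y, `|h y| <= B) ->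
  `|cyl g h p| <= C * B.
Proof. by move=> gC hB; rewrite normrM ler_pM. Qed.

Variable t0 : R.
Hypothesis t0_gt0 : 0 < t0.
Local Notation win := (\1_(`]0%R, t0[ : set R) : R -> R).

Variables (g : R -> R) (C : R).
Hypotheses (mg : measurable_fun setT g) (gC : forall s, `|g s| <= C).

Section slices.
Variables (h : V -> R) (B : R) (p : spacetime).
Hypotheses (mh : measurable_fun setT h) (hB : forall y, `|h y| <= B).

Let slice (s : R) : R := win (s - p.1) * g s * \int[lebV]_y (gk (s - p.1) (p.2 - y) * h y).

Let i := kop_rintegrable (measurable_heatk t0) (int_norm_heatk t0_gt0) p
  (measurable_cyl mg mh) (fun p' => cyl_le p' gC hB).

Let sliceE (s : R) : \int[lebV]_y (heatk t0 (p, (s, y)) * cyl g h (s, y)) = slice s.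
Proof.
rewrite /slice /heatk /window /lag /cyl /=.
rewrite indicE; case: (boolP (_ \in _)) => [|_]; last first.
  by rewrite !mul0r; transitivity (\int[lebV]_y (0 : R)); [apply: eq_Rint => y; rewrite mulr0 mul0r|rewrite /Rintegral integral0].
rewrite inE/= in_itv/= => /andP[sp _]; rewrite mul1r -RintZl; last first.
  apply: (rintegrable_mulr _ mh hB); apply: rintegrableP.
    apply: measurable_gk => //; apply: measurable_addrV => //; exact: measurable_opprV.
  under eq_int do rewrite ger0_norm//.
  by rewrite int_gk_sub// ltry.
by apply: eq_Rint => y; rewrite mulr1 mulrCA.
Qed.

Lemma rintegrable_heat_cyl : rintegrable leb (fun s : R =>
  win (s - p.1) * g s * \int[lebV]_y (gk (s - p.1) (p.2 - y) * h y)).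
Proof.
have := rintegrable_Rint i; apply: eq_integrable => // s _.
by congr EFin; rewrite [LHS]sliceE.
Qed.

Lemma kop_heat_cyl : kop mst (heatk t0) (cyl g h) p =
  \int[leb]_s (win (s - p.1) * g s * \int[lebV]_y (gk (s - p.1) (p.2 - y) * h y)).
Proof. by rewrite /kop (Rint_prod i); apply: eq_Rint => s; exact: sliceE. Qed.

End slices.

Lemma kop_heat_cyl_shift (h : V -> R) (B : R) (r : R) (z w : V) :
  measurable_fun setT h -> (forall y, `|h y| <= B) ->
  kop mst (heatk t0) (cyl g h) (r, z + w) = kop mst (heatk t0) (cyl g (fun y : V => h (y + w))) (r, z).
Proof.
move=> mh hB; have mhw : measurable_fun setT (fun y : V => h (y + w)).
  by apply: (measurableT_comp mh); exact: measurable_addrV.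
rewrite (kop_heat_cyl _ mh hB) (kop_heat_cyl _ mhw (fun y : V => hB (y + w))).
apply: eq_Rint => s /=; congr (_ * _).
rewrite -[LHS](Rint_shift w); last first.
  apply: measurable_funM => //; apply: measurable_gk => //; apply: measurable_addrV => //.
  exact: measurable_opprV.
by apply: eq_Rint => y; rewrite opprD addrACA subrr addr0.
Qed.

Lemma kop_heat_cyl_cst (p : spacetime) :
  kop mst (heatk t0) (cyl g (fun=> 1)) p = \int[leb]_s (win (s - p.1) * g s).
Proof.
rewrite (@kop_heat_cyl _ 1)//; last by move=> y; rewrite normr1.
apply: eq_Rint => s; rewrite indicE; case: (boolP (_ \in _)) => [|_]; last by rewrite !mul0r.
rewrite inE/= in_itv/= => /andP[sp _].
transitivity (1%:R * g s * \int[lebV]_y (gk (s - p.1) (p.2 - y))).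
  by congr (_ * _); apply: eq_Rint => y; rewrite mulr1.
by rewrite /Rintegral int_gk_sub//= mulr1.
Qed.

End cylinders.

Section cylinder_average.
Context {R : realType} {d : nat}.
Local Notation leb := (@lebesgue_measure R).
Local Notation V := 'rV[R]_d.
Local Notation lebV := (lebesgue_rV d).
Local Notation spacetime := (@spacetime R d).
Local Notation mst := (@mst R d).
Variable t0 : R.
Hypothesis t0_gt0 : 0 < t0.
Local Notation win := (\1_(`]0%R, t0[ : set R) : R -> R).

Let mwin : measurable_fun setT win. Proof. exact: measurable_indic. Qed.

Let win1 s : `|win s| <= 1.
Proof. by rewrite indicE; case: (_ \in _); rewrite ?normr1 ?normr0. Qed.

Lemma int_win_win (r : R) : 0 <= r < t0 ->
  (\int[leb]_s (win (s - r) * win s)%:E = (t0 - r)%:E)%E.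
Proof.
move=> /andP[r0 rt].
have mF : measurable_fun setT (fun s : R => win (s - r) * win s).
  apply: measurable_funM => //; apply: (measurableT_comp mwin).
  exact: (measurable_funB (@measurable_id _ _ setT) (measurable_cst r)).
transitivity (\int[leb]_s (1 * \1_(`]r, t0[ : set R) s : R)%:E)%E.
  apply: eq_int => s; rewrite mul1r !indicE; congr EFin; rewrite -natrM mulnb; congr (nat_of_bool _)%:R.
  apply/idP/idP => [/andP[/set_mem/= + /set_mem/= +]|/set_mem/= +]; rewrite ?in_itv/=.
    by move=> /andP[a _] /andP[_ c]; apply/mem_set; rewrite /= in_itv/= -subr_gt0 a.
  move=> /andP[a c]; apply/andP; split; apply/mem_set; rewrite /= in_itv/=.
    by rewrite subr_gt0 a ltrBlDr (lt_le_trans c)// lerDl.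
  by rewrite (le_lt_trans r0 a).
rewrite (int_indic_itv (f := fun=> 1) r t0 (measurable_cst _)).
rewrite integral_cst//= mul1e lebesgue_measure_itv/= lte_fin rt -EFinB.
by [].
Qed.

Lemma kop_heat_cyl_le (h : V -> R) (B c r : R) (z : V) : 0 <= r < t0 ->
  measurable_fun setT h -> (forall y, `|h y| <= B) ->
  (forall s, 0 < s < t0 -> \int[lebV]_y (gk s (z - y) * h y) <= c) ->
  kop mst (heatk t0) (cyl win h) (r, z) <= c * (t0 - r).
Proof.
move=> rt mh hB hc; rewrite (kop_heat_cyl t0_gt0 mwin win1 (r, z) mh hB) /=.
have mF : measurable_fun setT (fun s : R => win (s - r) * win s).
  apply: measurable_funM => //; apply: (measurableT_comp mwin).
  exact: (measurable_funB (@measurable_id _ _ setT) (measurable_cst r)).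
have w0 (s : R) : 0 <= win (s - r) * win s by rewrite mulr_ge0.
have iw : rintegrable leb (fun s : R => win (s - r) * win s).
  apply: rintegrableP => //; under eq_int do rewrite ger0_norm//.
  by rewrite int_win_win// ltry.
have -> : c * (t0 - r) = \int[leb]_s (c * (win (s - r) * win s)).
  by rewrite (RintZl _ iw) /Rintegral int_win_win.
apply: le_Rint.
- exact: (rintegrable_heat_cyl t0_gt0 mwin win1 (r, z) mh hB).
- exact: rintegrableZl.
- move=> s; rewrite mulrC; have [->|w1] := eqVneq (win (s - r)) 0; first by rewrite mul0r !mulr0.
  rewrite [leRHS]mulrC [leLHS]mulrC; apply: ler_wpM2l => //; apply: hc.
  by move: w1; rewrite indicE; case: (boolP (_ \in _)); rewrite ?eqxx// inE/= in_itv.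
Qed.

End cylinder_average.

(** * The jump intensity seen from a point *)

Section jump_average.
Context {R : realType} {d : nat}.
Local Notation leb := (@lebesgue_measure R).
Local Notation V := 'rV[R]_d.
Local Notation lebV := (lebesgue_rV d).
Local Notation spacetime := (@spacetime R d).
Local Notation mst := (@mst R d).

Variables (beta : R) (b : V -> V -> R) (M : R).
Hypotheses (d_ge1 : (1 <= d)%N) (beta_gt0 : 0 < beta) (beta_lt2 : beta < 2).
Hypothesis mb : measurable_fun [set: V * V] (fun p : V * V => b p.1 p.2).
Hypothesis bM : forall x z, `|b x z| <= M.
Hypothesis b_sym : forall x z, b x z = b x (- z).
Hypothesis b_cont : {ae lebV, forall z, continuous (fun x => b x z)}.

Variables (f : V -> R) (B C : R) (x0 : V).
Hypothesis mf : measurable_fun setT f.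
Hypothesis cf : continuous f.
Hypothesis f_ge0 : forall y, 0 <= f y.
Hypothesis fB : forall y, f y <= B.
Hypothesis fx0 : f x0 = 0.
Hypothesis fD2 : forall v w, `|f (v + w) + f (v - w) - 2 * f v| <= C * levy_cut beta w.

Local Notation J := (jump beta b).
Let mJ := measurable_jump beta mb.
Let M0 : 0 <= M := le_trans (normr_ge0 _) (bM 0 0).
Let fB' y : `|f y| <= B. Proof. by rewrite ger0_norm. Qed.

Let C0 : 0 <= C.
Proof.
(* The weight [levy_cut] is positive at nonzero vectors. *)
have h0 := le_trans (normr_ge0 _) (fD2 0 (const_mx 1)).
have : 0 < levy_cut beta (const_mx 1 : V).
  rewrite lt_min ltr01 powR_gt0// enorm_gt0.
  case: d d_ge1 => [//|n _]; apply/eqP => /matrixP/(_ ord0 ord0); rewrite !mxE.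
  by apply/eqP; rewrite oner_eq0.
by move=> l0; move: h0; rewrite pmulr_lge0.
Qed.

Let D2 (v w : V) : R := f (v + w) + f (v - w) - 2 * f v.
(** The nonlocal operator applied to [f] at [v], with the jump intensity frozen at [z]. *)
Definition jump_diff (z v : V) : R := 2^-1 * \int[lebV]_w (J z w * D2 v w).
Local Notation G := jump_diff.

Let weight (w : V) : R := C * M * (levy_cut beta w * levy beta w).

Let rintegrable_weight : rintegrable lebV weight.
Proof. apply: rintegrableZl; exact: rintegrable_levy. Qed.

Let weight_ge0 w : 0 <= weight w.
Proof. by rewrite !mulr_ge0 ?levy_cut_ge0 ?levy_ge0. Qed.

Let JD2_le z v w : `|J z w * D2 v w| <= weight w.
Proof.
rewrite normrM /weight.
apply: (@le_trans _ _ (M * levy beta w * (C * levy_cut beta w))).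
  by apply: ler_pM => //; [exact: jump_le|exact: fD2].
by rewrite le_eqVlt; apply/orP; left; apply/eqP; ring.
Qed.

Let measurable_D2 : measurable_fun setT (fun p : V * V => D2 p.1 p.2).
Proof.
apply: measurable_funB; first apply: measurable_funD.
- by apply: (measurableT_comp mf); exact: measurable_addrV.
- apply: (measurableT_comp mf); apply: measurable_addrV => //; exact: measurable_opprV.
- by apply: measurable_funM => //; exact: (measurableT_comp mf).
Qed.

Let measurable_JD2 z : measurable_fun setT (fun p : V * V => J z p.2 * D2 p.1 p.2).
Proof.
apply: measurable_funM => //; exact: (measurableT_comp (measurable_section1 z mJ) measurable_snd).
Qed.

Lemma measurable_jump_diff z : measurable_fun setT (G z).
Proof. by apply: measurable_funM => //; exact: (measurable_Rint lebV (measurable_JD2 z)). Qed.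

Let CG : R := 2^-1 * \int[lebV]_w weight w.

Lemma jump_diff_le z v : `|G z v| <= CG.
Proof.
have mz : measurable_fun setT (fun w : V => J z w * D2 v w) := measurable_section1 v (measurable_JD2 z).
rewrite /jump_diff normrM ger0_norm// ler_wpM2l//; apply: Rint_norm_le => //.
rewrite (EFin_Rint rintegrable_weight); apply: ge0_le_int => //.
- exact: measurableT_comp.
- exact: rintegrable_measurable rintegrable_weight.
Qed.

Definition jump_mean : R := \int[lebV]_w (J x0 w * f (x0 + w)).

Lemma rintegrable_jump_mean : rintegrable lebV (fun w : V => J x0 w * f (x0 + w)).
Proof.
have mfx : measurable_fun setT (fun w : V => f (x0 + w)).
  by apply: (measurableT_comp mf); exact: measurable_addrV.
apply: (@rintegrable_dominated _ _ _ lebV _ _ _ rintegrable_weight).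
  by apply: measurable_funM => //; exact: (measurable_section1 x0 mJ).
move=> w; apply: le_trans (JD2_le x0 x0 w); rewrite !normrM ler_wpM2l//.
rewrite /D2 fx0 mulr0 subr0 !ger0_norm ?addr_ge0//.
by rewrite lerDl.
Qed.

Let JN z w : J z (- w) = J z w.
Proof. by rewrite /jump -b_sym /levy enormN. Qed.

Lemma jump_diff_center : G x0 x0 = jump_mean.
Proof.
have i1 := rintegrable_jump_mean.
have m1 := rintegrable_measurable i1.
have eqN : \int[lebV]_w (J x0 w * f (x0 - w)) = jump_mean.
  by rewrite /jump_mean -[RHS](Rint_opp m1); apply: eq_Rint => w; rewrite JN.
have i2 : rintegrable lebV (fun w : V => J x0 w * f (x0 - w)).
  have mfx : measurable_fun setT (fun w : V => f (x0 - w)).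
    apply: (measurableT_comp mf); apply: measurable_addrV => //; exact: measurable_opprV.
  apply: (@rintegrable_dominated _ _ _ lebV _ _ _ rintegrable_weight).
    by apply: measurable_funM => //; exact: (measurable_section1 x0 mJ).
  move=> w; apply: le_trans (JD2_le x0 x0 w); rewrite !normrM ler_wpM2l//.
  rewrite /D2 fx0 mulr0 subr0 !ger0_norm ?addr_ge0//.
  by rewrite lerDr.
rewrite /jump_diff.
transitivity (2^-1 * (\int[lebV]_w (J x0 w * f (x0 + w) + J x0 w * f (x0 - w)))).
  by congr (_ * _); apply: eq_Rint => w; rewrite /D2 fx0 mulr0 subr0 mulrDr.
rewrite (RintD i1 i2) eqN -/jump_mean.
by move: jump_mean => a; field.
Qed.

(** Otherwise dominated convergence along a sequence of counterexamples contradicts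
    [jump_diff_center]. *)
Lemma jump_diff_near (e : R) : 0 < e -> exists2 rho : R, 0 < rho &
  forall z v, `|z - x0| < rho -> `|v - x0| < rho -> G z v <= jump_mean + e.
Proof.
move=> e0; apply: contrapT => H.
have /choice[zv zvP] : forall n, exists p : V * V,
    [/\ `|p.1 - x0| < n.+1%:R^-1, `|p.2 - x0| < n.+1%:R^-1 & jump_mean + e < G p.1 p.2].
  move=> n; apply: contrapT => Hn; apply: H; exists n.+1%:R^-1; first by rewrite invr_gt0.
  move=> z v zx vx; rewrite leNgt; apply/negP => lt; apply: Hn; by exists (z, v).
have to0 (u : nat -> V) : (forall n, `|u n - x0| < n.+1%:R^-1) -> u n @[n --> \oo] --> x0.
  move=> ux; apply/cvgrPdist_lt => eps eps0.
  have := @cvg_harmonic R; move/cvgrPdist_lt => /(_ _ eps0); apply: filterS => n.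
  rewrite sub0r normrN ger0_norm ?invr_ge0// => h; rewrite distrC.
  exact: lt_trans (ux n) h.
have cz : (zv n).1 @[n --> \oo] --> x0 by apply: to0 => n; have [] := zvP n.
have cv : (zv n).2 @[n --> \oo] --> x0 by apply: to0 => n; have [] := zvP n.
have cfu (u : nat -> V) (l : V) : u n @[n --> \oo] --> l -> f (u n) @[n --> \oo] --> f l.
  by move=> ul; apply: continuous_cvg => //; exact: cf.
have cG : G (zv n).1 (zv n).2 @[n --> \oo] --> G x0 x0.
  apply: cvgM; first exact: cvg_cst.
  apply: (Rint_cvg (g := weight)) => //.
  - by move=> n; exact: (measurable_section1 (zv n).2 (measurable_JD2 (zv n).1)).
  - exact: (measurable_section1 x0 (measurable_JD2 x0)).
  - apply: filterS b_cont => w bw; apply: cvgM.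
      apply: cvgM; last exact: cvg_cst.
      exact: (cvg_comp _ _ cz (bw x0)).
    apply: cvgB; first apply: cvgD.
    + have cvw : (zv n).2 + w @[n --> \oo] --> x0 + w by apply: cvgD => //; exact: cvg_cst.
      exact: cfu cvw.
    + have cvw : (zv n).2 - w @[n --> \oo] --> x0 - w by apply: cvgB => //; exact: cvg_cst.
      exact: cfu cvw.
    + apply: cvgM; first exact: cvg_cst.
      exact: cfu cv.
have : jump_mean + e <= G x0 x0.
  rewrite -(cvg_lim (@Rhausdorff R) cG); apply: limr_ge; first by apply/cvg_ex; exists (G x0 x0).
  by apply: nearW => n; have [_ _ /ltW] := zvP n.
by apply/negP; rewrite jump_diff_center -ltNge ltrDl.
Qed.

(** Either both points are close to [x0], where [jump_diff_near] applies, or one of the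
    two bumps is bounded below and dominates the bound of [jump_diff_le]. *)
Lemma jump_diff_bump (e : R) : 0 < e -> exists2 C1 : R, 0 <= C1 &
  forall z v, G z v <= jump_mean + e + C1 * (bump (z - x0) + bump (z - v)).
Proof.
move=> e0; have [rho rho0 near] := jump_diff_near e0.
pose r := rho / 2; have r0 : 0 < r by rewrite divr_gt0.
pose k := 1 - expR (- r ^+ 2).
have k0 : 0 < k by rewrite subr_gt0 expR_lt1 oppr_lt0 exprn_gt0.
have CG0 : 0 <= CG := le_trans (normr_ge0 _) (jump_diff_le 0 0).
have c0 : 0 <= CG + `|jump_mean + e| by rewrite addr_ge0.
exists ((CG + `|jump_mean + e|) / k); first by rewrite divr_ge0// ltW.
have far (u : V) : r <= `|u| -> k <= bump u.
  move=> ru; apply: le_bump; rewrite -enorm_sqr ler_sqr ?nnegrE ?enorm_ge0 ?(ltW r0)//.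
  exact: le_trans ru (norm_le_enorm u).
have big z v : k <= bump (z - x0) + bump (z - v) ->
    G z v <= jump_mean + e + (CG + `|jump_mean + e|) / k * (bump (z - x0) + bump (z - v)).
  move=> kb; apply: le_trans (ler_norm _) _; apply: le_trans (jump_diff_le z v) _.
  rewrite -mulrAC -lerBlDl ler_pdivlMr//.
  apply: le_trans (_ : (CG + `|jump_mean + e|) * k <= _); last by rewrite ler_wpM2l.
  by rewrite ler_wpM2r ?(ltW k0)// lerD2l -normrN ler_norm.
move=> z v; have [zr|/far kz] := ltP `|z - x0| r; last first.
  by apply: big; rewrite (le_trans kz)// lerDl bump_ge0.
have [vr|/far kv] := ltP `|z - v| r; last first.
  by apply: big; rewrite (le_trans kv)// lerDr bump_ge0.
have r2 : rho = r + r by rewrite /r; field.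
apply: (@le_trans _ _ (jump_mean + e)); last first.
  by rewrite lerDl mulr_ge0 ?divr_ge0 ?(ltW k0)// addr_ge0// bump_ge0.
apply: near; first by rewrite r2 (lt_trans zr)// ltrDl.
rewrite (_ : v - x0 = (z - x0) - (z - v)); last by rewrite opprB [RHS]addrC addrA subrK.
by rewrite r2 (le_lt_trans (ler_normB _ _))// ltrD.
Qed.

Section stk_cyl.
Variables (t0 tau : R).
Hypotheses (t0_gt0 : 0 < t0) (t0_le1 : t0 <= 1).
Hypothesis tauP : (\int[leb]_s ((s `^ theta beta)^-1 * \1_(`]0%R, t0[ : set R) s)%:E <= tau%:E)%E.
Local Notation win := (\1_(`]0%R, t0[ : set R) : R -> R).

Let mwin : measurable_fun setT win. Proof. exact: measurable_indic. Qed.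

Let win1 s : `|win s| <= 1.
Proof. by rewrite indicE; case: (_ \in _); rewrite ?normr1 ?normr0. Qed.

(** On functions constant in time, the nonlocal operator may act before the heat
    semigroup, provided that [z] is frozen in the jump kernel. *)
Lemma kop_stk_cyl (r : R) (z : V) :
  kop mst (stk t0 J) (cyl win f) (r, z) = kop mst (heatk t0) (cyl win (G z)) (r, z).
Proof.
have mh : measurable_fun setT (fun w : V => M * levy beta w).
  by apply: measurable_funM => //; exact: measurable_levy.
have hA := int_jump_weight d_ge1 beta_gt0 beta_lt2 bM.
have mheat := @measurable_heatk R d t0.
have iheat := int_norm_heatk (d := d) t0_gt0.
have cB (p : spacetime) : `|cyl win f p| <= B by rewrite -[B]mul1r; exact: cyl_le.
rewrite (kop_stk beta_gt0 beta_lt2 t0_gt0 t0_le1 tauP mJ mh (jump_le beta bM) hA (r, z)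
  (measurable_cyl mwin mf) cB) /=.
pose p0 : spacetime := (r, z).
pose F (p : V * spacetime) : R := J z p.1 * (heatk t0 (p0, p.2) * (win p.2.1 * D2 p.2.2 p.1)).
have mF : measurable_fun setT F.
  apply: measurable_funM; first exact: (measurableT_comp (measurable_section1 z mJ) measurable_fst).
  apply: measurable_funM.
    exact: (measurableT_comp (measurable_section1 p0 mheat) measurable_snd).
  apply: measurable_funM.
    apply: (measurableT_comp mwin); apply: (measurableT_comp (@measurable_time R)).
    exact: (measurableT_comp measurable_fst measurable_snd).
  apply: (measurableT_comp measurable_D2 (g := fun p : V * spacetime => (p.2.2, p.1))).
  apply: measurable_fun_pair; last exact: measurable_fst.
  exact: (measurableT_comp measurable_snd measurable_snd).
have Fle (w : V) (p : spacetime) : `|F (w, p)| <= weight w * heatk t0 (p0, p).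
  rewrite /F /= mulrCA normrM (ger0_norm (heatk_ge0 _ _)) mulrC ler_wpM2r ?heatk_ge0//.
  rewrite mulrCA normrM; apply: le_trans (ler_wpM2r (normr_ge0 _) (win1 _)) _.
  by rewrite mul1r JD2_le.
have iF : rintegrable (prodm lebV mst) F.
  apply: rintegrable_prodP => //.
  apply: (@le_lt_trans _ _ (\int[lebV]_w (t0 * weight w)%:E)%E).
    apply: ge0_le_integral => //.
    - by move=> w _; apply: integral_ge0 => p _; rewrite lee_fin.
    - by apply: (@measurable_int R _ _ V spacetime mst (fun p => `|F p|)) => //; exact: measurableT_comp.
    - by apply: measurable_EFinW; apply: measurable_funM => //; exact: rintegrable_measurable rintegrable_weight.
    move=> w _; have mFw : measurable_fun setT (fun p => F (w, p)) by exact: (measurable_section1 w mF).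
    apply: (@le_trans _ _ (\int[mst]_p (weight w * heatk t0 (p0, p))%:E)%E).
      apply: ge0_le_int => //; first exact: measurableT_comp.
      by apply: measurable_funM => //; exact: (measurable_section1 p0 mheat).
    rewrite (ge0_intZl mst (weight_ge0 w) (measurable_section1 p0 mheat)); last first.
      by move=> p; exact: heatk_ge0.
    by rewrite int_heatk// mulrC.
  rewrite -(EFin_Rint (rintegrableZl t0 rintegrable_weight)); exact: ltry.
transitivity (2^-1 * \int[lebV]_w \int[mst]_p F (w, p)).
  congr (_ * _); apply: eq_Rint => w.
  have mfw (a : V) : measurable_fun setT (fun y : V => f (y + a)).
    by apply: (measurableT_comp mf); exact: measurable_addrV.
  have ik (g : V -> R) : measurable_fun setT g -> (forall y, `|g y| <= B) ->
      rintegrable mst (fun p => heatk t0 (p0, p) * cyl win g p).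
    move=> mg gB; apply: (kop_rintegrable mheat iheat p0 (measurable_cyl mwin mg) (B := B)).
    by move=> p; rewrite -[B]mul1r; exact: cyl_le.
  have i1 := ik _ (mfw w) (fun y : V => fB' _).
  have i2 := ik _ (mfw (- w)) (fun y : V => fB' _).
  have i3 := ik _ mf fB'.
  rewrite (kop_heat_cyl_shift t0_gt0 mwin win1 r z w mf fB').
  rewrite (kop_heat_cyl_shift t0_gt0 mwin win1 r z (- w) mf fB').
  rewrite /kop -/p0 -(RintD i1 i2) -(RintZl 2 i3) -(RintB (rintegrableD i1 i2) (rintegrableZl 2 i3)).
  rewrite -RintZl; last exact: (rintegrableB (rintegrableD i1 i2) (rintegrableZl 2 i3)).
  apply: eq_Rint => p; rewrite /F /cyl /D2 /=.
  by move: (heatk _ _) (J z w) (win _) (f _) (f _) (f _) => a e g x y t; ring.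
rewrite (Rint_swap iF) -RintZl; last exact: (rintegrable_Rint_swap iF).
apply: eq_Rint => p; rewrite /cyl /jump_diff -/p0.
have iJD : rintegrable lebV (fun w : V => J z w * D2 p.2 w).
  apply: (@rintegrable_dominated _ _ _ lebV _ _ _ rintegrable_weight).
    exact: (measurable_section1 p.2 (measurable_JD2 z)).
  by move=> w; exact: JD2_le.
transitivity (2^-1 * \int[lebV]_w (heatk t0 (p0, p) * win p.1 * (J z w * D2 p.2 w))).
  congr (_ * _); apply: eq_Rint => w; rewrite /F /=.
  by move: (heatk _ _) (J z w) (win _) (D2 _ _) => a e g x; ring.
rewrite (RintZl _ iJD).
by move: (heatk _ _) (win _) (\int[lebV]_w _) => a e g; ring.
Qed.

End stk_cyl.
End jump_average.

(** * Short-time balance at a zero of order four *)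

Lemma bumpN {R : realType} {d : nat} (u : 'rV[R]_d) : bump (- u) = bump u.
Proof. by rewrite /bump /gaussV dotrVNl dotrVNr opprK. Qed.

Lemma stable_kernel_bump {R : realType} (d : nat) (beta c : R) : 0 < beta -> beta <= 2 -> 0 < c ->
  exists2 C : R, 0 <= C & forall t : R, 0 < t ->
    (forall u : 'rV[R]_d, 0 <= stable_kernel beta t (c *: u)) ->
    (\int[lebesgue_rV d]_u (stable_kernel beta t (c *: u) * bump u)%:E <= (C * t)%:E)%E.
Proof.
move=> b0 b2 c0.
suff [C CP] : exists C : R, forall t : R, 0 < t ->
    (forall u : 'rV[R]_d, 0 <= stable_kernel beta t (c *: u)) ->
    (\int[lebesgue_rV d]_u (stable_kernel beta t (c *: u) * bump u)%:E <= (C * t)%:E)%E.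
  exists `|C| => // t t0 sk0; apply: le_trans (CP t t0 sk0) _.
  by rewrite lee_fin ler_wpM2r ?(ltW t0)// ler_norm.
by eexists => t t0 sk0; exact: (int_stable_kernel_tail b0 b2 t0 c0 sk0 ltr01).
Qed.

Lemma le0_of_small {R : realFieldType} (a K m : R) : 0 < m -> 0 <= K ->
  (forall t, 0 < t <= m -> a <= K * t) -> a <= 0.
Proof.
move=> m0 K0 h; rewrite leNgt; apply/negP => a0.
have K1 : 0 < K + 1 by rewrite ltr_wpDl.
pose t := Num.min m (a / (2 * (K + 1))).
have t0 : 0 < t by rewrite lt_min m0 divr_gt0// mulr_gt0.
have := h t; rewrite t0 /t ge_min lexx => /(_ isT); rewrite leNgt => /negP; apply.
apply: (@le_lt_trans _ _ (K * (a / (2 * (K + 1))))).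
  by rewrite ler_wpM2l// ge_min lexx orbT.
rewrite mulrA ltr_pdivrMr ?mulr_gt0//.
have := mulr_ge0 K0 (ltW a0); have := a0; clear; lra.
Qed.

Lemma half_balance {R : realFieldType} (l e x : R) : 0 <= (l + e) / 2 + x -> - l - e <= 2 * x.
Proof. lra. Qed.

Section short_time.
Context {R : realType} {d : nat}.
Local Notation leb := (@lebesgue_measure R).
Local Notation V := 'rV[R]_d.
Local Notation lebV := (lebesgue_rV d).
Local Notation spacetime := (@spacetime R d).
Local Notation mst := (@mst R d).
#[local] Hint Extern 0 (is_true (0 <= gk _ _)) => solve [apply: gk_ge0] : core.

Variables (beta : R) (b : V -> V -> R) (q : R -> V -> V -> R) (M eps c1 c2 : R).
Hypotheses (d_ge1 : (1 <= d)%N) (beta_gt0 : 0 < beta) (beta_lt2 : beta < 2).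
Hypothesis mb : measurable_fun [set: V * V] (fun p : V * V => b p.1 p.2).
Hypothesis bM : forall x z, `|b x z| <= M.
Hypothesis b_sym : forall x z, b x z = b x (- z).
Hypothesis b_cont : {ae lebV, forall z, continuous (fun x => b x z)}.
Hypothesis cq : {within [set p : R * V * V | 0 < p.1.1],
      continuous (fun p => q p.1.1 p.1.2 p.2)}.
Hypotheses (eps0 : 0 < eps) (c10 : 0 < c1) (c20 : 0 < c2).
Hypothesis q_le : forall (t : R) x y, 0 < t <= eps ->
  `|q t x y| <= c1 * heat_kernel beta 1 t (c2 *: x) (c2 *: y).
Hypothesis q_duhamel : forall (t : R) x y, 0 < t <= eps ->
  q t x y = heat_kernel beta 0 t x y +
          \int[lebesgue_measure]_(s in `]0, t[)
            \int[lebesgue_rV d]_z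
              (q (t - s) x z *
               nonlocal_op beta b (fun w => heat_kernel beta 0 s w y) z).
Hypothesis q_ge0 : forall (t : R) x y, 0 < t -> 0 <= q t x y.

Variables (f : V -> R) (B C C4 : R) (x0 : V).
Hypothesis mf : measurable_fun setT f.
Hypothesis cf : continuous f.
Hypothesis f_ge0 : forall y, 0 <= f y.
Hypothesis fB : forall y, f y <= B.
Hypothesis fx0 : f x0 = 0.
Hypothesis fD2 : forall v w, `|f (v + w) + f (v - w) - 2 * f v| <= C * levy_cut beta w.
Hypothesis C40 : 0 <= C4.
Hypothesis f4 : forall y, f y <= C4 * dotrV (x0 - y) (x0 - y) ^+ 2.

Let mJ := measurable_jump beta mb.
Let L := jump_mean beta b f x0.
Let fB' y : `|f y| <= B. Proof. by rewrite ger0_norm. Qed.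

Section window.
Variables (t0 tau : R).
Hypotheses (t0_gt0 : 0 < t0) (t0_le1 : t0 <= 1) (t0_eps : t0 <= eps).
Hypothesis tauP : (\int[leb]_s ((s `^ theta beta)^-1 * \1_(`]0%R, t0[ : set R) s)%:E <= tau%:E)%E.
Local Notation win := (\1_(`]0%R, t0[ : set R) : R -> R).
Local Notation Q := (qst q t0 x0).

Let mwin : measurable_fun setT win. Proof. exact: measurable_indic. Qed.

Let win1 s : `|win s| <= 1.
Proof. by rewrite indicE; case: (_ \in _); rewrite ?normr1 ?normr0. Qed.

Let win_out (s : R) : ~ (0 < s < t0) -> win s = 0.
Proof. by move=> s0; rewrite indicE memNset//= in_itv. Qed.

Let iQ : rintegrable mst Q := rintegrable_qst cq c10 c20 q_le x0 t0_gt0 t0_eps.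

Let Q_ge0 p : 0 <= Q p.
Proof.
rewrite /qst; have [p0|p0] := pselect (0 < (p.1 : R) < t0); last by rewrite win_out ?mulr0.
by rewrite mulr_ge0// q_ge0//; case/andP: p0.
Qed.

Let master (phi : spacetime -> R) (A : R) : measurable_fun setT phi ->
  (forall p, `|phi p| <= A) -> (forall p, ~ (0 < (p.1 : R) < t0) -> phi p = 0) ->
  \int[mst]_p (Q p * phi p) = kop mst (heatk t0) phi (0, x0) +
    \int[mst]_p (Q p * kop mst (stk t0 (jump beta b)) phi p).
Proof.
exact: (int_qst_duhamel d_ge1 beta_gt0 beta_lt2 mb bM b_sym cq c10 c20 q_le q_duhamel
    x0 t0_gt0 t0_le1 t0_eps tauP).
Qed.

Let left (s : R) : R := (t0 - s) * win s.

Let mleft : measurable_fun setT left.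
Proof. by apply: measurable_funM => //; apply: measurable_funB. Qed.

Let left_le s : `|left s| <= t0.
Proof.
have [/andP[s0 st]|s0] := pselect (0 < s < t0); last by rewrite /left win_out// mulr0 normr0 ltW.
rewrite /left normrM (le_trans (ler_pM _ _ (lexx _) (win1 s)))// mulr1 ger0_norm ?subr_ge0 ?ltW//.
by rewrite gtrBl.
Qed.

Let cyl_left_le (p : spacetime) : `|cyl left (fun=> 1) p| <= t0.
Proof. by rewrite -[t0]mulr1; apply: cyl_le => // y; rewrite normr1. Qed.

(** The operator does not see functions that are constant in space, hence the total mass
    of [q], averaged in time, is that of the heat kernel. *)
Lemma int_qst_left : \int[mst]_p (Q p * cyl left (fun=> 1) p) = t0 ^+ 2 / 2.
Proof.
have mc : measurable_fun setT (cyl left (fun=> 1) : spacetime -> R).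
  by apply: measurable_cyl => //; exact: measurable_cst.
rewrite (master mc cyl_left_le); last by move=> p p0; rewrite /cyl /left win_out// mulr0 mul0r.
have mh : measurable_fun setT (fun w : V => M * levy beta w).
  by apply: measurable_funM => //; exact: measurable_levy.
have hA := int_jump_weight d_ge1 beta_gt0 beta_lt2 bM.
have -> : \int[mst]_p (Q p * kop mst (stk t0 (jump beta b)) (cyl left (fun=> 1)) p) = 0.
  transitivity (\int[mst]_p (0 : R)); last by rewrite /Rintegral integral0.
  apply: eq_Rint => p.
  rewrite (kop_stk beta_gt0 beta_lt2 t0_gt0 t0_le1 tauP mJ mh (jump_le beta bM) hA p mc cyl_left_le).
  rewrite (_ : \int[lebV]_w _ = 0) ?mulr0//.
  transitivity (\int[lebV]_w (0 : R)); last by rewrite /Rintegral integral0.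
  apply: eq_Rint => w; rewrite !(kop_heat_cyl_cst t0_gt0 mleft left_le) /=.
  by rewrite (_ : _ + _ - _ = 0) ?mulr0//; move: (Rintegral _ _ _) => a; ring.
rewrite addr0 (kop_heat_cyl_cst t0_gt0 mleft left_le) /=.
pose F (s : R) : R := t0 * s - s ^+ 2 / 2.
have dF (s : R) : is_derive s 1 F (t0 - s).
  by apply: is_derive_eq; rewrite /= /GRing.scale/=; field.
have cF : continuous (fun s : R => t0 - s) by move=> s; apply: cvgB; [exact: cvg_cst|exact: cvg_id].
transitivity (fine (\int[leb]_s ((t0 - s) * win s)%:E)%E).
  congr fine; apply: eq_int => s; rewrite subr0 /left mulrCA; congr EFin; congr (_ * _).
  by rewrite indicE; case: (_ \in _); rewrite ?mulr1 ?mulr0.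
rewrite (int_indic_itv _ _ (continuous_measurable_fun cF)).
by rewrite (integral_derivative_segment (ltW t0_gt0) dF cF) /F /=; field.
Qed.

Variable Cb : R.
Hypothesis Cb0 : 0 <= Cb.
Hypothesis CbP : forall t : R, 0 < t ->
    (forall u : V, 0 <= stable_kernel beta t (c2 *: u)) ->
    (\int[lebV]_u (stable_kernel beta t (c2 *: u) * bump u)%:E <= (Cb * t)%:E)%E.

Let bumpx (p : spacetime) : R := bump (p.2 - x0).

Let mbumpx : measurable_fun setT bumpx.
Proof. apply: measurable_bump; apply: measurable_addrV => //; exact: measurable_snd. Qed.

Let bumpx_le p : `|bumpx p| <= 1.
Proof. by rewrite ger0_norm ?bump_ge0 ?bump_le1. Qed.

Lemma int_qst_bump : \int[mst]_p (Q p * bumpx p) <= c1 * Cb * t0 * t0.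
Proof.
have mQ : measurable_fun setT Q := rintegrable_measurable iQ.
have mQb : measurable_fun setT (fun p => Q p * bumpx p) by exact: measurable_funM.
apply: le_trans (ler_norm _) _; apply: Rint_norm_le => //.
have mn : measurable_fun setT (fun p => `|Q p * bumpx p|) by exact: measurableT_comp.
rewrite (ge0_int_prod leb lebV mn)//.
have K0 : 0 <= c1 * Cb * t0 by rewrite !mulr_ge0// ltW.
apply: (@le_trans _ _ (\int[leb]_r (c1 * Cb * t0 * win r)%:E)%E); last first.
  rewrite ge0_intZl// EFinM integral_indic//= setIT lebesgue_measure_itv/= lte_fin t0_gt0.
  by rewrite oppr0 adde0.
apply: ge0_le_integral => //.
- by move=> r _; apply: integral_ge0 => z _; rewrite lee_fin.
- exact: (measurable_int lebV mn).
- have mc : measurable_fun setT (fun r : R => c1 * Cb * t0 * win r) by exact: measurable_funM.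
  exact: (measurable_EFinW mc).
move=> r _; have [r0t|r0] := pselect (0 < (r : R) < t0); last first.
  by rewrite /qst /= win_out//; under eq_int do rewrite mulr0 mul0r normr0; rewrite integral0 mulr0.
have /andP[r0 rt] := r0t.
have winr : win r = 1 by rewrite indicE mem_set//= in_itv.
have re : 0 < r <= eps by rewrite r0 (le_trans (ltW rt)).
have sk0 (u : V) : 0 <= stable_kernel beta r (c2 *: u) := stable_kernel_ge0 c10 q_le u re.
have msk : measurable_fun setT (fun u : V => stable_kernel beta r (c2 *: u) * bump u).
  apply: measurable_funM; last exact: measurable_bump.
  by apply: (measurableT_comp (measurable_stable_kernel beta r)); exact: measurable_scalerV.
have mskx : measurable_fun setT (fun z : V => stable_kernel beta r (c2 *: (x0 - z)) * bump (x0 - z)).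
  apply: (measurableT_comp msk (g := fun z : V => x0 - z)).
  apply: measurable_addrV => //; exact: measurable_opprV.
apply: (@le_trans _ _ (\int[lebV]_z (c1 * (stable_kernel beta r (c2 *: (x0 - z)) * bump (x0 - z)))%:E)%E).
  apply: ge0_le_int => //.
  - exact: (measurable_section1 (r : measurableTypeR R) mn).
  - exact: measurable_funM.
  move=> z; rewrite /qst /bumpx /= winr mulr1 normrM (ger0_norm (bump_ge0 _)) -bumpN opprB mulrA.
  by apply: ler_wpM2r; [exact: bump_ge0|exact: (q_le_stable q_le x0 z re)].
rewrite (ge0_intZl lebV (ltW c10) mskx); last by move=> z; rewrite mulr_ge0 ?bump_ge0.
rewrite (int_sub x0 (f := fun u : V => (stable_kernel beta r (c2 *: u) * bump u)%:E)); last exact: measurable_EFinW.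
rewrite winr mulr1 -[c1 * Cb * t0]mulrA [X in (_ <= X)%E]EFinM; apply: lee_wpmul2l.
  by rewrite lee_fin ltW.
by apply: le_trans (CbP r0 sk0) _; rewrite lee_fin ler_wpM2l// ltW.
Qed.

Let moment (k : nat) : R := k`!%:R * 8 ^+ k * Num.sqrt 2 ^+ d.
Let moment_ge0 k : 0 <= moment k.
Proof. by rewrite !mulr_ge0 ?exprn_ge0 ?sqrtr_ge0. Qed.

Let rint_gk (s : R) (z : V) (h : V -> R) (A : R) : 0 < s -> measurable_fun setT h ->
  (forall y, `|h y| <= A) -> rintegrable lebV (fun y => gk s (z - y) * h y).
Proof.
move=> s0 mh hA; apply: (rintegrable_mulr _ mh hA); apply: rintegrableP.
  apply: measurable_gk => //; apply: measurable_addrV => //; exact: measurable_opprV.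
under eq_int do rewrite ger0_norm//.
by rewrite int_gk_sub// ltry.
Qed.

Lemma heat_f_le : kop mst (heatk t0) (cyl win f) (0, x0) <= C4 * moment 2 * t0 ^+ 2 * t0.
Proof.
have rt : 0 <= (0 : R) < t0 by rewrite lexx t0_gt0.
rewrite -[X in _ * X]subr0; apply: (kop_heat_cyl_le t0_gt0 rt mf fB') => s /andP[s0 st].
have := int_gk_moment (k := 2) s0 C40 mf f_ge0 f4.
rewrite -(EFin_Rint (rint_gk x0 s0 mf fB')) lee_fin => /le_trans; apply.
rewrite (_ : C4 * _ * _ * _ * _ = C4 * moment 2 * s ^+ 2); last by rewrite /moment !mulrA.
apply: ler_wpM2l; first exact: mulr_ge0.
by rewrite ler_sqr ?nnegrE ltW// ltW.
Qed.

Variables (e C1 : R).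
Hypothesis C10 : 0 <= C1.
Hypothesis C1P : forall z v,
  jump_diff beta b f z v <= L + e + C1 * (bump (z - x0) + bump (z - v)).

Lemma stk_f_le (r : R) (z : V) : 0 < r < t0 ->
  kop mst (stk t0 (jump beta b)) (cyl win f) (r, z) <=
  (L + e + C1 * bump (z - x0) + C1 * moment 1 * t0) * (t0 - r).
Proof.
move=> /andP[r0 rt]; have r0t : 0 <= r < t0 by rewrite ltW.
rewrite (kop_stk_cyl d_ge1 beta_gt0 beta_lt2 mb bM mf f_ge0 fB fD2 t0_gt0 t0_le1 tauP).
have mG := measurable_jump_diff beta mb mf z.
have GC := jump_diff_le d_ge1 beta_gt0 beta_lt2 mb bM mf fD2 z.
apply: (kop_heat_cyl_le t0_gt0 r0t mG GC) => s /andP[s0 st].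
have iG := rint_gk z s0 mG GC.
have mbz : measurable_fun setT (fun v : V => bump (z - v)).
  apply: measurable_bump; apply: measurable_addrV => //; exact: measurable_opprV.
have bz1 (v : V) : `|bump (z - v)| <= 1 by rewrite ger0_norm ?bump_ge0 ?bump_le1.
have ib := rint_gk z s0 mbz bz1.
have ig : rintegrable lebV (fun v : V => gk s (z - v)).
  apply: rintegrableP.
    apply: measurable_gk => //; apply: measurable_addrV => //; exact: measurable_opprV.
  by under eq_int do rewrite ger0_norm//; rewrite int_gk_sub// ltry.
set a := L + e + C1 * bump (z - x0).
apply: (@le_trans _ _ (\int[lebV]_v (a * gk s (z - v) + C1 * (gk s (z - v) * bump (z - v))))).
  apply: le_Rint => //; first exact: rintegrableD (rintegrableZl a ig) (rintegrableZl C1 ib).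
  move=> v; apply: le_trans (ler_wpM2l (gk_ge0 s (z - v)) (C1P z v)) _.
  rewrite /a; move: (gk _ _) (bump _) (bump _) => g x y.
  by rewrite le_eqVlt; apply/orP; left; apply/eqP; ring.
rewrite (RintD (rintegrableZl a ig) (rintegrableZl C1 ib)) (RintZl _ ig) (RintZl _ ib).
rewrite lerD//; first by rewrite /Rintegral int_gk_sub//= mulr1.
rewrite -mulrA ler_wpM2l//.
have bd (v : V) : bump (z - v) <= 1 * dotrV (z - v) (z - v) ^+ 1.
  by rewrite mul1r expr1 bump_le_dotrV.
have := int_gk_moment (k := 1) (h := fun v => bump (z - v)) s0 ler01 mbz (fun v : V => bump_ge0 _) bd.
rewrite -(EFin_Rint ib) lee_fin => /le_trans; apply.
by rewrite mul1r expr1 -/(moment 1) ler_wpM2l// ltW.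
Qed.

(** The terms of [int_qst_duhamel] for the source [f]: the left-hand side is nonnegative,
    the potential is of order [t0^3], and the operator contributes [(L + e) * t0^2 / 2] up
    to terms of order [t0^3]. *)
Lemma short_time_balance :
  0 <= t0 ^+ 2 * ((L + e) / 2 + (C4 * moment 2 + C1 * moment 1 / 2 + C1 * (c1 * Cb)) * t0).
Proof.
have mphi : measurable_fun setT (cyl win f : spacetime -> R) by exact: measurable_cyl.
have phiB (p : spacetime) : `|cyl win f p| <= B by rewrite -[B]mul1r; exact: cyl_le.
have phi0 (p : spacetime) : ~ (0 < (p.1 : R) < t0) -> cyl win f p = 0.
  by move=> p0; rewrite /cyl win_out// mul0r.
have mc : measurable_fun setT (cyl left (fun=> 1) : spacetime -> R).
  by apply: measurable_cyl => //; exact: measurable_cst.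
have i1 : rintegrable mst (fun p => Q p * cyl left (fun=> 1) p) := rintegrable_mulr iQ mc cyl_left_le.
have i2 : rintegrable mst (fun p => Q p * bumpx p) := rintegrable_mulr iQ mbumpx bumpx_le.
have mh : measurable_fun setT (fun w : V => M * levy beta w).
  by apply: measurable_funM => //; exact: measurable_levy.
have hA := int_jump_weight d_ge1 beta_gt0 beta_lt2 bM.
have mstk := measurable_stk t0 mJ.
have istk := int_norm_stk beta_gt0 beta_lt2 t0_le1 tauP mJ mh (jump_le beta bM) hA.
have B0 : 0 <= B := le_trans (f_ge0 0) (fB 0).
have mK : measurable_fun setT (kop mst (stk t0 (jump beta b)) (cyl win f)).
  exact: (measurable_kop mst mstk mphi).
have i3 : rintegrable mst (fun p => Q p * kop mst (stk t0 (jump beta b)) (cyl win f) p).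
  exact: (rintegrable_mulr iQ mK (fun p => kop_norm_le mstk istk p B0 mphi phiB)).
have pos : 0 <= \int[mst]_p (Q p * cyl win f p).
  by apply: Rintegral_ge0 => p _; rewrite mulr_ge0// mulr_ge0.
rewrite (master mphi phiB phi0) in pos.
pose a := L + e + C1 * moment 1 * t0.
have step : \int[mst]_p (Q p * kop mst (stk t0 (jump beta b)) (cyl win f) p) <=
    a * (t0 ^+ 2 / 2) + C1 * t0 * (c1 * Cb * t0 * t0).
  apply: (@le_trans _ _ (\int[mst]_p (a * (Q p * cyl left (fun=> 1) p) + C1 * t0 * (Q p * bumpx p)))).
    apply: le_Rint => //; first exact: rintegrableD (rintegrableZl a i1) (rintegrableZl _ i2).
    case=> r z; have [r0t|r0] := pselect (0 < (r : R) < t0); last first.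
      by rewrite /qst /= win_out// !(mulr0, mul0r) addr0.
    have winr : win r = 1 by rewrite indicE mem_set//= in_itv.
    apply: le_trans (ler_wpM2l (Q_ge0 (r, z)) (stk_f_le z r0t)) _.
    have bt : C1 * bump (z - x0) * (t0 - r) <= C1 * t0 * bump (z - x0).
      case/andP: r0t => r0 _; rewrite (mulrAC C1 t0) ler_wpM2l ?mulr_ge0 ?bump_ge0//.
      by rewrite gerBl ltW.
    rewrite /cyl /left /bumpx /= winr !mulr1.
    have -> : a * (Q (r, z) * (t0 - r)) + C1 * t0 * (Q (r, z) * bump (z - x0)) =
      Q (r, z) * (a * (t0 - r) + C1 * t0 * bump (z - x0)) by ring.
    apply: ler_wpM2l => //.
    have -> : L + e + C1 * bump (z - x0) + C1 * moment 1 * t0 = a + C1 * bump (z - x0).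
      by rewrite /a addrAC.
    by rewrite mulrDl lerD2l.
  rewrite (RintD (rintegrableZl a i1) (rintegrableZl _ i2)) (RintZl _ i1) (RintZl _ i2).
  rewrite int_qst_left lerD2l ler_wpM2l ?int_qst_bump//.
  by rewrite mulr_ge0// ltW.
apply: le_trans (le_trans pos (lerD heat_f_le step)) _.
by rewrite /a le_eqVlt; apply/orP; left; apply/eqP; field.
Qed.

End window.

(** At an order-four zero of [f], the time average of [f] is negligible against that of
    the nonlocal operator applied to [f], which therefore cannot be negative. *)
Lemma jump_mean_ge0 : 0 <= L.
Proof.
have [Cb Cb0 CbP] := stable_kernel_bump d beta_gt0 (ltW beta_lt2) c20.
rewrite -oppr_le0; apply/ler_addgt0Pr => e e0; rewrite add0r -subr_le0.
have [C1 C10 C1P] := jump_diff_bump d_ge1 beta_gt0 beta_lt2 mb bM b_sym b_cont mf cf f_ge0 fx0 fD2 e0.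
pose mom (k : nat) : R := k`!%:R * 8 ^+ k * Num.sqrt 2 ^+ d.
have mom0 k : 0 <= mom k by rewrite !mulr_ge0 ?exprn_ge0 ?sqrtr_ge0.
pose K := 2 * (C4 * mom 2 + C1 * mom 1 / 2 + C1 * (c1 * Cb)).
have K0 : 0 <= K by rewrite mulr_ge0// !addr_ge0// ?mulr_ge0// ltW.
have [Ct [kappa [Ct0 k0 tw]]] := int_time_weight (theta_gt0 beta_gt0) (theta_lt1 beta_lt2).
apply: (@le0_of_small _ _ K (Num.min 1 eps)) => //; first by rewrite lt_min ltr01.
move=> t0 /andP[t00]; rewrite le_min => /andP[t01 t0e].
have t0P : 0 < t0 <= 1 by rewrite t00.
have := short_time_balance t00 t01 t0e (tw t0 t0P) Cb0 CbP C10 C1P.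
rewrite pmulr_rge0 ?exprn_gt0// => h.
have -> : K * t0 = 2 * ((C4 * mom 2 + C1 * mom 1 / 2 + C1 * (c1 * Cb)) * t0).
  by rewrite /K -mulrA.
move: h; rewrite -/(mom 2) -/(mom 1); by move=> /half_balance.
Qed.

End short_time.

(** * An algebra of test functions *)

Section mean_value.
Context {R : realType}.
Implicit Types F dF : R -> R.

Lemma mean_value F dF (x y : R) : (forall x : R, is_derive x 1 F (dF x)) ->
  exists2 c, `|c - x| <= `|y| & F (x + y) - F x = dF c * y.
Proof.
move=> dFP; have cF := is_derive_continuous dFP.
have cw (a b : R) : {within `[a, b], continuous F} by apply: continuous_subspaceT.
have [y0|/ltW y0] := leP 0 y.
  have le : x <= x + y by rewrite lerDl.
  have [c + ->] := MVT_segment le (fun z _ => dFP z) (cw _ _).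
  rewrite in_itv/= => /andP[xc cy]; exists c; last by rewrite addrAC subrr add0r.
  by rewrite !ger0_norm ?subr_ge0// lerBlDl.
have le : x + y <= x by rewrite gerDl.
have [c + E] := MVT_segment le (fun z _ => dFP z) (cw _ _).
rewrite in_itv/= => /andP[xc cy]; exists c; last by rewrite -[LHS]opprB E opprD addrA subrr sub0r mulrN opprK.
by rewrite !ler0_norm ?subr_le0//; move: xc; lra.
Qed.

Lemma second_difference_le F dF (K x y : R) : (forall x : R, is_derive x 1 F (dF x)) ->
  (forall x y, `|dF x - dF y| <= K * `|x - y|) -> 0 <= K ->
  `|F (x + y) + F (x - y) - 2 * F x| <= 2 * K * y ^+ 2.
Proof.
move=> dFP dFK K0; have [c1 c1x E1] := mean_value x y dFP.
have [c2 c2x E2] := mean_value x (- y) dFP.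
have -> : F (x + y) + F (x - y) - 2 * F x = (dF c1 - dF c2) * y.
  by rewrite (_ : _ - _ = (F (x + y) - F x) + (F (x - y) - F x)); [rewrite E1 E2; ring|ring].
rewrite normrM -[y ^+ 2]real_normK ?num_real// expr2 mulrA ler_wpM2r//.
apply: le_trans (dFK c1 c2) _; rewrite (mulrC 2) -mulrA ler_wpM2l//.
rewrite (_ : c1 - c2 = (c1 - x) - (c2 - x)); last by rewrite opprB addrA subrK.
apply: le_trans (ler_normB _ _) _; rewrite normrN in c2x.
by rewrite mulr_natl mulr2n lerD.
Qed.

Lemma oneDsqr_inv_lipschitz (x y : R) : `|(1 + x ^+ 2)^-1 - (1 + y ^+ 2)^-1| <= 1 * `|x - y|.
Proof.
have p (z : R) : 0 < 1 + z ^+ 2 by rewrite ltr_pwDl// sqr_ge0.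
have -> : (1 + x ^+ 2)^-1 - (1 + y ^+ 2)^-1 = (y - x) * ((x + y) / ((1 + x ^+ 2) * (1 + y ^+ 2))).
  by field; rewrite !lt0r_neq0.
have p2 : 0 < (1 + x ^+ 2) * (1 + y ^+ 2) by rewrite mulr_gt0.
rewrite normrM [X in X * _]distrC mulrC ler_wpM2r// normrM normfV [X in _ / X]gtr0_norm//.
rewrite ler_pdivrMr// mul1r ler_norml.
have := sqr_ge0 (x - 2^-1); have := sqr_ge0 (y - 2^-1); have := sqr_ge0 (x * y).
have := sqr_ge0 (x + 2^-1); have := sqr_ge0 (y + 2^-1).
by move=> *; apply/andP; split; lra.
Qed.

Lemma atan_lipschitz (x y : R) : `|atan x - atan y| <= `|x - y|.
Proof.
have [c _] := @mean_value atan _ y (x - y) (@is_derive1_atan R).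
rewrite [y + _]addrC subrK => ->; rewrite normrM ler_piMl// ger0_norm ?invr_ge0 ?addr_ge0 ?sqr_ge0//.
by rewrite invf_le1 ?ltr_pwDl ?sqr_ge0// lerDl sqr_ge0.
Qed.

Lemma atan_second_difference (x y : R) : `|atan (x + y) + atan (x - y) - 2 * atan x| <= 2 * y ^+ 2.
Proof.
rewrite -[2 in leRHS]mulr1.
exact: (second_difference_le x y (@is_derive1_atan R) oneDsqr_inv_lipschitz ler01).
Qed.

Lemma atan_norm_le (x : R) : `|atan x| <= pi / 2.
Proof. by rewrite ler_norml !ltW ?atan_ltpi2 ?atan_gtNpi2. Qed.

End mean_value.

Section test_functions.
Context {R : realType} {d : nat}.
Local Notation V := 'rV[R]_d.
Implicit Types (f g : V -> R).

(** Bounded Lipschitz functions with bounded second differences; the two norms are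
    equivalent, and each bound is stated with the norm that suits its use. *)
Definition test_function f := [/\ measurable_fun setT f,
  exists B, forall y, `|f y| <= B,
  exists K, forall x y, `|f x - f y| <= K * `|x - y| &
  exists C, forall v w, `|f (v + w) + f (v - w) - 2 * f v| <= C * dotrV w w].

Lemma test_cst (c : R) : test_function (fun=> c).
Proof.
split; first exact: measurable_cst.
- by exists `|c|.
- by exists 0 => x y; rewrite subrr normr0 mul0r.
- by exists 0 => v w; rewrite mul0r (_ : _ - _ = 0) ?normr0//; ring.
Qed.

Lemma testD f g : test_function f -> test_function g -> test_function (fun y => f y + g y).
Proof.
move=> [mf [B fB] [K fK] [C fC]] [mg [B' gB] [K' gK] [C' gC]]; split.
- exact: measurable_funD.
- by exists (B + B') => y; rewrite (le_trans (ler_normD _ _))// lerD.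
- exists (K + K') => x y; rewrite [leRHS]mulrDl opprD addrACA (le_trans (ler_normD _ _))// lerD//.
- exists (C + C') => v w; rewrite [leRHS]mulrDl.
  rewrite (_ : _ - _ = (f (v + w) + f (v - w) - 2 * f v) + (g (v + w) + g (v - w) - 2 * g v)); last by ring.
  by rewrite (le_trans (ler_normD _ _))// lerD.
Qed.

(** The second difference of a product has a cross term, which the Lipschitz bounds
    control. *)
Lemma testM f g : test_function f -> test_function g -> test_function (fun y => f y * g y).
Proof.
move=> [mf [B fB] [K fK] [C fC]] [mg [B' gB] [K' gK] [C' gC]].
have nle (w : V) : `|w| ^+ 2 <= dotrV w w.
  by rewrite -enorm_sqr ler_sqr ?nnegrE ?enorm_ge0//; exact: norm_le_enorm.
split.
- exact: measurable_funM.
- by exists (B * B') => y; rewrite normrM ler_pM.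
- exists (B * K' + K * B') => x y.
  rewrite (_ : _ - _ = f x * (g x - g y) + (f x - f y) * g y); last by ring.
  rewrite (le_trans (ler_normD _ _))// [leRHS]mulrDl lerD// normrM.
    by rewrite -mulrA ler_pM.
  by rewrite mulrAC ler_pM.
- exists (B * C' + C * B' + 2 * (`|K| * `|K'|)) => v w.
  rewrite (_ : _ - _ = f v * (g (v + w) + g (v - w) - 2 * g v) + (f (v + w) + f (v - w) - 2 * f v) * g v
    + ((f (v + w) - f v) * (g (v + w) - g v) + (f (v - w) - f v) * (g (v - w) - g v))); last by ring.
  have cross (u : V) : `|u - v| = `|w| ->
      `|(f u - f v) * (g u - g v)| <= `|K| * `|K'| * dotrV w w.
    move=> uw; apply: (@le_trans _ _ ((`|K| * `|w|) * (`|K'| * `|w|))); last first.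
      by rewrite mulrACA -expr2 ler_wpM2l// mulr_ge0.
    rewrite normrM ler_pM// -uw.
      by apply: le_trans (fK u v) _; rewrite ler_wpM2r// ler_norm.
    by apply: le_trans (gK u v) _; rewrite ler_wpM2r// ler_norm.
  rewrite [leRHS]mulrDl [(_ + _) * dotrV _ _ in leRHS]mulrDl; apply: le_trans (ler_normD _ _) _; apply: lerD.
    rewrite (le_trans (ler_normD _ _))// lerD// normrM; first by rewrite -mulrA ler_pM.
    by rewrite mulrAC ler_pM.
  apply: le_trans (ler_normD _ _) _; rewrite [2 * _]mulr_natl mulr2n [leRHS]mulrDl lerD// cross//.
    by rewrite addrAC subrr add0r.
  by rewrite addrAC subrr add0r normrN.
Qed.

Lemma test_shift f (a : V) : test_function f -> test_function (fun y => f (y - a)).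
Proof.
move=> [mf [B fB] [K fK] [C fC]]; split.
- by apply: (measurableT_comp mf); exact: measurable_addrV.
- by exists B.
- by exists K => x y; rewrite (le_trans (fK _ _))// opprB addrA subrK.
- by exists C => v w; rewrite (addrAC v w) (addrAC v (- w)).
Qed.

Lemma test_sum (I : Type) (s : seq I) (F : I -> V -> R) : (forall i, test_function (F i)) ->
  test_function (fun y => \sum_(i <- s) F i y).
Proof.
move=> tF; elim: s => [|i s IH].
  rewrite (_ : (fun _ => _) = fun=> 0); first exact: test_cst.
  by apply/funext => y; rewrite big_nil.
rewrite (_ : (fun _ => _) = fun y => F i y + \sum_(j <- s) F j y); first exact: testD.
by apply/funext => y; rewrite big_cons.
Qed.

Lemma coord_le_norm (x : V) i : `|x ord0 i| <= `|x|.
Proof. by rewrite [leRHS]mx_normrE; exact: (le_bigmax _ (fun ij => `|x ij.1 ij.2|) (ord0, i)). Qed.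

Lemma test_atan (i : 'I_d) (m c : R) : test_function (fun y => atan (m * y ord0 i + c)).
Proof.
split.
- apply: (measurableT_comp (@continuous_measurable_fun R _ (@continuous_atan R))).
  apply: measurable_funD => //; apply: measurable_funM => //; exact: measurable_coord.
- by exists (pi / 2) => y; exact: atan_norm_le.
- exists `|m| => x y; apply: le_trans (atan_lipschitz _ _) _.
  rewrite opprD addrACA subrr addr0 -mulrBr normrM ler_wpM2l//.
  by have := coord_le_norm (x - y) i; rewrite !mxE.
- exists (2 * m ^+ 2) => v w; rewrite !mxE mulrDr mulrDr mulrN (addrAC _ _ c) (addrAC _ (- _) c).
  apply: le_trans (atan_second_difference _ _) _; rewrite exprMn mulrA ler_wpM2l//.
    by rewrite mulr_ge0// sqr_ge0.
  exact: sqr_coord_le.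
Qed.

Lemma test_continuous f : test_function f -> continuous f.
Proof.
move=> [_ _ [K fK] _] x; apply/(@cvgrPdist_le _ _ _ (nbhs x)) => e e0.
have K1 : 0 < `|K| + 1 by rewrite ltr_wpDl.
have ek : 0 < e / (`|K| + 1) by rewrite divr_gt0.
apply/nbhs_ballP; exists (e / (`|K| + 1)) => //= y; rewrite -ball_normE/= => /ltW xy; apply: le_trans (fK x y) _.
apply: le_trans (_ : (`|K| + 1) * `|x - y| <= _); last by rewrite mulrC -ler_pdivlMr.
by rewrite ler_wpM2r// (le_trans (ler_norm K))// lerDl.
Qed.

Lemma test_levy_cut (beta : R) f : 0 < beta -> beta < 2 -> test_function f ->
  exists C, forall v w, `|f (v + w) + f (v - w) - 2 * f v| <= C * levy_cut beta w.
Proof.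
move=> b0 b2 [_ [B fB] _ [C fC]].
have B0 : 0 <= B := le_trans (normr_ge0 _) (fB 0).
exists (4 * B + `|C|) => v w; have [w1|w1] := leP (enorm w) 1.
  apply: le_trans (fC v w) _; apply: le_trans (_ : `|C| * levy_cut beta w <= _); last first.
    by rewrite ler_wpM2r ?levy_cut_ge0// lerDr mulr_ge0.
  apply: le_trans (_ : `|C| * dotrV w w <= _); first by rewrite ler_wpM2r ?dotrV_ge0// ler_norm.
  by rewrite ler_wpM2l//; exact: sqr_le_levy_cut.
rewrite levy_cut_large// mulr1.
apply: le_trans (_ : 4 * B <= _); last by rewrite lerDl.
apply: le_trans (ler_normB _ _) _; rewrite normrM ger0_norm//.
apply: le_trans (lerD (ler_normD _ _) (lexx _)) _.
by have := fB (v + w); have := fB (v - w); have := fB v; lra.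
Qed.

End test_functions.

(** * Test functions determine the sign of an integrable function *)

Section approximable.
Context {R : realType} {d : nat}.
Local Notation V := 'rV[R]_d.
Local Notation lebV := (lebesgue_rV d).
Variable G : V -> R.
Hypothesis iG : rintegrable lebV G.

Definition unit_valued (g : V -> R) := forall w, 0 <= g w <= 1.

(** Approximability in the norm of L^1(|G|); the values of the approximants are kept in
    [0, 1], so that products and pointwise limits of approximable functions remain
    approximable. *)
Definition approximable (g : V -> R) := [/\ measurable_fun setT g, unit_valued g &
  forall e : R, 0 < e -> exists h, [/\ test_function h, unit_valued h &
    \int[lebV]_w (`|g w - h w| * `|G w|) <= e]].

Let inG : rintegrable lebV (fun w => `|G w|) := rintegrable_norm iG.

Let dist_le1 (g h : V -> R) w : unit_valued g -> unit_valued h -> `|g w - h w| <= 1.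
Proof.
move=> /(_ w)/andP[g0 g1] /(_ w)/andP[h0 h1].
by rewrite ler_norml; apply/andP; split; lra.
Qed.

Let rintegrable_dist (g h : V -> R) : measurable_fun setT g -> measurable_fun setT h ->
  unit_valued g -> unit_valued h -> rintegrable lebV (fun w => `|g w - h w| * `|G w|).
Proof.
move=> mg mh g01 h01; apply: (@rintegrable_dominated _ _ _ lebV _ _ _ inG).
  apply: measurable_funM; first by apply: measurableT_comp => //; exact: measurable_funB.
  exact: rintegrable_measurable inG.
by move=> w; rewrite normrM !normr_id ler_piMl// dist_le1.
Qed.

Lemma approximable_test h : test_function h -> unit_valued h -> approximable h.
Proof.
move=> th h01; split => //; first by case: th.
move=> e e0; exists h; split => //.
rewrite (_ : (fun _ => _) = fun=> 0) ?/Rintegral ?integral0 ?ltW//.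
by apply/funext => w; rewrite subrr normr0 mul0r.
Qed.

Lemma approximable_compl g : approximable g -> approximable (fun w => 1 - g w).
Proof.
move=> [mg g01 ga]; split; first exact: measurable_funB.
  by move=> w; have /andP[g0 g1] := g01 w; rewrite subr_ge0 g1 gerBl.
move=> e /ga[h [th h01 hle]]; exists (fun w => 1 + (- 1) * h w); split.
- by apply: testD; [exact: test_cst|apply: testM => //; exact: test_cst].
- by move=> w; have /andP[h0 h1] := h01 w; rewrite mulN1r subr_ge0 h1 gerBl.
- apply: le_trans hle; rewrite le_eqVlt; apply/orP; left; apply/eqP.
  apply: eq_Rint => w; congr (_ * _).
  by rewrite (_ : 1 - g w - _ = - (g w - h w)) ?normrN//; ring.
Qed.

Lemma approximableM f g : approximable f -> approximable g -> approximable (fun w => f w * g w).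
Proof.
move=> [mf f01 fa] [mg g01 ga]; split; first exact: measurable_funM.
  move=> w; have /andP[f0 f1] := f01 w; have /andP[g0 g1] := g01 w.
  by rewrite mulr_ge0// mulr_ile1.
move=> e e0; have e2 : 0 < e / 2 by rewrite divr_gt0.
have [h [th h01 hle]] := fa _ e2; have [k [tk k01 kle]] := ga _ e2.
have [mh _ _ _] := th; have [mk _ _ _] := tk.
exists (fun w => h w * k w); split; first exact: testM.
  move=> w; have /andP[f0 f1] := h01 w; have /andP[g0 g1] := k01 w.
  by rewrite mulr_ge0// mulr_ile1.
have i1 := rintegrable_dist mf mh f01 h01; have i2 := rintegrable_dist mg mk g01 k01.
rewrite (splitr e); apply: le_trans (lerD hle kle); rewrite -(RintD i1 i2).
apply: le_Rint; [|exact: rintegrableD|].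
  apply: rintegrable_dist; do ?exact: measurable_funM.
  - by move=> w; have /andP[f0 f1] := f01 w; have /andP[g0 g1] := g01 w; rewrite mulr_ge0// mulr_ile1.
  - by move=> w; have /andP[f0 f1] := h01 w; have /andP[g0 g1] := k01 w; rewrite mulr_ge0// mulr_ile1.
move=> w; rewrite -mulrDl ler_wpM2r//.
rewrite (_ : _ - _ = (f w - h w) * g w + h w * (g w - k w)); last by ring.
have /andP[g0 g1] := g01 w; have /andP[h0 h1] := h01 w.
rewrite (le_trans (ler_normD _ _))// lerD// normrM.
  by rewrite ler_piMr// ger0_norm.
by rewrite ler_piMl// ger0_norm.
Qed.

Lemma approximable_lim (g_ : nat -> V -> R) g : (forall n, approximable (g_ n)) ->
  measurable_fun setT g -> unit_valued g -> (forall w, g_ ^~ w @ \oo --> g w) -> approximable g.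
Proof.
move=> ga mg g01 cg; split => // e e0; have e2 : 0 < e / 2 by rewrite divr_gt0.
have : (\int[lebV]_w (`|g w - g_ n w| * `|G w|)) @[n --> \oo] --> \int[lebV]_w (0 : R).
  apply: (Rint_cvg (g := fun w => `|G w|)) => //.
  - move=> n; have [mgn gn01 _] := ga n.
    exact: rintegrable_measurable (rintegrable_dist mg mgn g01 gn01).
  - apply: aeW => w; rewrite -[X in _ --> X](mul0r `|G w|); apply: cvgM; last exact: cvg_cst.
    rewrite -[X in _ --> X](normr0 R); apply: cvg_norm.
    rewrite -[X in _ --> X](subrr (g w)); apply: cvgB; [exact: cvg_cst|exact: cg].
  - move=> n w; have [mgn gn01 _] := ga n.
    by rewrite normrM !normr_id ler_piMl// dist_le1.
rewrite {2}/Rintegral integral0 => /cvgrPdist_le /(_ _ e2)[N _ /(_ N (leqnn N))] /=.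
rewrite sub0r normrN => gN; have [mgN gN01 /(_ _ e2)[h [th h01 hle]]] := ga N.
have [mh _ _ _] := th.
have i1 := rintegrable_dist mg mgN g01 gN01; have i2 := rintegrable_dist mgN mh gN01 h01.
exists h; split => //; rewrite (splitr e); apply: le_trans (lerD (le_trans (ler_norm _) gN) hle).
rewrite -(RintD i1 i2); apply: le_Rint; [exact: rintegrable_dist|exact: rintegrableD|].
move=> w; rewrite -mulrDl ler_wpM2r//.
rewrite (_ : g w - h w = (g w - g_ N w) + (g_ N w - h w)); last by ring.
exact: ler_normD.
Qed.

Let unit_indic (A : set V) : unit_valued (\1_A).
Proof. by move=> w; rewrite indicE; case: (_ \in _); rewrite ?lexx ?ler01. Qed.

Definition approximable_set (A : set V) := measurable A /\ approximable (\1_A : V -> R).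

Lemma approximable_setC A : approximable_set A -> approximable_set (~` A).
Proof.
move=> [mA aA]; split; first exact: measurableC.
have := approximable_compl aA; congr approximable; apply/funext => w.
by rewrite !indicE in_setC; case: (_ \in _); rewrite ?subr0 ?subrr.
Qed.

Lemma approximable_setI A B : approximable_set A -> approximable_set B -> approximable_set (A `&` B).
Proof.
move=> [mA aA] [mB aB]; split; first exact: measurableI.
have := approximableM aA aB; congr approximable; apply/funext => w.
by rewrite indicI.
Qed.

Lemma approximable_bigcap (F : nat -> set V) : (forall n, approximable_set (F n)) ->
  approximable_set (\bigcap_n F n).
Proof.
move=> aF; have mF n : measurable (F n) by have [] := aF n.
have mI : measurable (\bigcap_n F n) by exact: bigcap_measurableType.
split => //; pose I n := \big[setI/setT]_(i < n) F i.
have aI n : approximable_set (I n).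
  elim: n => [|n IH]; last by rewrite /I big_ord_recr; exact: approximable_setI.
  rewrite /I big_ord0; split => //; apply: approximable_test => //.
  by rewrite indicT; exact: test_cst.
apply: (@approximable_lim (fun n => \1_(I n))) => //.
- by move=> n; have [] := aI n.
move=> w; have [wF|] := pselect ((\bigcap_n F n) w).
  apply: cvg_near_cst; apply: nearW => n; rewrite !indicE !mem_set//.
  by rewrite /I -bigcap_mkord => i _; exact: wF.
move=> wF; have [N wN] : exists N, ~ F N w by apply/existsNP => wF'; apply: wF => n _; exact: wF'.
apply: cvg_near_cst; exists N.+1 => // n /= Nn; rewrite !indicE !memNset//.
by rewrite /I -bigcap_mkord => /(_ N Nn).
Qed.

Lemma approximable_sigma_algebra : sigma_algebra setT approximable_set.
Proof.
have aC A : approximable_set A -> approximable_set (setT `\` A).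
  by rewrite setTD; exact: approximable_setC.
split=> //.
- rewrite -setCT; apply: approximable_setC; split => //; apply: approximable_test => //.
  by rewrite indicT; exact: test_cst.
- move=> F aF; rewrite -[X in approximable_set X]setCK setC_bigcup.
  by apply: approximable_setC; apply: approximable_bigcap => n; exact: approximable_setC.
Qed.

Let pi0 : 0 < (pi : R) := pi_gt0 R.

(** The indicator of a half-space, as a limit of sigmoids: the argument [k (k s - 1)]
    tends to [-oo] for [s <= 0], including [s = 0], and to [+oo] for [s > 0]. *)
Lemma cvg_sigmoid (s : R) :
  (2^-1 + pi^-1 * atan (k%:R * (k%:R * s - 1))) @[k --> \oo] --> ((0 < s)%R%:R : R).
Proof.
have cat : (atan (k%:R : R)) @[k --> \oo] --> (pi / 2 : R).
  exact: (cvg_comp _ _ (@cvgr_idn R) (@cvgy_atan R)).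
have [s0|s0] := ltP 0 s.
  rewrite [X in _ --> X](_ : _ = 2^-1 + pi^-1 * (pi / 2)); last first.
    by rewrite mulKf ?lt0r_neq0// [LHS]splitr mul1r.
  apply: cvgD; first exact: cvg_cst.
  apply: cvgM; first exact: cvg_cst.
  apply: (squeeze_cvgr _ cat (cvg_cst (pi / 2))).
  have [N _ NP] : \forall n \near \oo, 2 / s <= n%:R :> R by exact: nbhs_infty_ger.
  exists N => // n /= Nn; apply/andP; split; last by rewrite ltW// atan_ltpi2.
  apply: le_atan.
  by rewrite ler_peMr// lerBrDr -ler_pdivrMr//; exact: NP.
rewrite [X in _ --> X](_ : _ = 2^-1 + pi^-1 * (- (pi / 2))); last first.
  by rewrite mulrN mulKf ?lt0r_neq0// subrr.
apply: cvgD; first exact: cvg_cst.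
apply: cvgM; first exact: cvg_cst.
apply: (squeeze_cvgr _ (cvg_cst (- (pi / 2))) (cvgN cat)).
apply: nearW => n; apply/andP; split; first by rewrite ltW// atan_gtNpi2.
rewrite -[leRHS]/(- atan n%:R) -atanN; apply: le_atan.
by rewrite mulrBr mulr1 gerDr mulr_ge0_le0// mulr_ge0_le0.
Qed.

Lemma approximable_halfspace (i : 'I_d) (a : R) :
  approximable_set ((fun w : V => w ord0 i) @^-1` `]a, +oo[%classic).
Proof.
pose H := (fun w : V => w ord0 i) @^-1` `]a, +oo[%classic.
have mH : measurable H.
  by rewrite -[X in measurable X]setTI; exact: (measurable_coord i measurableT).
split => //.
pose h (k : nat) (w : V) : R := 2^-1 + pi^-1 * atan (k%:R * k%:R * w ord0 i + k%:R * (- (k%:R * a) - 1)).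
have hE k w : h k w = 2^-1 + pi^-1 * atan (k%:R * (k%:R * (w ord0 i - a) - 1)).
  by rewrite /h; congr (_ + _ * atan _); ring.
apply: (@approximable_lim h) => //.
- move=> k; apply: approximable_test.
    apply: testD; first exact: test_cst.
    by apply: testM; [exact: test_cst|exact: test_atan].
  move=> w; rewrite /h; move: (_ * w ord0 i + _) => x.
  have := atan_ltpi2 x; have := atan_gtNpi2 x => h1 h2.
  have e1 : pi^-1 * (pi / 2) = 2^-1 :> R by rewrite mulKf// lt0r_neq0.
  have pV : 0 < (pi : R)^-1 by rewrite invr_gt0.
  have := ler_wpM2l (ltW pV) (ltW h1); have := ler_wpM2l (ltW pV) (ltW h2).
  by rewrite mulrN e1; move: (pi^-1 * _) => y *; apply/andP; split; lra.
- move=> w; rewrite (_ : (fun n => h n w) = fun k : nat => 2^-1 + pi^-1 * atan (k%:R * (k%:R * (w ord0 i - a) - 1))).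
    have -> : \1_H w = (0 < w ord0 i - a)%R%:R :> R.
      rewrite indicE; congr (nat_of_bool _)%:R; apply/idP/idP.
        by move=> /set_mem; rewrite /H/= in_itv/= andbT subr_gt0.
      by move=> h0; apply/mem_set; rewrite /H/= in_itv/= andbT -subr_gt0.
    exact: cvg_sigmoid.
  by apply/funext => k.
Qed.

Lemma approximable_measurable (A : set V) : measurable A -> approximable_set A.
Proof.
have [S0 SC SU] := approximable_sigma_algebra.
apply: smallest_sub; first exact: approximable_sigma_algebra.
rewrite -bigcup_seq => _ [i _ [B mB <-]]; rewrite setTI.
have : (@RGenOInfty.G R).-sigma.-measurable B by rewrite -RGenOInfty.measurableE.
move: B {mB}; apply: smallest_sub.
  split; first by rewrite preimage_set0.
  - by move=> B aB; rewrite setTD preimage_setC; exact: approximable_setC.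
  - by move=> B aB; rewrite preimage_bigcup; exact: SU.
by move=> _ [a ->]; exact: approximable_halfspace.
Qed.

End approximable.

(** * Signs of the jump intensity and of the kernel *)

Section sign.
Context {R : realType} {d : nat}.
Local Notation V := 'rV[R]_d.
Local Notation lebV := (lebesgue_rV d).

(** The indicator of the set where [G] is negative is a limit of test functions in
    L^1(|G|). *)
Lemma ae_ge0_of_test_functions (G : V -> R) : rintegrable lebV G ->
  (forall h, test_function h -> unit_valued h -> 0 <= \int[lebV]_w (h w * G w)) ->
  {ae lebV, forall w, 0 <= G w}.
Proof.
move=> iG Gh; have mG := rintegrable_measurable iG.
pose A := [set w | G w < 0].
have mA : measurable A.
  rewrite -[A]setTI; have := mG measurableT `]-oo, 0[%classic (measurable_itv _).
  by congr measurable; apply/seteqP; split=> w /=; rewrite /A/= in_itv/=.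
have mi : measurable_fun setT (\1_A : V -> R) by exact: measurable_indic.
have i1 w : `|\1_A w : R| <= 1 by rewrite indicE; case: (_ \in _); rewrite ?normr1 ?normr0.
have iAG : rintegrable lebV (fun w => G w * \1_A w) := rintegrable_mulr iG mi i1.
have AG0 : 0 <= \int[lebV]_w (G w * \1_A w).
  rewrite -oppr_le0; apply/ler_addgt0Pr => e e0; rewrite add0r.
  have [_ [_ _ /(_ _ e0)[h [th h01 hle]]]] := approximable_measurable iG mA.
  have [mh _ _ _] := th.
  have h1 w : `|h w| <= 1 by have /andP[? ?] := h01 w; rewrite ger0_norm.
  have ih : rintegrable lebV (fun w => G w * h w) := rintegrable_mulr iG mh h1.
  have := Gh h th h01.
  have -> : \int[lebV]_w (h w * G w) = \int[lebV]_w (G w * h w).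
    by apply: eq_Rint => w; rewrite mulrC.
  move=> pos; apply: le_trans hle.
  apply: (@le_trans _ _ (\int[lebV]_w (G w * h w) - \int[lebV]_w (G w * \1_A w))).
    by rewrite lerDr.
  rewrite -(RintB ih iAG); apply: le_trans (ler_norm _) _.
  apply: le_trans (Rint_norm (rintegrableB ih iAG)) _.
  rewrite le_eqVlt; apply/orP; left; apply/eqP; apply: eq_Rint => w.
  by rewrite -mulrBr normrM mulrC distrC.
have nonpos w : G w * \1_A w <= 0.
  rewrite indicE; case: (boolP (w \in A)) => [/set_mem wA|_]; rewrite ?mulr0// mulr1.
  exact: ltW.
have I0 : (\int[lebV]_w `|(G w * \1_A w)%:E| = 0)%E.
  rewrite (eq_int _ (g := fun w => (- (G w * \1_A w))%:E)); last first.
    by move=> w; rewrite /= ler0_norm.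
  rewrite -(EFin_Rint (rintegrableN iAG)) (RintN iAG); congr EFin.
  apply/eqP; rewrite oppr_eq0 eq_le AG0 andbT.
  rewrite -oppr_ge0 -(RintN iAG); apply: Rintegral_ge0 => w _.
  by rewrite oppr_ge0.
have := (ae_eq_integral_abs lebV measurableT (measurable_EFinW (rintegrable_measurable iAG))).1 I0.
apply: filterS => w /(_ I) /= -[Gw]; rewrite leNgt; apply/negP => wA.
by move: Gw; rewrite indicE mem_set// mulr1 => G0; move: wA; rewrite G0 ltxx.
Qed.

(** A test function with a zero of order four at the origin, and no other zero. *)
Definition quartic (w : V) : R := \sum_(i < d) atan (w ord0 i) ^+ 4.

Lemma test_quartic : test_function quartic.
Proof.
apply: test_sum => i.
have ta : test_function (fun w : V => atan (w ord0 i)).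
  rewrite (_ : (fun _ => _) = fun w : V => atan (1 * w ord0 i + 0)); first exact: test_atan.
  by apply/funext => w; rewrite mul1r addr0.
rewrite (_ : (fun _ => _) = fun w : V => atan (w ord0 i) * atan (w ord0 i) *
  (atan (w ord0 i) * atan (w ord0 i))); first by do ![apply: testM => //].
by apply/funext => w; ring.
Qed.

Lemma quartic_ge0 w : 0 <= quartic w.
Proof. by apply: sumr_ge0 => i _; rewrite -[4%N]/(2 * 2)%N exprM sqr_ge0. Qed.

Lemma quartic_le w : quartic w <= d%:R * dotrV w w ^+ 2.
Proof.
apply: (@le_trans _ _ (\sum_(i < d) dotrV w w ^+ 2)); last first.
  by rewrite sumr_const card_ord mulr_natl.
apply: ler_sum => i _.
rewrite -[4%N]/(2 * 2)%N exprM ler_sqr ?nnegrE ?sqr_ge0 ?dotrV_ge0//.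
apply: le_trans (sqr_coord_le w i).
rewrite -(real_normK (num_real (atan _))) -(real_normK (num_real (w ord0 i))) ler_sqr ?nnegrE//.
by have := atan_lipschitz (w ord0 i) 0; rewrite atan0 !subr0.
Qed.

Lemma quartic_gt0 w : w != 0 -> 0 < quartic w.
Proof.
move=> w0; rewrite lt0r quartic_ge0 andbT; apply: contra w0.
rewrite psumr_eq0; last by move=> i _; rewrite -[4%N]/(2 * 2)%N exprM sqr_ge0.
move=> /allP h; apply/eqP/rowP => i; rewrite mxE.
have := h i (mem_index_enum _); rewrite /= expf_eq0/= => /eqP a0.
by rewrite -[w ord0 i]atanK a0 tan0.
Qed.

Lemma quarticN w : quartic (- w) = quartic w.
Proof. by apply: eq_bigr => i _; rewrite mxE atanN; ring. Qed.

Lemma ae_neq0 : (1 <= d)%N -> {ae lebV, forall w, (w : V) != 0}.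
Proof.
move=> d1; exists [set 0]; split.
- rewrite (_ : [set 0] = [set x : V | forall i, (0 : V) ord0 i <= x ord0 i <= (0 : V) ord0 i]).
    exact: measurable_box.
  apply/seteqP; split=> [w ->|w h /=]; first by move=> i; rewrite lexx.
  by apply/rowP => i; apply/eqP; rewrite eq_le andbC; exact: h.
- rewrite (_ : [set 0] = [set x : V | forall i, (0 : V) ord0 i <= x ord0 i <= (0 : V) ord0 i]).
    rewrite lebesgue_rV_box// (eq_bigr (fun=> 0)) => [|i _]; last by rewrite subrr.
    by rewrite prodr_const card_ord expr0n; case: d d1.
  apply/seteqP; split=> [w ->|w h /=]; first by move=> i; rewrite lexx.
  by apply/rowP => i; apply/eqP; rewrite eq_le andbC; exact: h.
- by move=> w /= /negP; rewrite negbK => /eqP.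
Qed.

End sign.

Section nonnegative_kernel.
Context {R : realType} {d : nat}.
Local Notation V := 'rV[R]_d.
Local Notation lebV := (lebesgue_rV d).

Variables (beta : R) (b : V -> V -> R) (q : R -> V -> V -> R) (M eps c1 c2 : R).
Hypotheses (d_ge1 : (1 <= d)%N) (beta_gt0 : 0 < beta) (beta_lt2 : beta < 2).
Hypothesis mb : measurable_fun [set: V * V] (fun p : V * V => b p.1 p.2).
Hypothesis bM : forall x z, `|b x z| <= M.
Hypothesis b_sym : forall x z, b x z = b x (- z).
Hypothesis b_cont : {ae lebV, forall z, continuous (fun x => b x z)}.
Hypothesis cq : {within [set p : R * V * V | 0 < p.1.1],
      continuous (fun p => q p.1.1 p.1.2 p.2)}.
Hypotheses (eps0 : 0 < eps) (c10 : 0 < c1) (c20 : 0 < c2).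
Hypothesis q_le : forall (t : R) x y, 0 < t <= eps ->
  `|q t x y| <= c1 * heat_kernel beta 1 t (c2 *: x) (c2 *: y).
Hypothesis q_duhamel : forall (t : R) x y, 0 < t <= eps ->
  q t x y = heat_kernel beta 0 t x y +
          \int[lebesgue_measure]_(s in `]0, t[)
            \int[lebesgue_rV d]_z
              (q (t - s) x z *
               nonlocal_op beta b (fun w => heat_kernel beta 0 s w y) z).
Hypothesis q_ge0 : forall (t : R) x y, 0 < t -> 0 <= q t x y.

Lemma jump_mean_quartic_ge0 (x0 : V) (h : V -> R) : test_function h -> unit_valued h ->
  rintegrable lebV (fun w => jump beta b x0 w * (quartic w * h w)) /\
  0 <= \int[lebV]_w (jump beta b x0 w * (quartic w * h w)).
Proof.
move=> th h01; pose f y := quartic (y - x0) * h (y - x0).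
have tf : test_function f.
  exact: (test_shift x0 (testM test_quartic th)).
have [mf [B fB] _ _] := tf; have cf := test_continuous tf.
have [C fC] := test_levy_cut beta_gt0 beta_lt2 tf.
have h0 y : 0 <= h y by have /andP[] := h01 y.
have f0 y : 0 <= f y by rewrite mulr_ge0 ?quartic_ge0.
have fB' y : f y <= B := le_trans (ler_norm _) (fB y).
have f4 y : f y <= d%:R * dotrV (x0 - y) (x0 - y) ^+ 2.
  apply: le_trans (quartic_le (x0 - y)); rewrite -quarticN opprB.
  by rewrite ler_piMr ?quartic_ge0//; have /andP[] := h01 (y - x0).
have fx0 : f x0 = 0.
  apply/eqP; rewrite eq_le f0 andbT; apply: le_trans (f4 x0) _.
  by rewrite subrr dotrV0 expr0n mulr0.
have fE w : f (x0 + w) = quartic w * h w by rewrite /f addrAC subrr add0r.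
split.
  have := rintegrable_jump_mean d_ge1 beta_gt0 beta_lt2 mb bM mf f0 fx0 fC.
  by apply: eq_integrable => // w _; rewrite fE.
have := jump_mean_ge0 d_ge1 beta_gt0 beta_lt2 mb bM b_sym b_cont cq eps0 c10 c20
  q_le q_duhamel q_ge0 mf cf f0 fB' fx0 fC (ler0n R d) f4.
rewrite (_ : jump_mean _ _ _ _ = \int[lebV]_w (jump beta b x0 w * (quartic w * h w)))//.
by apply: eq_Rint => w; rewrite fE.
Qed.

Lemma jump_intensity_ge0 (x0 : V) : {ae lebV, forall z, 0 <= b x0 z}.
Proof.
have one01 : unit_valued (fun _ : V => 1 : R) by move=> w; rewrite ler01 lexx.
have [i1 _] := jump_mean_quartic_ge0 x0 (test_cst 1) one01.
have iG : rintegrable lebV (fun w => quartic w * jump beta b x0 w).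
  by move: i1; apply: eq_integrable => // w _; rewrite mulr1 mulrC.
have Gh h : test_function h -> unit_valued h -> 0 <= \int[lebV]_w (h w * (quartic w * jump beta b x0 w)).
  move=> th h01; have [_] := jump_mean_quartic_ge0 x0 th h01.
  rewrite (_ : \int[lebV]_w _ = \int[lebV]_w (h w * (quartic w * jump beta b x0 w)))//.
  by apply: eq_Rint => w; ring.
apply: filterS2 (ae_ge0_of_test_functions iG Gh) (ae_neq0 d_ge1) => w + w0.
rewrite pmulr_rge0 ?quartic_gt0// /jump pmulr_lge0// /levy invr_gt0 powR_gt0//.
by rewrite lt0r enorm_eq0 w0 enorm_ge0.
Qed.

End nonnegative_kernel.

(** The Chapman--Kolmogorov equation doubles the time interval. *)
Lemma chapman_kolmogorov_ge0 {R : realType} {d : nat} (q : R -> 'rV[R]_d -> 'rV[R]_d -> R) (t0 : R) :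
  chapman_kolmogorov q -> 0 < t0 -> (forall t x y, 0 < t < t0 -> 0 <= q t x y) ->
  forall t x y, 0 < t -> 0 <= q t x y.
Proof.
move=> ck t00 q0 t x y tp.
have dbl n : forall t x y, 0 < t < 2 ^+ n * t0 -> 0 <= q t x y.
  elim: n => [|n IH] s u v; first by rewrite expr0 mul1r; exact: q0.
  rewrite exprS -mulrA => /andP[s0 st]; have s2 : 0 < s / 2 by rewrite divr_gt0.
  rewrite [s]splitr -ck//; apply: Rintegral_ge0 => z _.
  by rewrite mulr_ge0// IH// s2 ltr_pdivrMr// mulrC.
have [n tn] : exists n : nat, t < 2 ^+ n * t0.
  exists (Num.bound (t / t0)).
  rewrite -ltr_pdivrMr//; apply: lt_trans (archi_boundP (ltW (divr_gt0 tp t00))) _.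
  by rewrite -natrX ltr_nat ltn_expl.
by apply: (dbl n); rewrite tp.
Qed.

Theorem theorem1p2 (R : realType) (d : nat) (beta : R)
    (b : 'rV[R]_d -> 'rV[R]_d -> R) (q : R -> 'rV[R]_d -> 'rV[R]_d -> R)
    (d_ge1 : (1 <= d)%N) (beta_gt0 : 0 < beta) (beta_lt2 : beta < 2)
    (b_measurable : measurable_fun [set: 'rV[R]_d * 'rV[R]_d]
       (fun p : 'rV[R]_d * 'rV[R]_d => b p.1 p.2))
    (b_bounded : exists M : R, forall x z, `|b x z| <= M)
    (b_sym : forall x z, b x z = b x (- z))
    (b_continuous : {ae lebesgue_rV d, forall z, continuous (fun x => b x z)})
    (q_fundsol : is_fundamental_solution beta b q) :
  (forall (t : R) (x y : 'rV[R]_d), 0 < t -> 0 <= q t x y) <->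
  (forall x : 'rV[R]_d, {ae lebesgue_rV d, forall z, 0 <= b x z}).
Proof.
have [M bM] := b_bounded.
have [cq ck [eps [c1 [c2 [e0 c10 c20 H]]]]] := q_fundsol.
have q_le (t : R) x y : 0 < t <= eps -> `|q t x y| <= c1 * heat_kernel beta 1 t (c2 *: x) (c2 *: y).
  by move=> /(H t x y)[].
have q_duhamel (t : R) x y : 0 < t <= eps -> q t x y = heat_kernel beta 0 t x y +
    \int[lebesgue_measure]_(s in `]0, t[) \int[lebesgue_rV d]_z
      (q (t - s) x z * nonlocal_op beta b (fun w => heat_kernel beta 0 s w y) z).
  by move=> /(H t x y)[].
split=> [q_ge0 x|b_ge0].
  exact: (jump_intensity_ge0 d_ge1 beta_gt0 beta_lt2 b_measurable bM b_sym b_continuous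
    cq e0 c10 c20 q_le q_duhamel q_ge0 x).
have [C [kappa [C0 k0 tw]]] := int_time_weight (theta_gt0 beta_gt0) (theta_lt1 beta_lt2).
have M0 : 0 <= M := le_trans (normr_ge0 _) (bM 0 0).
pose A : R := M * @levy_mass R d beta.
have A0 : 0 <= A.
  rewrite mulr_ge0//; apply: Rintegral_ge0 => w _.
  by rewrite mulr_ge0 ?levy_cut_ge0 ?levy_ge0.
have AC0 : 0 <= 2 * A * C by apply: mulr_ge0 => //; exact: mulr_ge0.
have half0 : 0 < 2^-1 :> R by rewrite invr_gt0.
have [dl /andP[dl0 dl1] dlP] := powR_small AC0 k0 half0.
pose t0 := Num.min dl eps.
have t00 : 0 < t0 by rewrite lt_min dl0.
have t01 : t0 <= 1 by rewrite ge_min dl1.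
have t0e : t0 <= eps by rewrite ge_min lexx orbT.
have t0P : 0 < t0 <= 1 by rewrite t00.
apply: (chapman_kolmogorov_ge0 ck t00) => t x y tt0.
apply: (fundsol_ge0_small d_ge1 beta_gt0 beta_lt2 b_measurable bM b_sym cq c10 c20
  q_le q_duhamel b_ge0 t00 t01 t0e (tw t0 t0P) _ x y tt0).
apply: le_trans dlP; rewrite mulrA ler_wpM2l//.
have t0dl : t0 <= dl by rewrite ge_min lexx.
by apply: ge0_ler_powR; rewrite ?nnegrE ?(ltW k0) ?(ltW t00) ?(ltW dl0).
Qed.
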